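(* Let $\{Q_i\}_{i\in\Lambda}$ be a set of key polynomials for $\nu$, and assume $\operatorname{char}k_\nu=\operatorname{char}K=p>0$. Let $\ell\in\Lambda$ be such that $\ell+\omega\in\Lambda$, $\alpha_{\ell+t}=1$ for all $t\in\mathbb N$, and the sequence $\{\nu(Q_{\ell+t})\}_{t\in\mathbb N}$ is bounded in $\tilde\Gamma_0$. Let $\bar\beta=\sup\{\nu(Q_{\ell+t}):t\in\mathbb N\}\in\mathbb R$, let $\delta$ be the stable value of $\delta_{\ell+t}(Q_{\ell+\omega})$ for large $t\in\mathbb N$, and write $\delta=p^{e_0}$ (it is known that $\delta$ is a power of $p$). Then the limit key polynomial $Q_{\ell+\omega}$ can be chosen (that is, there is a monic polynomial which may replace $Q_{\ell+\omega}$ so that $\{Q_i\}_{i<\ell+\omega}\cup\{Q_{\ell+\omega}\}$ is still a set of key polynomials for $\nu$) in such a way that there exists $i\in\{\ell+t\}_{t\in\mathbb N_0}$ for which the $i$-standard expansion $Q_{\ell+\omega}=\sum_{j=0}^{\delta}c_{j,i}Q_i^j$ is monic of degree $p^{e_0}$ in $Q_i$ and weakly affine, with $$\bar\beta\le\frac1{p^{e_0}}\,\nu(Q_{\ell+\omega})\quad(\text{i.e. }p^{e_0}\nu(Q_{\ell+t})\le\nu(Q_{\ell+\omega})\text{ for all }t\in\mathbb N)$$ and $$\nu(c_{j,i})=(p^{e_0}-j)\bar\beta\quad\text{whenever }j>0\text{ and }c_{j,i}\neq0.$$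
   Context: Setting. $K\subset K(x)$ is a simple transcendental extension, $\nu$ a valuation of $K(x)$ with value group $\Gamma$ and residue field $k_\nu$, $\nu_K=\nu|_K$ with value group $\Gamma_0$; $\operatorname{rank}\nu_K=1$, $\nu(x)>0$. $\tilde\Gamma_0=\Gamma_0\otimes_{\mathbb Z}\mathbb Q$, with a fixed ordered embedding into $\mathbb R$; values are compared in $\Gamma\otimes\mathbb Q$. $\mathbb N$ = positive integers, $\mathbb N_0=\mathbb N\cup\{0\}$. $G_\nu=\bigoplus_{\beta\in\Gamma}\mathbf P_\beta/\mathbf P_{\beta+}$ with $\mathbf P_\beta=\{y\in K(x):\nu(y)\ge\beta\}$, $\mathbf P_{\beta+}=\{y:\nu(y)>\beta\}$; $\mathrm{in}_\nu y$ is the class of $y$ in degree $\nu(y)$; $G_{\nu_K}$ is the analogous algebra for $(K,\nu_K)$. For a graded domain $G$, $G^*=\{g/h: g,h\in G,\ h\ne0 \text{ homogeneous}\}$. Index sets. $\Lambda$ is a countable well ordered set with least element $0$; $i+1$ is the successor of $i$, etc. $(\alpha_i)_{i\in\Lambda}$ are positive integers, $\alpha_0=1$. $i$ is inessential if $i+\omega\in\Lambda$ and $\alpha_{i+t}=1$ for all $t\in\mathbb N_0$. For non-maximal $i$, $i+$ denotes $i+\omega$ if $i$ is inessential, and $i+1$ otherwise. Pre-key polynomials: monic $Q_i\in K[x]$ $(i\in\Lambda)$, $Q_0=x$, with $\deg Q_i=\alpha_i\deg Q_{i_0}$ for all non-maximal $i\ge1$ and $i_0<i$ with $i_0+=i$.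 Put $\beta_i=\nu(Q_i)$, $\bar\alpha_i=\deg_xQ_i$, $\mathbf Q_i=\{Q_q\}_{q<i}$. Standard expansions. An $\ell$-standard monomial is $c\prod_{i\le\ell}Q_i^{\gamma_i}$, $c\in K$, $\gamma_i\in\mathbb N_0$ almost all $0$, with $\gamma_i<\alpha_{i+}$ for $i<\ell$ and, for each inessential $i$, at most one $j$ with $j+=i+$ and $\gamma_j\neq0$ (here $i+$ is computed in $\{q\in\Lambda:q\le\ell\}$). It is $Q_\ell$-free if $\gamma_\ell=0$. A $Q_\ell$-free $\ell$-standard expansion is a finite sum of $Q_\ell$-free $\ell$-standard monomials whose $\nu$-value is the minimum of the values of the monomials. An $\ell$-standard expansion of $g\in K[x]$ is $g=\sum_jc_jQ_\ell^j$ with each $c_j$ a $Q_\ell$-free $\ell$-standard expansion. It is weakly affine if $c_j=0$ whenever $j>0$ and $j$ is not of the form $p^e$, $e\in\mathbb N_0$. Set of key polynomials for $\nu$: a set of pre-key polynomials such that (a) $\beta_i\in\tilde\Gamma_0$ for $i\ne\max\Lambda$; (b) if $i\ge1$ has an immediate predecessor, $Q_i$ has an $(i-1)$-standard expansion $Q_i=Q_{i-1}^{\alpha_i}+\sum_{j<\alpha_i}\big(\sum_\gamma c_{j,\gamma}M_\gamma\big)Q_{i-1}^j$ where the $c_{j,\gamma}M_\gamma$ are $Q_{i-1}$-free $(i-1)$-standard monomials ($c_{j,\gamma}\in K$, $M_\gamma$ a product of powers of elements of $\mathbf Q_{i-1}$; elements of $K$ if $i=1$), all the monomials appearing have the same $\nu$-value,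 and $(\mathrm{in}_\nu Q_{i-1})^{\alpha_i}+\sum_{j}\big(\sum_\gamma \mathrm{in}_{\nu_K}c_{j,\gamma}\,\mathrm{in}_\nu M_\gamma\big)(\mathrm{in}_\nu Q_{i-1})^j=0$ is the minimal algebraic relation of $\mathrm{in}_\nu Q_{i-1}$ over $G_{\nu_K}[\mathrm{in}_\nu\mathbf Q_{i-1}]^*$; (c) if $i\geq 1$ has no immediate predecessor, there is $i_0$ with $i_0+=i$, and for every such $i_0$ there is an $i_0$-standard expansion $Q_i=\sum_{j=0}^{\alpha_i}c_{j,i_0}Q_{i_0}^j$; every such expansion satisfies $\nu(Q_i)>\min_j\nu(c_{j,i_0}Q_{i_0}^j)$, and $Q_i$ has the smallest degree among polynomials with this property for all $i_0$ with $i_0+=i$; if $\{\beta_{i'}:i'<i\}$ is bounded in $\tilde\Gamma_0$ (in particular if $i\ne\max\Lambda$) then $c_{\alpha_i,i_0}=1$ and $\min_j\nu(c_{j,i_0}Q_{i_0}^j)=\alpha_i\beta_{i_0}=\nu(c_{0,i_0})$; (d) if for some $n$ the set $\{i:\deg Q_i=n\}$ is infinite, then $\{\nu(Q_i):\deg Q_i=n\}$ is cofinal in $\{\nu(f): f\in K[x]\text{ monic},\deg f=n\}$. Truncations. Each $f\in K[x]$ has a unique $Q_i$-expansion $f=\sum_jd_{j,i}Q_i^j$ with $\deg d_{j,i}<\deg Q_i$; put $\nu_i(f)=\min_j\{\nu(d_{j,i})+j\beta_i\}$. For $f\ne0$, $S_i(f)=\{j: d_{j,i}\neq 0,\ \nu(d_{j,i})+j\beta_i=\nu_i(f)\}$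 and $\delta_i(f)=\max S_i(f)$. (For $i=\ell+t$, $t\in\mathbb N$, $\delta_i(f)$ is eventually constant in $t$.)
   Formalization: Condition (d) for the new family {Q_i}_{i<ℓ+ω}∪{Q_{ℓ+ω}} is asserted only if the original {Q_i}_{i≤ℓ+ω} satisfies (d); this is automatic if α_{ℓ+ω}>1, and for δ=1 the unconditional claim can fail when later Q_i of the same degree have values without maximum. *)

(* Defs.v *)
From HB Require Import structures.
From mathcomp Require Import all_boot all_order all_algebra.
From mathcomp Require Import generic_quotient ring_quotient.
From mathcomp Require Import finmap.
From mathcomp Require Import boolp classical_sets cardinality reals.

Set Implicit Arguments.
Unset Strict Implicit.
Unset Printing Implicit Defensive.

Import Order.TTheory GRing.Theory Num.Theory.

Local Open Scope classical_set_scope.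
Local Open Scope ring_scope.
Local Open Scope quotient_scope.

(* A record over [porderZmodType], which has no compatibility axiom: mathcomp has
   no structure of ordered abelian groups. *)
Record ozmodType := OZmodType {
  ozmod_sort :> porderZmodType;
  ozmod_total : total (<=%R : rel ozmod_sort);
  ozmod_leD2r : forall z x y : ozmod_sort, x <= y -> x + z <= y + z
}.

(* [vinf V] is V with a largest element, written [\top] and represented by
   [None], added; it is where valuations take their values, and 0 is the only
   element of value [\top]. *)
Definition vinf (V : ozmodType) : Type := option V.

Notation Fin a := (Some a : vinf _).

Section Vinf.
Variable V : ozmodType.
Implicit Types a b c : vinf V.

HB.instance Definition _ := Choice.copy (vinf V) (option V).

Definition vinf_le a b : bool :=
  match a, b with
  | _, None => true
  | None, Some _ => false
  | Some x, Some y => x <= y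
  end.

Definition vinf_lt a b : bool := (b != a) && vinf_le a b.

Lemma vinf_le_refl : reflexive vinf_le.
Proof. by case=> //= x; apply: lexx. Qed.

Lemma vinf_le_anti : antisymmetric vinf_le.
Proof. by case=> [x|] [y|] //= /le_anti ->. Qed.

Lemma vinf_le_trans : transitive vinf_le.
Proof. by case=> [x|] [y|] [z|] //=; apply: le_trans. Qed.

Lemma vinf_le_total : total vinf_le.
Proof. by case=> [x|] [y|] //=; apply: ozmod_total. Qed.

HB.instance Definition _ := Order.isPOrder.Build ring_display (vinf V)
  (fun _ _ => erefl) vinf_le_refl vinf_le_anti vinf_le_trans.
HB.instance Definition _ :=
  Order.POrder_isTotal.Build ring_display (vinf V) vinf_le_total.

Lemma vinf_le_top (a : vinf V) : a <= (None : vinf V).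
Proof. by case: a. Qed.

HB.instance Definition _ :=
  Order.hasTop.Build ring_display (vinf V) vinf_le_top.

Definition vadd a b : vinf V :=
  if (a, b) is (Some x, Some y) then Some (x + y) else None.

End Vinf.

Record valuation (F : fieldType) (V : ozmodType) := Valuation {
  val_fun :> F -> vinf V;
  val_top : forall y, val_fun y = \top%O <-> y = 0;
  valM : forall y z, val_fun (y * z) = vadd (val_fun y) (val_fun z);
  valD : forall y z, Num.min (val_fun y) (val_fun z) <= val_fun (y + z)
}.

Section ValuationTheory.
Variables (F : fieldType) (V : ozmodType) (nu : valuation F V).
Implicit Types (y z : F) (a b : V).

Lemma ozD2r a b (c : V) : (a + c <= b + c) = (a <= b).
Proof.
apply/idP/idP; last exact: ozmod_leD2r.
by move/(ozmod_leD2r (- c)); rewrite !addrK.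
Qed.

Lemma ozleD a b (c d : V) : a <= b -> c <= d -> a + c <= b + d.
Proof.
move=> ab cd; apply: (@le_trans _ _ (b + c)); first by rewrite ozD2r.
by rewrite ![b + _]addrC ozD2r.
Qed.

Lemma val0 : nu 0 = None.
Proof. exact/(val_top nu 0). Qed.

Lemma val1 : nu 1 = Some 0.
Proof.
have := valM nu 1 1; rewrite mulr1.
case E : (nu 1) => [a|] /=; last by move=> _; move/val_top/eqP: E; rewrite oner_eq0.
by case=> /eqP; rewrite -subr_eq subrr => /eqP ->.
Qed.

Lemma valN1 : nu (- 1) = Some 0.
Proof.
have := valM nu (-1) (-1); rewrite mulrNN mulr1 val1.
case E : (nu (- 1)) => [a|] //= -[] /esym a2.
have /orP[a0|a0] := ozmod_total 0 a; congr Some; apply: le_anti.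
  by have := ozleD (lexx a) a0; rewrite addr0 a2 a0 => ->.
by have := ozleD (lexx a) a0; rewrite addr0 a2 a0 => ->.
Qed.

Lemma valN y : nu (- y) = nu y.
Proof. by rewrite -mulN1r valM valN1; case: (nu y) => [a|] //=; rewrite /vadd add0r. Qed.

Lemma val_leD (a : V) y z :
  Fin a <= nu y -> Fin a <= nu z -> Fin a <= nu (y + z).
Proof. by move=> ay az; apply: le_trans (valD nu y z); rewrite le_min ay. Qed.

Lemma val_ltD (a : V) y z :
  Fin a < nu y -> Fin a < nu z -> Fin a < nu (y + z).
Proof. by move=> ay az; apply: lt_le_trans (valD nu y z); rewrite lt_min ay. Qed.

Lemma val_leM a b y z :
  Fin a <= nu y -> Fin b <= nu z -> Fin (a + b) <= nu (y * z).
Proof.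
by rewrite valM; case: (nu y) => [c|]; case: (nu z) => [d|] //; apply: ozleD.
Qed.

Lemma vinf_ltE a b : (Fin a < Fin b) = (a < b).
Proof. by rewrite [LHS]lt_neqAle [RHS]lt_neqAle. Qed.

Lemma val_ltM a b y z :
  Fin a <= nu y -> Fin b < nu z -> Fin (a + b) < nu (y * z).
Proof.
rewrite valM; case: (nu y) => [c|]; case: (nu z) => [d|] //.
rewrite /= !vinf_ltE => ac; rewrite !lt_neqAle => /andP[bd bd'].
rewrite [X in _ && X](ozleD ac bd') andbT; apply: contra bd => /eqP E.
apply/eqP/le_anti; rewrite bd' /=.
have : d + c <= b + c by rewrite [d + c]addrC -E addrC; exact: ozleD.
by rewrite ozD2r.
Qed.

Lemma val_lt0 (a : V) : Fin a < nu 0.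
Proof. by rewrite val0. Qed.

Definition value_group : set V := [set v | exists y, nu y = Fin v].

End ValuationTheory.

Section Restriction.
Variables (K F : fieldType) (V : ozmodType) (nu : valuation F V).
Variable f : {rmorphism K -> F}.

Lemma restr_top y : nu (f y) = \top%O <-> y = 0.
Proof.
split=> [/val_top/eqP|->]; first by rewrite fmorph_eq0 => /eqP.
by rewrite rmorph0; apply/val_top.
Qed.

Lemma restrM y z : nu (f (y * z)) = vadd (nu (f y)) (nu (f z)).
Proof. by rewrite rmorphM valM. Qed.

Lemma restrD y z : Num.min (nu (f y)) (nu (f z)) <= nu (f (y + z)).
Proof. by rewrite rmorphD valD. Qed.

Definition restriction : valuation K V := Valuation restr_top restrM restrD.

End Restriction.

Section Rank.
Variable V : ozmodType.

Definition convex_subgroup (G H : set V) : Prop :=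
  [/\ H `<=` G, H 0, forall x y, H x -> H y -> H (x - y)
    & forall x y, H x -> G y -> 0 <= y -> y <= x -> H y].

Definition rank_one (G : set V) : Prop :=
  G <> [set 0] /\ forall H, convex_subgroup G H -> H = [set 0] \/ H = G.

(* G (x) Q, computed inside a divisible V. *)
Definition divisible_hull (G : set V) : set V :=
  [set v | exists2 n : nat, (0 < n)%N & G (v *+ n)].

(* Characterizes V as the ordered group G (x) Q: an ordered group is torsion-free,
   hence uniquely divisible as soon as it is divisible, and its order is determined
   by that of G. A valuation with value group Gamma is thus viewed as a map to
   V = Gamma (x) Q whose set of finite values is Gamma. *)
Definition is_tensor_rat (G : set V) : Prop :=
  (forall (v : V) (n : nat), (0 < n)%N -> exists w, w *+ n = v) /\
  divisible_hull G = [set: V].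

(* phi is only meaningful on G. *)
Definition ordered_embedding (R : realType) (G : set V) (phi : V -> R) : Prop :=
  (forall u v, G u -> G v -> phi (u + v) = phi u + phi v) /\
  (forall u v, G u -> G v -> u < v -> phi u < phi v).

End Rank.

Section Residue.
Variables (F : fieldType) (V : ozmodType) (nu : valuation F V).

Definition vring_pred : {pred F} := fun y => Fin 0 <= nu y.

Lemma vring_subring : subring_closed vring_pred.
Proof.
split=> [|y z yO zO|y z yO zO]; rewrite /in_mem /= /vring_pred.
- by rewrite val1.
- by apply: val_leD; rewrite ?valN.
- by rewrite -[X in Some X]addr0; apply: val_leM.
Qed.

HB.instance Definition _ := GRing.isSubringClosed.Build F vring_pred vring_subring.

Record vring := VRing { vring_val : F; vring_valP : vring_val \in vring_pred }.

HB.instance Definition _ := [isSub for vring_val].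
HB.instance Definition _ := [Choice of vring by <:].
HB.instance Definition _ := [SubChoice_isSubComNzRing of vring by <:].

Definition vmax : {pred vring} := fun y => Fin 0 < nu (val y).

Lemma vmax_ideal : idealr_closed vmax.
Proof.
split; rewrite /in_mem /= /vmax.
- by rewrite rmorph0 val_lt0.
- by rewrite rmorph1 val1 ltxx.
- move=> a u v um vm; rewrite rmorphD rmorphM; apply: val_ltD => //.
  by rewrite -[X in Some X]addr0; apply: val_ltM => //; apply: (valP a).
Qed.

HB.instance Definition _ := isIdealr.Build vring vmax vmax_ideal.

(* The quotient of the valuation ring by its maximal ideal, with its ring structure
   only: no field instance is needed to speak of its characteristic. *)
Definition residue_field : comNzRingType := {ideal_quot vmax}.

End Residue.

(* An element of G_nu is represented by a list of pairs (beta, y) with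
   y in P_beta, read as the sum of the classes of the y in degree beta. Two lists
   represent the same element when, in each degree beta, the sums of their
   entries of degree beta agree modulo P_{beta+}. For beta in V but not in the
   value group, P_beta = P_{beta+}, so that degrees may range over all of V. *)
Section Graded.
Variables (F : fieldType) (V : ozmodType) (nu : valuation F V).

Definition gr_valid (s : seq (V * F)) : bool :=
  all (fun t => Fin t.1 <= nu t.2) s.

Record gr_raw := GrRaw { gr_seq : seq (V * F); gr_seqP : gr_valid gr_seq }.

HB.instance Definition _ := [isSub for gr_seq].
HB.instance Definition _ := [Choice of gr_raw by <:].

Definition gr_comp (s : seq (V * F)) (b : V) : F :=
  \sum_(t <- s | t.1 == b) t.2.

Definition gr_eqv (s s' : gr_raw) : bool :=
  `[< forall b, Fin b < nu (gr_comp (gr_seq s) b - gr_comp (gr_seq s') b) >].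

Lemma gr_eqvxx : reflexive gr_eqv.
Proof. by move=> s; apply/asboolP => b; rewrite subrr val_lt0. Qed.

Lemma gr_eqv_sym : symmetric gr_eqv.
Proof.
by move=> s s'; apply/asboolP/asboolP => H b; rewrite -opprB valN.
Qed.

Lemma gr_eqv_trans : transitive gr_eqv.
Proof.
move=> s s' s'' /asboolP H1 /asboolP H2; apply/asboolP => b.
by rewrite -(subrKA (gr_comp (gr_seq s) b)) val_ltD.
Qed.

Canonical gr_equiv := EquivRel gr_eqv gr_eqvxx gr_eqv_sym gr_eqv_trans.

Definition gr := {eq_quot gr_equiv}.

HB.instance Definition _ := Choice.on gr.
HB.instance Definition _ := EqQuotient.on gr.

Lemma gr_zero_valid : gr_valid [::]. Proof. by []. Qed.
Definition graw0 := GrRaw gr_zero_valid.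

Lemma gr_one_valid : gr_valid [:: (0, 1)].
Proof. by rewrite /gr_valid /= val1 lexx. Qed.
Definition graw1 := GrRaw gr_one_valid.

Lemma gr_opp_valid (s : gr_raw) : gr_valid [seq (t.1, - t.2) | t <- gr_seq s].
Proof.
rewrite /gr_valid all_map; apply/allP => t ts /=; rewrite valN.
exact: (allP (gr_seqP s)).
Qed.
Definition graw_opp s := GrRaw (gr_opp_valid s).

Lemma gr_add_valid (s s' : gr_raw) : gr_valid (gr_seq s ++ gr_seq s').
Proof. by rewrite /gr_valid all_cat; apply/andP; split; apply: gr_seqP. Qed.
Definition graw_add s s' := GrRaw (gr_add_valid s s').

Definition seq_mul (s s' : seq (V * F)) : seq (V * F) :=
  [seq (t.1 + u.1, t.2 * u.2) | t <- s, u <- s'].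

Lemma gr_mul_valid (s s' : gr_raw) : gr_valid (seq_mul (gr_seq s) (gr_seq s')).
Proof.
apply/allP => _ /allpairsP[[t u] /= [ts us ->]] /=.
by apply: val_leM; [apply: (allP (gr_seqP s)) | apply: (allP (gr_seqP s'))].
Qed.
Definition graw_mul s s' := GrRaw (gr_mul_valid s s').

Lemma gr_comp0 b : gr_comp [::] b = 0.
Proof. by rewrite /gr_comp big_nil. Qed.

Lemma gr_compD s s' b : gr_comp (s ++ s') b = gr_comp s b + gr_comp s' b.
Proof. by rewrite /gr_comp big_cat. Qed.

Lemma gr_compN s b : gr_comp [seq (t.1, - t.2) | t <- s] b = - gr_comp s b.
Proof. by rewrite /gr_comp big_map /= sumrN. Qed.

Lemma big_seq_mul (G : V * F -> F) s s' : \sum_(t <- seq_mul s s') G t =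
  \sum_(t <- s) \sum_(u <- s') G (t.1 + u.1, t.2 * u.2).
Proof.
elim: s => [|t s IH]; first by rewrite !big_nil.
by rewrite /seq_mul /= big_cat big_map big_cons -IH.
Qed.

Lemma gr_compM s s' b :
  gr_comp (seq_mul s s') b = \sum_(t <- s) t.2 * gr_comp s' (b - t.1).
Proof.
rewrite /gr_comp big_mkcond big_seq_mul; apply: eq_bigr => t _ /=.
rewrite mulr_sumr [RHS]big_mkcond; apply: eq_bigr => u _.
by rewrite [u.1 == _]eq_sym subr_eq eq_sym [u.1 + _]addrC.
Qed.

Lemma gr_compMC s s' b : gr_comp (seq_mul s s') b = gr_comp (seq_mul s' s) b.
Proof.
rewrite /gr_comp big_mkcond [RHS]big_mkcond !big_seq_mul exchange_big /=.
by apply: eq_bigr => t _; apply: eq_bigr => u _; rewrite addrC mulrC.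
Qed.

Lemma gr_compMA s s' s'' b :
  gr_comp (seq_mul s (seq_mul s' s'')) b = gr_comp (seq_mul (seq_mul s s') s'') b.
Proof.
rewrite /gr_comp big_mkcond [RHS]big_mkcond !big_seq_mul.
apply: eq_bigr => t _; rewrite big_seq_mul; apply: eq_bigr => u _.
by apply: eq_bigr => v _ /=; rewrite addrA mulrA.
Qed.

Lemma gr_compMDl s s' s'' b : gr_comp (seq_mul (s ++ s') s'') b =
  gr_comp (seq_mul s s'' ++ seq_mul s' s'') b.
Proof. by rewrite gr_compD !gr_compM big_cat. Qed.

Lemma gr_comp1M s b : gr_comp (seq_mul [:: (0, 1)] s) b = gr_comp s b.
Proof. by rewrite gr_compM big_seq1 subr0 mul1r. Qed.

Lemma gr_piP (s s' : gr_raw) :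
  (forall b, Fin b < nu (gr_comp (gr_seq s) b - gr_comp (gr_seq s') b)) ->
  \pi_gr s = \pi_gr s'.
Proof. by move=> H; apply/eqmodP/asboolP. Qed.

Lemma gr_piE (s s' : gr_raw) :
  (forall b, gr_comp (gr_seq s) b = gr_comp (gr_seq s') b) ->
  \pi_gr s = \pi_gr s'.
Proof. by move=> H; apply: gr_piP => b; rewrite H subrr val_lt0. Qed.

Lemma gr_repr (s : gr_raw) b : Fin b <
  nu (gr_comp (gr_seq s) b - gr_comp (gr_seq (repr (\pi_gr s))) b).
Proof.
have /eqmodP/asboolP : s = repr (\pi_gr s) %[mod gr] by rewrite reprK.
exact.
Qed.

Definition gr_zero : gr := lift_cst gr graw0.
Definition gr_one : gr := lift_cst gr graw1.
Definition gr_opp : gr -> gr := lift_op1 gr graw_opp.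
Definition gr_add : gr -> gr -> gr := lift_op2 gr graw_add.
Definition gr_mul : gr -> gr -> gr := lift_op2 gr graw_mul.

Canonical pi_gr_zero := PiConst gr_zero.
Canonical pi_gr_one := PiConst gr_one.

Lemma pi_gr_opp : {morph \pi_gr : s / graw_opp s >-> gr_opp s}.
Proof.
move=> s; unlock gr_opp; apply: gr_piP => b /=.
by rewrite !gr_compN -opprD valN gr_repr.
Qed.
Canonical pi_gr_opp_morph := PiMorph1 pi_gr_opp.

Lemma pi_gr_add : {morph \pi_gr : s s' / graw_add s s' >-> gr_add s s'}.
Proof.
move=> s s'; unlock gr_add; apply: gr_piP => b /=.
by rewrite !gr_compD opprD addrACA val_ltD ?gr_repr.
Qed.
Canonical pi_gr_add_morph := PiMorph2 pi_gr_add.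

Lemma gr_mul_congr (s s' u : gr_raw) : \pi_gr s = \pi_gr s' ->
  \pi_gr (graw_mul u s) = \pi_gr (graw_mul u s').
Proof.
move=> /eqmodP/asboolP ss'; apply: gr_piP => b /=.
rewrite !gr_compM -sumrB big_seq.
apply: (big_ind (fun y => Fin b < nu y)); first exact: val_lt0.
  by move=> y z; apply: val_ltD.
move=> t tu; rewrite -mulrBr -[X in Some X](subrK t.1) addrC.
by apply: val_ltM (ss' _); apply: (allP (gr_seqP u)).
Qed.

Lemma graw_mulC (s s' : gr_raw) :
  \pi_gr (graw_mul s s') = \pi_gr (graw_mul s' s).
Proof. by apply: gr_piE => b /=; rewrite gr_compMC. Qed.

Lemma pi_gr_mul : {morph \pi_gr : s s' / graw_mul s s' >-> gr_mul s s'}.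
Proof.
move=> s s'; unlock gr_mul.
rewrite (gr_mul_congr _ (esym (reprK (\pi_gr s')))) graw_mulC.
by rewrite (gr_mul_congr _ (esym (reprK (\pi_gr s)))) graw_mulC.
Qed.
Canonical pi_gr_mul_morph := PiMorph2 pi_gr_mul.

Lemma gr_addA : associative gr_add.
Proof.
elim/quotW=> s; elim/quotW=> s'; elim/quotW=> s''; rewrite !piE.
by apply: gr_piE => b /=; rewrite catA.
Qed.

Lemma gr_addC : commutative gr_add.
Proof.
elim/quotW=> s; elim/quotW=> s'; rewrite !piE.
by apply: gr_piE => b /=; rewrite !gr_compD addrC.
Qed.

Lemma gr_add0 : left_id gr_zero gr_add.
Proof. by elim/quotW=> s; rewrite !piE; apply: gr_piE. Qed.

Lemma gr_addN : left_inverse gr_zero gr_opp gr_add.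
Proof.
elim/quotW=> s; rewrite !piE; apply: gr_piE => b /=.
by rewrite gr_compD gr_compN addNr gr_comp0.
Qed.

HB.instance Definition _ :=
  GRing.isZmodule.Build gr gr_addA gr_addC gr_add0 gr_addN.

Lemma gr_mulA : associative gr_mul.
Proof.
elim/quotW=> s; elim/quotW=> s'; elim/quotW=> s''; rewrite !piE.
by apply: gr_piE => b /=; rewrite gr_compMA.
Qed.

Lemma gr_mulC : commutative gr_mul.
Proof. by elim/quotW=> s; elim/quotW=> s'; rewrite !piE graw_mulC. Qed.

Lemma gr_mul1 : left_id gr_one gr_mul.
Proof.
by elim/quotW=> s; rewrite !piE; apply: gr_piE => b; rewrite gr_comp1M.
Qed.

Lemma gr_mulDl : left_distributive gr_mul gr_add.
Proof.
elim/quotW=> s; elim/quotW=> s'; elim/quotW=> s''; rewrite !piE.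
by apply: gr_piE => b /=; rewrite gr_compMDl.
Qed.

Lemma gr_one_neq0 : gr_one != gr_zero.
Proof.
apply/eqP; rewrite !piE => /eqmodP/asboolP/(_ 0).
by rewrite gr_comp0 subr0 /gr_comp big_mkcond big_seq1 /= eqxx val1 ltxx.
Qed.

HB.instance Definition _ := GRing.Zmodule_isComNzRing.Build gr
  gr_mulA gr_mulC gr_mul1 gr_mulDl gr_one_neq0.

(* The class of y in P_b/P_{b+}; the value is 0 if y is not in P_b. *)
Definition gr_class (b : V) (y : F) : gr :=
  \pi_gr (insubd graw0 [:: (b, y)]).

Definition in_form (y : F) : gr :=
  if nu y is Some b then gr_class b y else 0.

Definition homogeneous (g : gr) : Prop :=
  exists b y, Fin b <= nu y /\ g = gr_class b y.

End Graded.

(* The inclusion of the graded algebra of a subfield into G_nu, computed on a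
   representative, on which the value does not depend. *)
Section GradedEmbedding.
Variables (K F : fieldType) (V : ozmodType) (nu : valuation F V).
Variable f : {rmorphism K -> F}.

Definition gr_embed (g : gr (restriction nu f)) : gr nu :=
  \sum_(t <- gr_seq (repr g)) gr_class nu t.1 (f t.2).

End GradedEmbedding.

Section GradedAlgebra.

Definition subring_generated (R : nzRingType) (S : set R) : set R :=
  [set a | forall B : set R, S `<=` B -> B 1 ->
     (forall x y, B x -> B y -> B (x - y)) ->
     (forall x y, B x -> B y -> B (x * y)) -> B a].

Variables (F : fieldType) (V : ozmodType) (nu : valuation F V).

(* For a graded subalgebra A of G_nu, this is A^*: since nu is a valuation of a
   field, the nonzero homogeneous elements of G_nu are invertible in G_nu, so
   that g / h is the unique a in G_nu with a * h = g. *)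
Definition graded_fractions (A : set (gr nu)) : set (gr nu) :=
  [set a | exists g h, [/\ A g, A h, homogeneous h, h <> 0 & a * h = g]].

Definition minimal_relation (B : set (gr nu)) (a : gr nu) (P : {poly gr nu}) :
    Prop :=
  [/\ P \is monic, forall j, B P`_j, P.[a] = 0
    & forall P' : {poly gr nu}, P' != 0 -> (forall j, B P'`_j) -> P'.[a] = 0 ->
        (size P <= size P')%N].

End GradedAlgebra.

(* All notions below are relative to an initial segment D of a well ordered
   type L. *)
Section Index.
Variables (d : Order.disp_t) (L : bOrderType d).
Implicit Types (D : set L) (i j k l : L).

Definition well_ordered : Prop := well_founded (fun i j : L => (i < j)%O).

Definition upto l : set L := [set q | (q <= l)%O].

Definition is_max D i : Prop := D i /\ forall j, D j -> (j <= i)%O.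

(* j = i + 1 *)
Definition succ i j : Prop :=
  (i < j)%O /\ forall k, (i < k)%O -> (j <= k)%O.

(* j = i + t *)
Fixpoint plus_nat i (t : nat) j : Prop :=
  if t is t'.+1 then exists2 k, plus_nat i t' k & succ k j else j = i.

(* j = i + omega *)
Definition plus_omega i j : Prop :=
  (forall t, exists2 k, plus_nat i t k & (k < j)%O) /\
  (forall m, (forall t k, plus_nat i t k -> (k < m)%O) -> (j <= m)%O).

Variable alpha : L -> nat.

Definition inessential D i : Prop :=
  (exists2 j, plus_omega i j & D j) /\
  (forall t k, plus_nat i t k -> alpha k = 1%N).

(* j = i+ *)
Definition nxt D i j : Prop :=
  [/\ D i, D j
    & (inessential D i /\ plus_omega i j) \/ (~ inessential D i /\ succ i j)].

End Index.

Notation ratfun K := {fraction {poly K}}.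

Section KeyPolynomials.
Variables (K : fieldType) (V : ozmodType) (nu : valuation (ratfun K) V).

Definition cst : {rmorphism K -> ratfun K} := @tofrac {poly K} \o polyC.

Definition nuK : valuation K V := restriction nu cst.

Definition tGamma0 : set V := divisible_hull (value_group nuK).

Definition pv (f : {poly K}) : vinf V := nu (tofrac f).

Definition deg (f : {poly K}) : nat := (size f).-1.

Definition pin (f : {poly K}) : gr nu := in_form nu (tofrac f).

Variables (d : Order.disp_t) (L : bOrderType d) (alpha : L -> nat).

Local Notation exps := {fsfun L -> nat with 0%N}.

(* (c, g) stands for the monomial c * \prod_i Q_i ^ (g i). *)
Local Notation term := (K * exps)%type.

Section Expansions.
Variable Q : L -> {poly K}.

Definition mon (g : exps) : {poly K} := \prod_(i <- finsupp g) Q i ^+ g i.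
Definition term_eval (t : term) : {poly K} := t.1 *: mon t.2.
Definition expn_eval (s : seq term) : {poly K} := \sum_(t <- s) term_eval t.

Definition std_exps (l : L) (g : exps) : Prop :=
  [/\ forall i, g i != 0%N -> (i <= l)%O,
      forall i j, (i < l)%O -> nxt alpha (upto l) i j -> (g i < alpha j)%N
    & forall i k, inessential alpha (upto l) i -> nxt alpha (upto l) i k ->
      forall j j', nxt alpha (upto l) j k -> nxt alpha (upto l) j' k ->
        g j != 0%N -> g j' != 0%N -> j = j'].

(* A sum is recorded in collected form, with pairwise distinct exponents and
   nonzero coefficients. This is no restriction: if the value of a sum is the
   minimum of the values of its monomials, this still holds after collecting them. *)
Definition free_std_expansion (l : L) (s : seq term) : Prop :=
  [/\ uniq [seq t.2 | t <- s],
      forall c g, (c, g) \in s -> [/\ c != 0, std_exps l g & g l = 0%N]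
    & pv (expn_eval s) = \big[Num.min / \top%O]_(t <- s) pv (term_eval t)].

(* f = \sum_(j <= N) c_j Q_l^j with c_j = expn_eval (e j). *)
Definition std_expansion (l : L) (f : {poly K}) (N : nat)
    (e : nat -> seq term) : Prop :=
  f = \sum_(j < N.+1) expn_eval (e j) * Q l ^+ j /\
  (forall j, (j <= N)%N -> free_std_expansion l (e j)).

Definition weakly_affine (p N : nat) (e : nat -> seq term) : Prop :=
  forall j, (0 < j <= N)%N -> (forall a : nat, j <> (p ^ a)%N) ->
    expn_eval (e j) = 0.

Definition min_value (l : L) (N : nat) (e : nat -> seq term) : vinf V :=
  \big[Num.min / \top%O]_(j < N.+1) pv (expn_eval (e j) * Q l ^+ j).

(* G_{nu_K}[in_nu {Q_q}_{q < l}] *)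
Definition initial_algebra (l : L) : set (gr nu) :=
  subring_generated (range (@gr_embed _ _ _ nu cst) `|`
                     [set pin (Q q) | q in [set q | (q < l)%O]]).

Definition initial_relation (l : L) (a : nat) (e : nat -> seq term) :
    {poly gr nu} :=
  'X^a + \sum_(j < a)
    (\sum_(t <- e j) gr_embed (in_form nuK t.1) * pin (mon t.2)) *: 'X^j.

Definition pre_key (D : set L) : Prop :=
  [/\ forall i, D i -> Q i \is monic /\ (0 < alpha i)%N,
      alpha \bot%O = 1%N, Q \bot%O = 'X
    & forall i i0, D i -> ~ is_max D i -> i != \bot%O -> nxt alpha D i0 i ->
        deg (Q i) = (alpha i * deg (Q i0))%N].

Definition key_a (D : set L) : Prop :=
  forall i, D i -> ~ is_max D i -> exists2 b, pv (Q i) = Fin b & tGamma0 b.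

(* The monomials of equal value are those of the relation, that is, the products
   c_{j,g} M_g Q_{i-1}^j together with Q_{i-1}^(alpha_i). *)
Definition key_b (D : set L) : Prop :=
  forall i i', D i -> succ i' i ->
  exists e : nat -> seq term,
  [/\ Q i = Q i' ^+ alpha i + \sum_(j < alpha i) expn_eval (e j) * Q i' ^+ j,
      forall j, (j < alpha i)%N -> free_std_expansion i' (e j),
      forall j t, (j < alpha i)%N -> t \in e j ->
        pv (term_eval t * Q i' ^+ j) = pv (Q i' ^+ alpha i)
    & minimal_relation (graded_fractions (initial_algebra i')) (pin (Q i'))
        (initial_relation i' (alpha i) e)].

Definition limit_property (D : set L) (i : L) (f : {poly K}) : Prop :=
  forall i0, nxt alpha D i0 i ->
    (exists N e, std_expansion i0 f N e) /\
    (forall N e, std_expansion i0 f N e -> min_value i0 N e < pv f).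

Definition bounded_below_index (i : L) : Prop :=
  exists2 b, tGamma0 b & forall i', (i' < i)%O -> pv (Q i') <= Fin b.

Definition key_c (D : set L) : Prop :=
  forall i, D i -> i != \bot%O -> (forall i', ~ succ i' i) ->
  [/\ exists i0, nxt alpha D i0 i,
      forall i0, nxt alpha D i0 i -> exists e, std_expansion i0 (Q i) (alpha i) e,
      limit_property D i (Q i),
      forall f, limit_property D i f -> (deg (Q i) <= deg f)%N
    & bounded_below_index i \/ ~ is_max D i ->
      forall i0 e, nxt alpha D i0 i -> std_expansion i0 (Q i) (alpha i) e ->
      [/\ expn_eval (e (alpha i)) = 1,
          min_value i0 (alpha i) e = pv (Q i0 ^+ alpha i)
        & min_value i0 (alpha i) e = pv (expn_eval (e 0%N))]].

Definition key_d (D : set L) : Prop :=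
  forall n, infinite_set [set i | D i /\ deg (Q i) = n] ->
  forall f, f \is monic -> deg f = n ->
    exists i, [/\ D i, deg (Q i) = n & pv f <= pv (Q i)].

Definition key_polynomials (D : set L) : Prop :=
  [/\ pre_key D, key_a D, key_b D, key_c D & key_d D].

End Expansions.

Definition replace (Q : L -> {poly K}) (i : L) (f : {poly K}) : L -> {poly K} :=
  fun q => if q == i then f else Q q.

End KeyPolynomials.

Section Truncation.
Variables (K : fieldType) (V : ozmodType) (nu : valuation (ratfun K) V).

(* The q-expansion f = \sum_j d_j q^j, collected in the polynomial d. *)
Definition q_expansion (q f : {poly K}) (e : {poly {poly K}}) : Prop :=
  f = e.[q] /\ forall j : nat, (size (e`_j)%R < size q)%N.

Definition trunc_value (q : {poly K}) (e : {poly {poly K}}) : vinf V :=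
  \big[Num.min / \top%O]_(j < size e) pv nu (e`_j * q ^+ j).

(* m is the largest element of S_i(f), where q = Q_i; nu (d_j) + j * nu (q) is
   written as the value of d_j q^j. *)
Definition is_delta (q f : {poly K}) (m : nat) : Prop :=
  exists2 e, q_expansion q f e &
  let S := [set j : nat | e`_j != 0 /\ pv nu (e`_j * q ^+ j) = trunc_value q e] in
  S m /\ forall j, S j -> (j <= m)%N.

End Truncation.

(* Main.v *)
Require Import Defs.
From HB Require Import structures.
From mathcomp Require Import all_boot all_order all_algebra generic_quotient.
From mathcomp Require Import finmap zify lra.
From mathcomp Require Import boolp classical_sets cardinality reals.

(* Write b_i = nu(Q_i).  By transfinite induction, for every non-maximal i the
   truncation of nu at Q_i is multiplicative and agrees with nu in degrees smaller
   than deg Q_i: a jump of value would contradict the minimality of the algebraic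
   relation of in(Q_(i-1)) when i is a successor, and that of deg Q_i when i is a
   limit.

   In the block l + t, put d = alpha_(l+omega), q_t = Q_(l+t+1), and let c_(k,t) be the
   coefficients of Q_(l+omega) in q_t.  Passing from q_t to q_t' = q_t + z gives
   c_(k,t') = sum_j 'C(j,k) c_(j,t) (-z)^(j-k), up to carries due to the reductions
   modulo q_t'; controlling these by the truncation at q_0 shows that they exceed the
   expected value by at least b(q_t) - b(q_0), which does not tend to 0.  Up to this
   error c_(k,t') is also the constant coefficient of the k-th Hasse derivative of
   the expansion in q_t, which has degree less than Q_(l+omega) and hence an
   eventually constant value.  As nu(c_(k,t)) >= (d - k) b(q_t), it follows that for
   0 < k < d either nu(c_(k,t)) = (d - k) bbar for all large t ("exact"), or
   nu(c_(k,t)) exceeds (d - k) bbar by a fixed amount ("large").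

   If j is the largest exact index that is not a power of p, let k be the p-part of j.
   Larger exact indices and d are powers of p, so that their binomial coefficients
   vanish, while 'C(j,k) <> 0 in K: the term of index j gives nu(c_(k,t')) < (d - k) bbar,
   a contradiction.  So exact indices are powers of p, and it suffices to drop from
   the expansion of Q_(l+omega), for a large t, the monomials with a large
   coefficient: their sum has truncation greater than d b_i for all i in the block. *)

Set Implicit Arguments.
Unset Strict Implicit.
Unset Printing Implicit Defensive.

Import Order.TTheory GRing.Theory Num.Theory.

Local Open Scope classical_set_scope.
Local Open Scope ring_scope.

(** * Values of polynomials *)

(** Only lower bounds for the truncations are used: supermultiplicativity and agreement with [nu] in
    small degrees suffice, and the truncation is never built as a valuation.

    Two sizes compete in the block. The gaps [bbar - b_t] can be made as small as desired, because
    the values lie in R through [phi]; the carries gain at least [b_t - b_0], which stays away from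
    0. Hence the carries are bounded through the fixed first polynomial of the sequence, and the
    index is taken so large that [d] times the gap is below this gain.

    A coefficient called large must exceed its threshold by [d (bbar - b_T)]: this pays for having
    powers of the fixed polynomial of index [T] in its monomial, both when Taylor terms are compared
    and when truncations at later key polynomials are taken.

    Standard expansions intervene twice. Condition (c) minimizes the degree only among polynomials
    that have such expansions, so that their existence in small degrees has to be proved; and they
    show that polynomials of small degree have values in [tGamma0], where [phi] is meaningful. *)

Section OrderedGroup.
Variable V : ozmodType.
Implicit Types a b c : V.

Lemma oz_leNgt a b : (a <= b) = ~~ (b < a).
Proof.
apply/idP/idP=> [ab|]; first by apply/negP => /(le_lt_trans ab); rewrite ltxx.
rewrite lt_neqAle negb_and negbK => /orP[/eqP->//|].
by have /orP[->|->] := ozmod_total a b.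
Qed.

Lemma oz_ltNge a b : (a < b) = ~~ (b <= a).
Proof. by rewrite oz_leNgt negbK. Qed.

Lemma ozD2l a b c : (c + a <= c + b) = (a <= b).
Proof. by rewrite ![c + _]addrC ozD2r. Qed.

Lemma oz_ltD2r a b c : (a + c < b + c) = (a < b).
Proof. by rewrite !oz_ltNge ozD2r. Qed.

Lemma oz_ltD2l a b c : (c + a < c + b) = (a < b).
Proof. by rewrite ![c + _]addrC oz_ltD2r. Qed.

Lemma oz_leBlDr a b c : (a - b <= c) = (a <= c + b).
Proof. by rewrite -(ozD2r (a - b) c b) subrK. Qed.

Lemma oz_leBrDr a b c : (a <= b - c) = (a + c <= b).
Proof. by rewrite -(ozD2r a (b - c) c) subrK. Qed.

Lemma oz_ltBrDr a b c : (a < b - c) = (a + c < b).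
Proof. by rewrite -(oz_ltD2r a (b - c) c) subrK. Qed.

Lemma oz_subr_ge0 a b : (0 <= b - a) = (a <= b).
Proof. by rewrite oz_leBrDr add0r. Qed.

Lemma oz_subr_gt0 a b : (0 < b - a) = (a < b).
Proof. by rewrite oz_ltBrDr add0r. Qed.

Lemma oz_leMn a b n : a <= b -> a *+ n <= b *+ n.
Proof. by move=> ab; elim: n => // n IH; rewrite !mulrS ozleD. Qed.

Lemma oz_ltMn a b n : a < b -> (0 < n)%N -> a *+ n < b *+ n.
Proof.
case: n => // n ab _; rewrite !mulrS.
by apply: lt_le_trans (_ : b + a *+ n <= _); rewrite ?oz_ltD2r ?ozD2l ?oz_leMn // ltW.
Qed.

Lemma oz_mulrn_ge a n : 0 <= a -> (0 < n)%N -> a <= a *+ n.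
Proof.
case: n => // n a0 _; rewrite mulrS -[leLHS]addr0 ozD2l.
by have := oz_leMn n a0; rewrite mul0rn.
Qed.

Lemma oz_subr_leMn a b n : a <= b -> (0 < n)%N -> b - a <= b *+ n - a *+ n.
Proof. by move=> ab n0; rewrite -mulrnBl oz_mulrn_ge // oz_subr_ge0. Qed.

End OrderedGroup.

Section PolyValue.
Variables (K : fieldType) (V : ozmodType) (nu : valuation (ratfun K) V).
Local Notation pv := (pv nu).
Implicit Types (f g : {poly K}) (u v : V).

Lemma pvM f g : pv (f * g) = vadd (pv f) (pv g).
Proof. by rewrite /Defs.pv rmorphM Defs.valM. Qed.

Lemma pv0 : pv 0 = None.
Proof. by rewrite /Defs.pv rmorph0 Defs.val0. Qed.

Lemma pv1 : pv 1 = Fin 0.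
Proof. by rewrite /Defs.pv rmorph1 Defs.val1. Qed.

Lemma pvN f : pv (- f) = pv f.
Proof. by rewrite /Defs.pv rmorphN Defs.valN. Qed.

Lemma pv_fin f : f != 0 -> exists v, pv f = Fin v.
Proof.
move=> f0; case E : (pv f) => [v|]; first by exists v.
by move/Defs.val_top/eqP: E; rewrite tofrac_eq0 (negPf f0).
Qed.

Definition vge v f := Fin v <= pv f.

Lemma vge0 v : vge v 0.
Proof. by rewrite /vge pv0. Qed.

Lemma vgeD v f g : vge v f -> vge v g -> vge v (f + g).
Proof. by move=> ? ?; rewrite /vge /Defs.pv rmorphD Defs.val_leD. Qed.

Lemma vgeN v f : vge v (- f) = vge v f.
Proof. by rewrite /vge pvN. Qed.

Lemma vgeB v f g : vge v f -> vge v g -> vge v (f - g).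
Proof. by move=> ? ?; rewrite vgeD // vgeN. Qed.

Lemma vgeM u v f g : vge u f -> vge v g -> vge (u + v) (f * g).
Proof. by move=> ? ?; rewrite /vge /Defs.pv rmorphM Defs.val_leM. Qed.

Lemma vge_le u v f : u <= v -> vge v f -> vge u f.
Proof. by move=> uv; apply: le_trans. Qed.

Lemma vge_sum v I (r : seq I) (P : pred I) (F : I -> {poly K}) :
  (forall i, P i -> vge v (F i)) -> vge v (\sum_(i <- r | P i) F i).
Proof. by move=> H; apply: (big_ind (vge v)) => //; [exact: vge0 | exact: vgeD]. Qed.

Lemma vgeX v f n : vge v f -> vge (v *+ n) (f ^+ n).
Proof.
move=> vf; elim: n => [|n IH]; first by rewrite /vge pv1.
by rewrite exprS mulrS vgeM.
Qed.

Lemma vge_pv v f : pv f = Fin v -> vge v f.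
Proof. by rewrite /vge => ->. Qed.

Lemma pvX v f n : pv f = Fin v -> pv (f ^+ n) = Fin (v *+ n).
Proof.
move=> fv; elim: n => [|n IH]; first by rewrite pv1.
by rewrite exprS mulrS pvM fv IH.
Qed.

Lemma vgeMr u b f g : pv g = Fin b -> vge u (f * g) = vge (u - b) f.
Proof.
move=> gb; rewrite /vge pvM gb; case: (pv f) => [w|] //=.
by rewrite /Order.le /= oz_leBlDr.
Qed.

Lemma vgeP u f v : pv f = Fin v -> vge u f = (u <= v).
Proof. by rewrite /vge => ->. Qed.

Lemma vge_const v n f : vge v f -> vge v (f *+ n).
Proof. by move=> vf; elim: n => [|n IH]; rewrite ?vge0 // mulrS vgeD. Qed.

Lemma pvD_min f g : Num.min (pv f) (pv g) <= pv (f + g).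
Proof. by rewrite /Defs.pv rmorphD valD. Qed.

Lemma pvD_lt f g : pv f < pv g -> pv (f + g) = pv f.
Proof.
move=> fg; apply: le_anti; have := pvD_min f g.
rewrite (min_idPl (ltW fg)) => ->; rewrite andbT leNgt; apply/negP => H.
have := pvD_min (f + g) (- g); rewrite addrK pvN leNgt => /negP; apply.
by rewrite lt_min H.
Qed.

Lemma vgeE u f : vge u f = (Fin u <= pv f). Proof. by []. Qed.

Lemma vge_gt u v f : u < v -> vge v f -> Fin u < pv f.
Proof. by move=> uv; apply: lt_le_trans; rewrite vinf_ltE. Qed.

Lemma pv_sub_lt u f g v : pv f = Fin u -> u < v -> vge v (g - f) -> pv g = Fin u.
Proof.
by move=> fu uv vg; rewrite -(subrKC f g) pvD_lt // fu; exact: vge_gt vg.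
Qed.

End PolyValue.

(** * Expansions and truncations *)

Section QExpansion.
Variable K : fieldType.
Implicit Types (q f g c d : {poly K}) (e : {poly {poly K}}).

Lemma q_expansionS q c e : (size c < size q)%N -> q_expansion q e.[q] e ->
  q_expansion q (e.[q] * q + c) (e * 'X + c%:P).
Proof.
move=> cq [_ eq]; split=> [|j]; first by rewrite hornerMXaddC.
by rewrite coefD coefMX coefC; case: j => [|j] /=; rewrite ?add0r ?addr0.
Qed.

Lemma q_expansion_cons q c e : q_expansion q (e * 'X + c%:P).[q] (e * 'X + c%:P) ->
  (size c < size q)%N /\ q_expansion q e.[q] e.
Proof.
case=> _ H; split.
  by have := H 0%N; rewrite coefD coefMX coefC /= add0r.
by split=> // j; have := H j.+1; rewrite coefD coefMX coefC /= addr0.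
Qed.

Lemma q_expansion_small q f : (size f < size q)%N -> q_expansion q f f%:P.
Proof.
move=> fq; split=> [|j]; first by rewrite hornerC.
by rewrite coefC; case: eqP => // _; rewrite size_poly0; case: (size q) fq.
Qed.

Lemma q_expansionD q f g e1 e2 :
  q_expansion q f e1 -> q_expansion q g e2 -> q_expansion q (f + g) (e1 + e2).
Proof.
move=> [-> H1] [-> H2]; split=> [|j]; first by rewrite hornerD.
by rewrite coefD (leq_ltn_trans (size_polyD _ _)) // gtn_max H1 H2.
Qed.

Lemma q_expansionN q f e : q_expansion q f e -> q_expansion q (- f) (- e).
Proof.
by move=> [-> H]; split=> [|j]; rewrite ?hornerN // coefN size_polyN.
Qed.

Lemma q_expansionMX q f e : (0 < size q)%N -> q_expansion q f e ->
  q_expansion q (f * q) (e * 'X).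
Proof.
move=> q0 [-> H]; split=> [|j]; first by rewrite hornerMX.
by rewrite coefMX; case: eqP => // _; rewrite size_poly0.
Qed.

Lemma q_expansionMXn q f e n : (0 < size q)%N -> q_expansion q f e ->
  q_expansion q (f * q ^+ n) (e * 'X^n).
Proof.
move=> q0 H; elim: n => [|n IH]; first by rewrite !expr0 !mulr1.
by rewrite !exprSr !mulrA; apply: q_expansionMX.
Qed.

Lemma q_expansion_sum q (r : seq nat) (F : nat -> {poly K}) E : (0 < size q)%N ->
  (forall i, i \in r -> q_expansion q (F i) (E i)) ->
  q_expansion q (\sum_(i <- r) F i) (\sum_(i <- r) E i).
Proof.
move=> q0; elim: r => [|i r IH] H.
  by rewrite !big_nil -(polyC0 (polynomial K)); apply: q_expansion_small; rewrite size_poly0.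
rewrite !big_cons; apply: q_expansionD; first by apply: H; rewrite inE eqxx.
by apply: IH => j jr; apply: H; rewrite inE jr orbT.
Qed.

(** No cancellation is possible: a nonzero multiple of [q] has size at least that of [q], while the
    constant coefficient is smaller. *)
Lemma q_expansion_eq0 q e : q \is monic -> q_expansion q 0 e -> e = 0.
Proof.
move=> qm [/esym + H]; elim/poly_ind: e H => [//|e c IH] H /eqP.
have [cq [_ eq]] := q_expansion_cons (conj erefl H).
rewrite hornerMXaddC addr_eq0 => /eqP E.
have e0 : e.[q] = 0.
  apply/eqP; apply: contraTT cq => e0.
  rewrite -leqNgt -(size_polyN c) -E size_Mmonic // -lez_nat.
  have := e0; rewrite -size_poly_gt0; case: (size _) => // k _.
  by rewrite addSn /= lez_nat leq_addl.
have -> : c = 0 by apply/eqP; rewrite -oppr_eq0 -E e0 mul0r.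
by rewrite (IH eq e0) mul0r add0r.
Qed.

Lemma q_expansion_uniq q f e1 e2 : q \is monic ->
  q_expansion q f e1 -> q_expansion q f e2 -> e1 = e2.
Proof.
move=> qm H1 H2; apply/eqP; rewrite -subr_eq0; apply/eqP.
apply: (q_expansion_eq0 qm); rewrite -(subrr f).
exact: q_expansionD H1 (q_expansionN H2).
Qed.

Lemma size_divp_field f q : q != 0 -> size (f %/ q) = (size f - (size q).-1)%N.
Proof. exact: size_divp. Qed.

Lemma size_mul_divp f g q : q != 0 -> (size f < size q)%N -> (size g < size q)%N ->
  (size (f * g %/ q)%R < size q)%N.
Proof.
move=> q0 sf sg; rewrite size_divp_field //.
by have := size_polyMleq f g; move: sf sg; set x := size (f * g); clearbody x; lia.
Qed.

Lemma divp_modp_uniq q c d : (size c < size q)%N ->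
  (d * q + c) %/ q = d /\ (d * q + c) %% q = c.
Proof.
move=> cq; have q0 : q != 0 by rewrite -size_poly_gt0; case: (size q) cq.
by rewrite divp_addl_mul // divp_small // addr0 modpD modp_mull add0r modp_small.
Qed.

Lemma q_expansion_exists q f : (1 < size q)%N -> exists e, q_expansion q f e.
Proof.
move=> q1; have q0 : q != 0 by rewrite -size_poly_gt0 ltnW.
have [n] := ubnP (size f); elim: n f => // n IH f; rewrite ltnS => fn.
have [fq|qf] := ltnP (size f) (size q).
  by exists f%:P; apply: q_expansion_small.
have [|e He] := IH (f %/ q).
  rewrite size_divp_field //; apply: leq_trans fn.
  by lia.
exists (e * 'X + (f %% q)%:P); rewrite {1}(divp_eq f q) [f %/ q]He.1.
apply: q_expansionS; first by rewrite ltn_modp.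
by split=> //; exact: He.2.
Qed.

Lemma size_q_expansion q f e : q \is monic -> q_expansion q f e -> e != 0 ->
  size f = ((size e).-1 * (size q).-1 + size (lead_coef e))%N.
Proof.
move=> qm [-> H]; elim/poly_ind: e H => [|e c IH] H e0; first by rewrite eqxx in e0.
have [cq [_ eq]] := q_expansion_cons (conj erefl H).
have [E|en0] := eqVneq e 0.
  move: e0; rewrite E mul0r add0r polyC_eq0 => c0.
  by rewrite size_polyC c0 lead_coefC hornerC /= mul0n.
rewrite hornerMXaddC size_polyDl; last first.
  rewrite size_Mmonic //; last first.
    by apply: contra_neq en0 => E; apply: (q_expansion_eq0 qm); rewrite -E.
  rewrite (IH eq en0); apply: leq_trans cq _.
  have : (0 < size (lead_coef e))%N by rewrite size_poly_gt0 lead_coef_eq0.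
  by case: (size (lead_coef e)) => // k _; rewrite addnS addSn /= leq_addl.
have en1 : e.[q] != 0.
  by apply: contra_neq en0 => E; apply: (q_expansion_eq0 qm); rewrite -E.
have q0 : (0 < size q)%N by rewrite size_poly_gt0 monic_neq0.
rewrite size_Mmonic // (IH eq en0).
have -> : size (e * 'X + c%:P) = (size e).+1.
  by rewrite size_MXaddC (negPf en0).
have -> : lead_coef (e * 'X + c%:P) = lead_coef e.
  rewrite lead_coefDl ?lead_coefMX // size_mulX // (leq_ltn_trans (size_polyC_leq1 _)) //.
  by rewrite ltnS size_poly_gt0.
have : (0 < size e)%N by rewrite size_poly_gt0.
case: (size e) => // k _; case: (size q) q0 => // m _ /=.
rewrite mulSn; lia.
Qed.

Lemma q_expansion_coef0 q f e m j : q \is monic -> q_expansion q f e ->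
  (size f <= m * (size q).-1)%N -> (m <= j)%N -> e`_j = 0.
Proof.
move=> qm H fm mj; have [->|e0] := eqVneq e 0; first by rewrite coef0.
apply: nth_default; apply: leq_trans mj; rewrite leqNgt; apply/negP => me.
move: fm; rewrite (size_q_expansion qm H e0) leqNgt => /negP; apply.
have : (0 < size (lead_coef e))%N by rewrite size_poly_gt0 lead_coef_eq0.
case: (size (lead_coef e)) => // k _; rewrite addnS ltnS.
apply: leq_trans (leq_addr _ _); rewrite leq_mul2r.
by case: (size e) me => // n /=; rewrite ltnS => ->; rewrite orbT.
Qed.

Lemma q_expansion_lt_size q f e m : q \is monic -> (1 < size q)%N ->
  q_expansion q f e -> (forall j, (m <= j)%N -> e`_j = 0) ->
  (size f <= m * (size q).-1)%N.
Proof.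
move=> qm q1 H em; have [E|e0] := eqVneq e 0.
  by rewrite H.1 E horner0 size_poly0.
have sem : (size e <= m)%N.
  by rewrite leqNgt; apply: contra e0 => me; rewrite -lead_coef_eq0 lead_coefE em //;
     case: (size e) me.
rewrite (size_q_expansion qm H e0).
have : (size (lead_coef e) <= (size q).-1)%N.
  by rewrite lead_coefE; have := H.2 (size e).-1; case: (size q) q1.
have : (0 < size e)%N by rewrite size_poly_gt0.
case: (size e) sem => //= k km _ H1.
apply: leq_trans (_ : k.+1 * (size q).-1 <= _)%N; last by rewrite leq_mul2r km orbT.
by rewrite mulSn addnC leq_add2r.
Qed.

Lemma size_sub_monic f g : f \is monic -> g \is monic -> size f = size g ->
  (size (f - g)%R < size f)%N.
Proof.
move=> fm gm fg; have f0 : (0 < size f)%N by rewrite size_poly_gt0 monic_neq0.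
rewrite -(prednK f0) ltnS; apply/leq_sizeP => j; rewrite leq_eqVlt => /orP[/eqP <-|fj].
  have E : g`_(size f).-1 = lead_coef g by rewrite lead_coefE fg.
  by rewrite coefB E -lead_coefE (eqP fm) (eqP gm) subrr.
rewrite (prednK f0) in fj.
by rewrite coefB !nth_default ?subrr // -?fg.
Qed.

End QExpansion.

Section Truncation.
Variables (K : fieldType) (V : ozmodType) (nu : valuation (ratfun K) V).
Local Notation pv := (pv nu).
Local Notation vge := (vge nu).
Implicit Types (q f g h : {poly K}) (e : {poly {poly K}}) (u v b : V).

(** A lower bound for the truncation of [f] at [q]; stated as an inequality, it needs no infinite
    value for [f = 0]. *)
Definition trunc_ge q v f : Prop :=
  exists2 e, q_expansion q f e & forall j, vge v (e`_j * q ^+ j).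

Section Basic.
Variable q : {poly K}.
Hypotheses (qm : q \is monic) (q1 : (1 < size q)%N).

Let q0 : (0 < size q)%N. Proof. exact: ltnW. Qed.

Lemma trunc_geP v f e : q_expansion q f e ->
  trunc_ge q v f <-> forall j, vge v (e`_j * q ^+ j).
Proof.
move=> He; split=> [[e' He'] H j|]; last by exists e.
by rewrite (q_expansion_uniq qm He He').
Qed.

Lemma trunc_ge_small v f : (size f < size q)%N -> trunc_ge q v f <-> vge v f.
Proof.
move=> fq; rewrite (trunc_geP _ (q_expansion_small fq)).
split=> [/(_ 0%N)|H j]; first by rewrite coefC expr0 mulr1.
by rewrite coefC; case: j => [|j] /=; rewrite ?expr0 ?mulr1 // mul0r vge0.
Qed.

Lemma trunc_ge0 v : trunc_ge q v 0.
Proof. by apply/trunc_ge_small; rewrite ?size_poly0 ?vge0. Qed.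

Lemma trunc_geD v f g : trunc_ge q v f -> trunc_ge q v g -> trunc_ge q v (f + g).
Proof.
move=> [e1 H1 h1] [e2 H2 h2]; exists (e1 + e2); first exact: q_expansionD.
by move=> j; rewrite coefD mulrDl vgeD.
Qed.

Lemma trunc_geN v f : trunc_ge q v f -> trunc_ge q v (- f).
Proof.
move=> [e H h]; exists (- e); first exact: q_expansionN.
by move=> j; rewrite coefN mulNr vgeN.
Qed.

Lemma trunc_geB v f g : trunc_ge q v f -> trunc_ge q v g -> trunc_ge q v (f - g).
Proof. by move=> Hf /trunc_geN; apply: trunc_geD. Qed.

Lemma trunc_ge_sum v I (r : seq I) (P : pred I) (F : I -> {poly K}) :
  (forall i, P i -> trunc_ge q v (F i)) -> trunc_ge q v (\sum_(i <- r | P i) F i).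
Proof.
by move=> H; apply: (big_ind (trunc_ge q v)) => //; [exact: trunc_ge0 | exact: trunc_geD].
Qed.

Lemma trunc_geMn v f n : trunc_ge q v f -> trunc_ge q v (f *+ n).
Proof.
move=> H; elim: n => [|n IH]; first exact: trunc_ge0.
by rewrite mulrS; apply: trunc_geD.
Qed.

Lemma trunc_ge_le u v f : u <= v -> trunc_ge q v f -> trunc_ge q u f.
Proof. by move=> uv [e H h]; exists e => // j; apply: vge_le (h j). Qed.

Lemma trunc_ge_vge v f : trunc_ge q v f -> vge v f.
Proof.
by move=> [e [-> _] h]; rewrite horner_coef; apply: vge_sum => i _; apply: h.
Qed.

Variable b : V.
Hypothesis qb : pv q = Fin b.

Lemma trunc_geMq v f : trunc_ge q v f -> trunc_ge q (v + b) (f * q).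
Proof.
move=> [e H h]; exists (e * 'X); first exact: q_expansionMX.
move=> j; rewrite coefMX; case: j => [|j] /=; first by rewrite mul0r vge0.
by rewrite exprSr mulrA vgeM // vge_pv.
Qed.

Lemma trunc_geMqX v f n : trunc_ge q v f -> trunc_ge q (v + b *+ n) (f * q ^+ n).
Proof.
move=> H; elim: n => [|n IH]; first by rewrite expr0 mulr1 addr0.
by rewrite exprSr mulrA mulrSr addrA; exact: trunc_geMq.
Qed.

Lemma trunc_ge_q : trunc_ge q b q.
Proof.
have -> : trunc_ge q b q = trunc_ge q (0 + b) (1 * q) by rewrite mul1r add0r.
apply: trunc_geMq.
by apply/trunc_ge_small; rewrite ?size_poly1 // vge_pv // pv1.
Qed.

End Basic.

(* [trunc_mul q] says that the truncation of [nu] at [q] is a valuation: it gives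
   supermultiplicativity, which is all that is needed. *)
Definition trunc_mul q : Prop :=
  forall f g u v, (size f < size q)%N -> (size g < size q)%N ->
    vge u f -> vge v g -> trunc_ge q (u + v) (f * g).

Section Multiplicative.
Variables (q : {poly K}) (b : V).
Hypotheses (qm : q \is monic) (q1 : (1 < size q)%N) (qb : pv q = Fin b).
Hypothesis q_mul : trunc_mul q.

Lemma trunc_geM u v f g :
  trunc_ge q u f -> trunc_ge q v g -> trunc_ge q (u + v) (f * g).
Proof.
move=> [e1 [-> s1] h1] [e2 [-> s2] h2].
rewrite (horner_coef e1) (horner_coef e2) mulr_suml.
apply: trunc_ge_sum => // i _; rewrite mulr_sumr; apply: trunc_ge_sum => // j _.
rewrite mulrACA -exprD.
have -> : u + v = (u - b *+ i) + (v - b *+ j) + b *+ (i + j).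
  by rewrite addrACA -opprD -mulrnDr subrK.
apply: trunc_geMqX => //; apply: q_mul => //.
  by have := h1 i; rewrite (vgeMr _ _ (pvX i qb)).
by have := h2 j; rewrite (vgeMr _ _ (pvX j qb)).
Qed.

Lemma trunc_geX v f n : trunc_ge q v f -> trunc_ge q (v *+ n) (f ^+ n).
Proof.
move=> H; elim: n => [|n IH]; last by rewrite exprS mulrS; apply: trunc_geM.
by apply/trunc_ge_small; rewrite ?expr0 ?size_poly1 // vge_pv // pv1.
Qed.

(** The division by [Q] removes one leading term of the [q]-expansion at a time: if [m] is the top
    index, the multiple of [Q] by [e_m q^(m - a)] is subtracted. Its truncation is at least [v] by
    multiplicativity, and the degree drops because [Q] and [q^a] are monic of the same degree. *)
Lemma trunc_ge_divmod Q a v h : Q \is monic -> (0 < a)%N ->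
  (size Q).-1 = (a * (size q).-1)%N -> trunc_ge q (b *+ a) Q -> trunc_ge q v h ->
  trunc_ge q v (h %% Q) /\ trunc_ge q (v - b *+ a) (h %/ Q).
Proof.
move=> Qm a0 sQ HQ; have [n] := ubnP (size h); elim: n h => // n IH h.
rewrite ltnS => hn Hh.
have [hQ|Qh] := ltnP (size h) (size Q).
  by rewrite modp_small // divp_small //; split => //; apply: trunc_ge0.
case: (Hh) => e He he.
have h0 : h != 0.
  by apply: contraTneq Qh => ->; rewrite size_poly0 leqNgt size_poly_gt0 monic_neq0.
have e0 : e != 0 by apply: contra_neq h0 => E; rewrite He.1 E horner0.
set m := (size e).-1; have lh := size_q_expansion qm He e0.
have am : (a <= m)%N.
  rewrite leqNgt; apply/negP => ma.
  have : (size h < size Q)%N.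
    rewrite lh -/m; have -> : size Q = (a * (size q).-1).+1.
      by rewrite -sQ prednK // size_poly_gt0 monic_neq0.
    rewrite ltnS; apply: leq_trans (_ : m.+1 * (size q).-1 <= _)%N.
      rewrite mulSn addnC leq_add2r lead_coefE.
      by have := He.2 (size e).-1; case: (size q) q1.
    by rewrite leq_mul2r ma orbT.
  by rewrite ltnNge Qh.
have dn0 : e`_m != 0 by rewrite -lead_coefE lead_coef_eq0.
set d := e`_m * q ^+ (m - a).
have Hd : trunc_ge q (v - b *+ a) d.
  have -> : v - b *+ a = (v - b *+ m) + b *+ (m - a).
    by rewrite -{1}(subnK am) mulrnDr opprD addrA addrAC subrK.
  apply: trunc_geMqX => //; apply/trunc_ge_small => //.
    exact: He.2.
  by have := he m; rewrite (vgeMr _ _ (pvX m qb)).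
have HdQ : trunc_ge q v (d * Q).
  by rewrite -[v](subrK (b *+ a)); apply: trunc_geM.
have qXm k : q ^+ k \is monic by apply: monic_exp.
have sqX k : size (q ^+ k) = (k * (size q).-1).+1.
  by rewrite -[LHS]prednK ?size_exp 1?mulnC // size_poly_gt0 monic_neq0.
have hd : (size (h - d * Q)%R < size h)%N.
  have -> : h - d * Q = (h - e`_m * q ^+ m) + d * (q ^+ a - Q).
    have Ed : d * q ^+ a = e`_m * q ^+ m by rewrite /d -mulrA -exprD subnK.
    by rewrite mulrBr Ed addrA subrK.
  have H1 : (size (h - e`_m * q ^+ m)%R < size h)%N.
    have /(q_expansion_lt_size qm q1) : q_expansion q (h - e`_m * q ^+ m) (e - (e`_m)%:P * 'X^m).
      split=> [|j]; first by rewrite {1}He.1 hornerD hornerN hornerCM hornerXn.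
      rewrite coefB coefCM coefXn; case: eqP => [->|_]; last by rewrite mulr0 subr0 He.2.
      by rewrite mulr1 subrr size_poly0 ltnW.
    move=> /(_ m) H1; rewrite lh; apply: leq_ltn_trans (H1 _) _.
      move=> j mj; rewrite coefB coefCM coefXn; have [->|jm] := eqVneq j m.
        by rewrite mulr1 subrr.
      rewrite mulr0 subr0 nth_default //; have : (m < j)%N by rewrite ltn_neqAle eq_sym jm.
      by rewrite /m; case: (size e).
    by rewrite -[ltnLHS]addn0 ltn_add2l size_poly_gt0 lead_coef_eq0.
  have H2 : (size (d * (q ^+ a - Q))%R < size h)%N.
    have sQS : size Q = (a * (size q).-1).+1.
      by rewrite -sQ prednK // size_poly_gt0 monic_neq0.
    have := size_sub_monic (qXm a) Qm; rewrite sqX sQS ltnS => /(_ erefl) H2.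
    apply: leq_ltn_trans (size_polyMleq _ _) _.
    rewrite size_Mmonic // sqX lh -/m lead_coefE -/m.
    move: dn0; rewrite -size_poly_gt0.
    have := mulnDl (m - a)%N a (size q).-1; rewrite subnK // => ->.
    move: H2; set x := size (q ^+ a - Q); set y := size e`_m.
    set s := ((m - a) * _)%N; set t := (a * _)%N; clearbody x y s t; clear; lia.
  by apply: leq_ltn_trans (size_polyD _ _) _; rewrite gtn_max H1 H2.
have [|IH1 IH2] := IH _ (leq_trans hd hn); first exact: trunc_geB.
have Q0 : Q != 0 by apply: monic_neq0.
rewrite -[h](subrK (d * Q)) modpD modp_mull addr0 divpD mulpK //.
by split => //; apply: trunc_geD.
Qed.

(** Each division by [Q] costs [b], the value of [q], even when [Q] has a larger value. The
    difference of these two values is the gain on carries used later. *)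
Lemma trunc_ge_small_div Q j e v h : Q \is monic -> size Q = size q -> vge b Q ->
  trunc_ge q v h -> q_expansion Q h e -> vge (v - b *+ j) e`_j.
Proof.
move=> Qm sQ bQ Hh He; suff : trunc_ge q (v - b *+ j) e`_j.
  by move=> H; apply/(trunc_ge_small qm) => //; rewrite -sQ; apply: He.2.
have HQ : trunc_ge q (b *+ 1) Q.
  have -> : Q = q + (Q - q) by rewrite subrKC.
  apply: trunc_geD; first exact: trunc_ge_q.
  apply/trunc_ge_small => //; first by rewrite -sQ size_sub_monic.
  by rewrite vgeB // vge_pv.
have sQ1 : (size Q).-1 = (1 * (size q).-1)%N by rewrite mul1n sQ.
move: Hh He; rewrite /q_expansion => Hh [+ eQ].
elim/poly_ind: e v h eQ j Hh => [|e c IH] v h eQ j Hh hE.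
  by rewrite coef0; apply: trunc_ge0.
have [cQ He] := q_expansion_cons (conj erefl eQ).
have := trunc_ge_divmod Qm (ltn0Sn 0) sQ1 HQ Hh.
have [] := divp_modp_uniq e.[Q] cQ; rewrite -hornerMXaddC -hE => -> -> [H1 H2].
rewrite coefD coefMX coefC; case: j => [|j] /=; first by rewrite add0r subr0.
rewrite addr0 mulrS opprD addrA; exact: (IH _ _ He.2 _ H2 erefl).
Qed.

(** Quotient and remainder of [f * g] by [Q] are both smaller than [Q], so that the division is
    already the [Q]-expansion. The quotient loses [b *+ a], and the factor [Q] gives back [B], which
    is no smaller. *)
Lemma trunc_mul_step Q a B : Q \is monic -> (0 < a)%N -> pv Q = Fin B -> b *+ a <= B ->
  (size Q).-1 = (a * (size q).-1)%N -> trunc_ge q (b *+ a) Q ->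
  forall f g u v, (size f < size Q)%N -> (size g < size Q)%N ->
  trunc_ge q u f -> trunc_ge q v g -> trunc_ge Q (u + v) (f * g).
Proof.
move=> Qm a0 QB bB sQ HQ f g u v sf sg Hf Hg.
have [H1 H2] := trunc_ge_divmod Qm a0 sQ HQ (trunc_geM Hf Hg).
have Q0 : Q != 0 by apply: monic_neq0.
have sm := size_mul_divp Q0 sf sg.
rewrite (divp_eq (f * g) Q); apply: trunc_geD; last first.
  apply/trunc_ge_small; rewrite ?ltn_modp //; exact: trunc_ge_vge H1.
rewrite -[u + v](subrK B); apply: trunc_geMq => //.
  have : (0 < (size Q).-1)%N by rewrite sQ muln_gt0 a0; case: (size q) q1 => [|[]].
  by case: (size Q) => [|[]].
apply/trunc_ge_small => //; apply: vge_le (trunc_ge_vge H2).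
by rewrite ozD2l -oz_subr_ge0 opprK addrC oz_subr_ge0.
Qed.

End Multiplicative.
(** Substitute [q = (q - q') + q'] in the expansion: both summands have truncation at least [b] at
    [q'], the first because its degree is smaller than that of [q']. *)
Lemma trunc_ge_mono q q' b b' v f : q \is monic -> q' \is monic -> (1 < size q')%N ->
  size q = size q' -> pv q = Fin b -> pv q' = Fin b' -> b <= b' -> trunc_mul q' ->
  trunc_ge q v f -> trunc_ge q' v f.
Proof.
move=> qm qm' q1 qq' qb qb' bb' H [e [-> eq] he].
rewrite horner_coef; apply: trunc_ge_sum => // i _.
rewrite -[v](subrK (b *+ i)); apply: (trunc_geM qm' q1 qb' H).
  by apply/(trunc_ge_small qm'); rewrite -?qq' //; have := he i; rewrite (vgeMr _ _ (pvX i qb)).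
apply: (trunc_geX qm' q1 qb' H); rewrite -[q](subrK q'); apply: trunc_geD.
  apply/(trunc_ge_small qm'); first by rewrite -qq' size_sub_monic.
  by rewrite vgeB // ?(vgeP _ qb) ?(vgeP _ qb').
by apply: (trunc_ge_le bb'); apply: trunc_ge_q.
Qed.

End Truncation.

(** * Minima of finitely many values *)

Section BigMin.
Variables (K : fieldType) (V : ozmodType) (nu : valuation (ratfun K) V).
Implicit Types a : vinf V.

Lemma le_bigmin_seq (I : eqType) (r : seq I) (G : I -> vinf V) a :
  a <= \big[Num.min / \top%O]_(i <- r) G i <-> forall i, i \in r -> a <= G i.
Proof.
elim: r => [|i r IH]; first by rewrite big_nil lex1; split.
rewrite big_cons le_min; split=> [/andP[ai /IH H] j|H].
  by rewrite inE => /orP[/eqP->|/H].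
rewrite H ?inE ?eqxx //; apply/IH => j jr; by rewrite H // inE jr orbT.
Qed.

Lemma le_bigmin_ordP n (G : 'I_n -> vinf V) a :
  a <= \big[Num.min / \top%O]_(i < n) G i <-> forall i, a <= G i.
Proof.
split=> [/le_bigmin_seq H i|H]; first by apply: H; rewrite mem_index_enum.
by apply/le_bigmin_seq => i _.
Qed.

Lemma pv_sum_ge a I (r : seq I) (P : pred I) (G : I -> {poly K}) :
  (forall i, P i -> a <= pv nu (G i)) -> a <= pv nu (\sum_(i <- r | P i) G i).
Proof.
move=> H; apply: (big_ind (fun f => a <= pv nu f)) => //.
  by rewrite pv0; exact: lex1.
by move=> f g af ag; apply: le_trans (pvD_min nu f g); rewrite le_min af.
Qed.

Lemma bigmin_attained_seq (I : eqType) (r : seq I) (G : I -> vinf V) w :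
  \big[Num.min / \top%O]_(i <- r) G i = Fin w -> exists2 i, i \in r & G i = Fin w.
Proof.
elim: r => [|i r IH]; first by rewrite big_nil.
rewrite big_cons minEle; case: ifP => _ E; first by exists i; rewrite ?inE ?eqxx.
by have [j jr Gj] := IH E; exists j; rewrite ?inE ?jr ?orbT.
Qed.

Lemma bigmin_attained n (G : 'I_n -> vinf V) w :
  \big[Num.min / \top%O]_(i < n) G i = Fin w -> exists i, G i = Fin w.
Proof. by move/bigmin_attained_seq => [i _ Gi]; exists i. Qed.

End BigMin.

(** * Well ordered index sets *)

Section IndexTheory.
Variables (disp : Order.disp_t) (L : bOrderType disp).
Hypothesis L_wo : well_ordered L.
Implicit Types (D : set L) (i j k l m q : L) (s t : nat).

Lemma wf_min (P : L -> Prop) : (exists i, P i) ->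
  exists i, P i /\ forall j, P j -> (i <= j)%O.
Proof.
case=> i; elim/(well_founded_ind L_wo): i => i IH Pi.
have [[j Pj ji]|H] := pselect (exists2 j, P j & (j < i)%O); first exact: IH Pj.
exists i; split=> // j Pj; rewrite leNgt; apply/negP => ji.
by apply: H; exists j.
Qed.

Lemma succ_lt i j : succ i j -> (i < j)%O. Proof. by case. Qed.

Lemma succ_uniq i j k : succ i j -> succ i k -> j = k.
Proof.
by move=> [ij Hj] [ik Hk]; apply: le_anti; rewrite Hj //= Hk.
Qed.

Lemma lt_succ_le i j k : succ i j -> (k < j)%O -> (k <= i)%O.
Proof.
by move=> [ij H] kj; rewrite leNgt; apply/negP => /H; rewrite leNgt kj.
Qed.

Lemma succ_exists i j : (i < j)%O -> exists k, succ i k.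
Proof. by move=> ij; case: (wf_min (ex_intro (fun k => (i < k)%O) j ij)) => k; exists k. Qed.

Lemma plus_nat_uniq i t j k : plus_nat i t j -> plus_nat i t k -> j = k.
Proof.
elim: t j k => [|t IH] j k /=; first by move=> -> ->.
by move=> [j' /IH Hj sj] [k' /Hj <- sk]; apply: succ_uniq sj sk.
Qed.

Lemma plus_nat_le i t j : plus_nat i t j -> (i <= j)%O.
Proof.
elim: t j => [|t IH] j /=; first by move=> ->.
by move=> [k /IH ik [kj _]]; apply: le_trans ik (ltW kj).
Qed.

Lemma plus_nat_cat i s j t k : plus_nat i s j -> plus_nat j t k -> plus_nat i (s + t) k.
Proof.
move=> Hj; elim: t k => [|t IH] k /=; first by rewrite addn0 => ->.
by rewrite addnS => -[m /IH Hm mk]; exists m.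
Qed.

Lemma plus_nat_split i s t k : plus_nat i (s + t) k ->
  exists2 j, plus_nat i s j & plus_nat j t k.
Proof.
elim: t k => [|t IH] k; first by rewrite addn0 => ?; exists k.
rewrite addnS => -[m /IH[j ij jm] mk]; exists j => //; by exists m.
Qed.

Lemma plus_omega_uniq i j k : plus_omega i j -> plus_omega i k -> j = k.
Proof.
move=> [H1 M1] [H2 M2]; apply: le_anti; rewrite M1 ?M2 // => t m im.
  by have [m' im' m'j] := H1 t; rewrite (plus_nat_uniq im im').
by have [m' im' m'j] := H2 t; rewrite (plus_nat_uniq im im').
Qed.

Lemma plus_omega_nat_lt i j t k : plus_omega i j -> plus_nat i t k -> (k < j)%O.
Proof. by move=> [/(_ t)[k' ik' k'j] _] ik; rewrite (plus_nat_uniq ik ik'). Qed.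

Lemma plus_omega_lt i j : plus_omega i j -> (i < j)%O.
Proof. by move=> H; apply: (plus_omega_nat_lt (t := 0) H). Qed.

Lemma plus_nat_between i t j k : plus_nat i t j -> (i <= k)%O -> (k <= j)%O ->
  exists s, plus_nat i s k.
Proof.
elim: t j => [|t IH] j /=.
  by move=> -> ik ki; exists 0%N; apply: le_anti; rewrite ik ki.
move=> [j' ij' sj] ik; rewrite le_eqVlt => /orP[/eqP ->|/(lt_succ_le sj)]; last exact: IH ik.
by exists t.+1, j'.
Qed.

Lemma plus_omega_between i j k : plus_omega i j -> (i <= k)%O -> (k < j)%O ->
  exists s, plus_nat i s k.
Proof.
move=> [H M] ik kj.
have [[t [m im km]]|E] := pselect (exists t, exists2 m, plus_nat i t m & (k <= m)%O).
  exact: plus_nat_between im ik km.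
have /M : forall t m, plus_nat i t m -> (m < k)%O.
  by move=> t m im; rewrite ltNge; apply/negP => km; apply: E; exists t, m.
by rewrite leNgt kj.
Qed.

Lemma plus_omega_shift i j t k : plus_omega i j -> plus_nat i t k -> plus_omega k j.
Proof.
move=> ij ik; split=> [s|m H].
  have [m im mj] := ij.1 (t + s)%N; have [k' ik' k'm] := plus_nat_split im.
  by exists m; rewrite // (plus_nat_uniq ik ik').
apply: ij.2 => s n i_n; have [n' in' _] := ij.1 (s + t)%N.
have [n'' in'' H1] := plus_nat_split in'.
move: in'; rewrite addnC => /plus_nat_split[k' ik' kn'].
rewrite (plus_nat_uniq i_n in''); apply: le_lt_trans (plus_nat_le H1) _.
by apply: (H s); rewrite (plus_nat_uniq ik ik').
Qed.

(** Such a predecessor would be some [i + t], and [j] would be [i + (t + 1)], which lies below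
    [i + omega]. *)
Lemma plus_omega_not_succ i j k : plus_omega i j -> ~ succ k j.
Proof.
move=> ij kj; have := succ_lt kj; have [ik|ki _] := leP i k; last first.
  by have := kj.2 _ ki; rewrite leNgt (plus_omega_lt ij).
move=> /(plus_omega_between ij ik)[t it].
have := plus_omega_nat_lt ij (_ : plus_nat i t.+1 j); rewrite ltxx => H.
by have : false by apply: H; exists k.
Qed.

Lemma plus_omega_le i j k : (forall m, ~ succ m j) -> (i < j)%O -> plus_omega i k ->
  (k <= j)%O.
Proof.
move=> nj ij ik; apply: ik.2 => t; elim: t => [|t IH] m /=; first by move=> ->.
move=> [n /IH nj' nm]; rewrite lt_neqAle nm.2 // andbT.
by apply/eqP => mj; apply: (nj n); rewrite -mj.
Qed.

Lemma plus_omega_le_lim i j l m : plus_omega l j -> (i < j)%O -> plus_omega i m -> (m <= j)%O.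
Proof. by move=> lj; apply: plus_omega_le => k; apply: plus_omega_not_succ lj. Qed.

Variable alpha : L -> nat.
Local Notation inessential := (inessential alpha).
Local Notation nxt := (nxt alpha).

Lemma inessential_shift D i t k : inessential D i -> plus_nat i t k -> inessential D k.
Proof.
move=> [[j ij Dj] a1] ik; split; first by exists j => //; apply: plus_omega_shift ij ik.
by move=> s m km; apply: (a1 (t + s)%N); apply: plus_nat_cat ik km.
Qed.

Lemma inessential_sub D D' i : (D `<=` D') -> inessential D i -> inessential D' i.
Proof. by move=> DD' [[j ij Dj] a1]; split=> //; exists j => //; apply: DD'. Qed.

Lemma sub_upto i j : (i <= j)%O -> upto i `<=` upto j.
Proof. by move=> ij k /= ki; apply: le_trans ki ij. Qed.

Lemma inessential_succ_alpha1 D i j : inessential D i -> succ i j -> alpha j = 1%N.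
Proof. by move=> [_ H] ij; apply: (H 1%N); exists i. Qed.

Lemma nxt_lt D i j : nxt D i j -> (i < j)%O.
Proof. by move=> [_ _ [[_ /plus_omega_lt]|[_ /succ_lt]]]. Qed.

Lemma nxt_uniq D i j k : nxt D i j -> nxt D i k -> j = k.
Proof.
move=> [_ _ Hj] [_ _ Hk]; case: Hj Hk => -[Hi ij] [] [Hi' ik] //.
  exact: plus_omega_uniq ij ik.
exact: succ_uniq ij ik.
Qed.

Lemma nxt_exists l i : (i < l)%O -> exists j, nxt (upto l) i j.
Proof.
move=> il; have [H|H] := pselect (inessential (upto l) i).
  by have [[j ij jl] _] := H; exists j; split=> //; [exact: ltW | left].
have [j ij] := succ_exists il; exists j; split; rewrite /upto /=; first exact: ltW.
  exact: ij.2.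
by right.
Qed.

Lemma nxt_inessential D i j k : nxt D i j -> plus_omega k j ->
  inessential D i /\ plus_omega i j.
Proof. by move=> [_ _ [//|[_ ij]]] kj; case: (plus_omega_not_succ kj ij). Qed.

Lemma nxt_inessential_sub D D' i j : D `<=` D' -> nxt D i j -> inessential D i -> nxt D' i j.
Proof.
move=> DD' [Di Dj [[Hi ij]|[]//]] _.
by split; [exact: DD' | exact: DD' | left; split => //; exact: inessential_sub Hi].
Qed.

(** An inessential index may cease to be so below [l] only because its [+ omega] lies beyond [l];
    its new [i+] is then [i + 1], where [alpha] is 1. *)
Lemma nxt_upto_setT l i j : nxt (upto l) i j -> nxt setT i j \/ alpha j = 1%N.
Proof.
move=> [_ _ [[Hi ij]|[Hi ij]]].
  by left; split=> //; left; split=> //; apply: inessential_sub Hi.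
have [H|H] := pselect (inessential setT i).
  by right; apply: inessential_succ_alpha1 H ij.
by left; split=> //; right.
Qed.

(** If [k] lies beyond [m], it can only be [q + omega]; then [m] is some [q + s] and shares the next
    index [k]. *)
Lemma nxt_upto_down l m q k : (q < m)%O -> (m <= l)%O -> nxt (upto l) q k ->
  nxt (upto m) q k \/
  [/\ (m < k)%O, inessential (upto l) q, plus_omega q k & nxt (upto l) m k].
Proof.
move=> qm ml [ql kl [[Hq qk]|[Hq qk]]].
  have [km|mk] := leP k m.
    by left; split=> //; [exact: ltW | left; split=> //; case: Hq => _ ?; split=> //; exists k].
  right; split=> //; have [s qs] := plus_omega_between qk (ltW qm) mk.
  split=> //; left; split; first exact: inessential_shift Hq qs.
  exact: plus_omega_shift qk qs.
left; split; [exact: ltW | exact: qk.2 | right; split=> // H; apply: Hq].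
exact: inessential_sub (sub_upto ml) H.
Qed.

Lemma nxt_upto_up l m q k : (q < m)%O -> (m <= l)%O -> nxt (upto m) q k ->
  nxt (upto l) q k \/
  exists k', [/\ inessential (upto l) q, nxt (upto l) q k' & nxt (upto l) m k'].
Proof.
move=> qm ml qk; have [k' qk'] := nxt_exists (lt_le_trans qm ml).
have [H|[_ Hq _ mk']] := nxt_upto_down qm ml qk'; last by right; exists k'.
by left; rewrite (nxt_uniq qk H).
Qed.

Lemma nxt_setT_upto j l i k : plus_omega l j -> (i < j)%O -> nxt setT i k -> nxt (upto j) i k.
Proof.
move=> lj ij [_ _ [[Hi ik]|[Hi ik]]].
  have kj := plus_omega_le_lim lj ij ik.
  split=> //; first exact: ltW.
  by left; split=> //; case: Hi => _ ?; split=> //; exists k.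
split; [exact: ltW | exact: ik.2 | right; split=> // H; apply: Hi].
exact: inessential_sub H.
Qed.

Lemma nxt_upto_setT_lim j l i k : plus_omega l j -> (i < j)%O -> nxt (upto j) i k ->
  nxt setT i k.
Proof.
move=> lj ij [_ _ [[Hi ik]|[Hi ik]]]; split=> //.
  by left; split=> //; apply: inessential_sub Hi.
right; split=> // H; apply: Hi; have [[m im _] a1] := H.
by split=> //; exists m => //; apply: plus_omega_le_lim lj ij im.
Qed.

End IndexTheory.

(** * The graded algebra *)

Section GradedTheory.
Local Open Scope quotient_scope.
Variables (F : fieldType) (V : ozmodType) (nu : valuation F V).
Implicit Types (y z : F) (b c : V).

Lemma gr_classE b y (H : gr_valid nu [:: (b, y)]) : gr_class nu b y = \pi_(gr nu) (GrRaw H).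
Proof. by rewrite /gr_class /insubd insubT. Qed.

Lemma gr_valid1 b y : Fin b <= nu y -> gr_valid nu [:: (b, y)].
Proof. by rewrite /gr_valid /= andbT. Qed.

Lemma gr_comp1 b y c : gr_comp [:: (b, y)] c = if b == c then y else 0.
Proof. by rewrite /gr_comp big_mkcond big_seq1. Qed.

Lemma gr_class_eq0 b y : Fin b <= nu y -> gr_class nu b y = 0 <-> Fin b < nu y.
Proof.
move=> H; rewrite (gr_classE (gr_valid1 H)).
have -> : 0 = \pi_(gr nu) (graw0 nu) by change (gr_zero nu = \pi_(gr nu) (graw0 nu)); rewrite piE.
split=> [/eqmodP/asboolP/(_ b)|by_].
  by rewrite gr_comp1 gr_comp0 eqxx subr0.
by apply: gr_piP => c; rewrite gr_comp1 gr_comp0 subr0; case: eqP => [<-//|_]; exact: val_lt0.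
Qed.

Lemma gr_classD b y z : Fin b <= nu y -> Fin b <= nu z ->
  gr_class nu b (y + z) = gr_class nu b y + gr_class nu b z.
Proof.
move=> Hy Hz; rewrite (gr_classE (gr_valid1 Hy)) (gr_classE (gr_valid1 Hz)).
rewrite (gr_classE (gr_valid1 (val_leD Hy Hz))).
change (\pi_(gr nu) (GrRaw (gr_valid1 (val_leD Hy Hz))) =
  gr_add (\pi_(gr nu) (GrRaw (gr_valid1 Hy))) (\pi_(gr nu) (GrRaw (gr_valid1 Hz)))).
rewrite -pi_gr_add.
apply: gr_piE => c /=; rewrite (gr_compD [:: _] [:: _]) !gr_comp1.
by case: eqP; rewrite ?addr0.
Qed.

Lemma gr_classM b c y z : Fin b <= nu y -> Fin c <= nu z ->
  gr_class nu (b + c) (y * z) = gr_class nu b y * gr_class nu c z.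
Proof.
move=> Hy Hz; rewrite (gr_classE (gr_valid1 Hy)) (gr_classE (gr_valid1 Hz)).
rewrite (gr_classE (gr_valid1 (val_leM Hy Hz))).
change (\pi_(gr nu) (GrRaw (gr_valid1 (val_leM Hy Hz))) =
  gr_mul (\pi_(gr nu) (GrRaw (gr_valid1 Hy))) (\pi_(gr nu) (GrRaw (gr_valid1 Hz)))).
rewrite -pi_gr_mul.
by apply: gr_piE => e.
Qed.

Lemma gr_class1 : gr_class nu 0 1 = 1.
Proof.
have H : Fin 0 <= nu 1 by rewrite Defs.val1.
rewrite (gr_classE (gr_valid1 H)).
by change (\pi_(gr nu) (GrRaw (gr_valid1 H)) = gr_one nu); rewrite piE; apply: gr_piE.
Qed.

Lemma gr_class0 b : gr_class nu b 0 = 0.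
Proof. by apply/gr_class_eq0; rewrite Defs.val0. Qed.

Lemma gr_class_sum b I (r : seq I) (P : pred I) (f : I -> F) :
  (forall i, P i -> Fin b <= nu (f i)) ->
  gr_class nu b (\sum_(i <- r | P i) f i) = \sum_(i <- r | P i) gr_class nu b (f i).
Proof.
move=> H; suff [] : Fin b <= nu (\sum_(i <- r | P i) f i) /\
  gr_class nu b (\sum_(i <- r | P i) f i) = \sum_(i <- r | P i) gr_class nu b (f i) by [].
apply: (big_rec2 (fun y g => Fin b <= nu y /\ gr_class nu b y = g)).
  by rewrite Defs.val0 gr_class0.
by move=> i g y /H fi [yb <-]; rewrite val_leD // gr_classD.
Qed.

Lemma in_formE b y : nu y = Fin b -> in_form nu y = gr_class nu b y.
Proof. by rewrite /in_form => ->. Qed.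

Lemma in_form_neq0 b y : nu y = Fin b -> in_form nu y <> 0.
Proof.
move=> yb; rewrite (in_formE yb) => /gr_class_eq0; rewrite yb lexx => /(_ isT).
by rewrite ltxx.
Qed.

Lemma in_form0 : in_form nu 0 = 0.
Proof. by rewrite /in_form Defs.val0. Qed.

Lemma in_formM y z : in_form nu (y * z) = in_form nu y * in_form nu z.
Proof.
rewrite {2 3}/in_form; case Ey : (nu y) => [b|]; last first.
  by move/val_top: Ey => ->; rewrite mul0r in_form0 mul0r.
case Ez : (nu z) => [c|]; last first.
  by move/val_top: Ez => ->; rewrite mulr0 in_form0 mulr0.
rewrite -gr_classM ?Ey ?Ez //; apply: in_formE.
by rewrite Defs.valM Ey Ez.
Qed.

Lemma in_form1 : in_form nu 1 = 1.
Proof. by rewrite (in_formE (Defs.val1 nu)) gr_class1. Qed.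

Lemma in_formX y n : in_form nu (y ^+ n) = in_form nu y ^+ n.
Proof. by elim: n => [|n IH]; rewrite ?in_form1 // !exprS in_formM IH. Qed.

Lemma in_form_homogeneous y : homogeneous (in_form nu y).
Proof.
rewrite /in_form; case Ey : (nu y) => [b|]; first by exists b, y; rewrite Ey.
by exists 0, 0; rewrite Defs.val0 gr_class0.
Qed.

Lemma sum_gr_class (s : seq (V * F)) (H : gr_valid nu s) :
  \sum_(t <- s) gr_class nu t.1 t.2 = \pi_(gr nu) (GrRaw H).
Proof.
elim: s H => [|[b y] s IH] H.
  rewrite big_nil; change (gr_zero nu = \pi_(gr nu) (GrRaw H)); rewrite piE.
  exact: gr_piE.
have /andP[Hy Hs] : (Fin b <= nu y) && gr_valid nu s by [].
rewrite big_cons (IH Hs) (gr_classE (gr_valid1 Hy)).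
change (gr_add (\pi_(gr nu) (GrRaw (gr_valid1 Hy))) (\pi_(gr nu) (GrRaw Hs)) =
  \pi_(gr nu) (GrRaw H)).
by rewrite -pi_gr_add; apply: gr_piE.
Qed.

End GradedTheory.

Section GradedEmbedding.
Local Open Scope quotient_scope.
Variables (K F : fieldType) (V : ozmodType) (nu : valuation F V).
Variable f : {rmorphism K -> F}.

(** [gr_embed] uses a representative chosen by the quotient. Applying [f] to the entries of a list
    commutes with taking its component in each degree, so that any representative gives the same
    result. *)
Lemma gr_embed_in_form c :
  gr_embed (in_form (restriction nu f) c) = in_form nu (f c).
Proof.
pose m (s : seq (V * K)) := [seq (t.1, f t.2) | t <- s].
have mv s : gr_valid (restriction nu f) s -> gr_valid nu (m s).
  by move=> H; rewrite /gr_valid all_map; apply: sub_all H.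
have mE s : \sum_(t <- s) gr_class nu t.1 (f t.2) =
            \sum_(t <- m s) gr_class nu t.1 t.2 by rewrite big_map.
have mc s b : gr_comp (m s) b = f (gr_comp s b).
  by rewrite /gr_comp big_map rmorph_sum.
have embE (s : gr_raw (restriction nu f)) :
    gr_embed (\pi_(gr (restriction nu f)) s) = \pi_(gr nu) (GrRaw (mv _ (gr_seqP s))).
  rewrite /gr_embed mE (sum_gr_class (mv _ (gr_seqP _))); apply: gr_piP => b /=.
  rewrite !mc -rmorphB -opprB rmorphN Defs.valN.
  exact: (gr_repr s b).
rewrite /in_form /=; case E : (nu (f c)) => [b|].
  have H : Fin b <= restriction nu f c by rewrite /= E.
  have H' : Fin b <= nu (f c) by rewrite E.
  rewrite (gr_classE (gr_valid1 H)) embE (gr_classE (gr_valid1 H')).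
  exact: gr_piE.
have <- : \pi_(gr (restriction nu f)) (graw0 _) = 0.
  by change (\pi_(gr (restriction nu f)) (graw0 _) = gr_zero _); rewrite piE.
rewrite embE; have -> : 0 = \pi_(gr nu) (graw0 nu).
  by change (gr_zero nu = \pi_(gr nu) (graw0 nu)); rewrite piE.
by apply: gr_piE.
Qed.

End GradedEmbedding.

(** * Binomial coefficients in characteristic p *)

Section BinomialChar.
Variables (K : fieldType) (p : nat).
Hypothesis pK : p \in [pchar K].

Lemma coef_X1n n i : (('X + 1) ^+ n : {poly K})`_i = ('C(n, i))%:R.
Proof.
rewrite addrC exprDn.
have -> : \sum_(j < n.+1) (1 ^+ (n - j) * 'X^j *+ 'C(n, j)) =
    \poly_(j < n.+1) ('C(n, j))%:R :> {poly K}.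
  rewrite poly_def; apply: eq_bigr => j _.
  by rewrite expr1n mul1r -mulr_natl -polyC_natr mul_polyC.
rewrite coef_poly; case: ifP => // /negbT; rewrite -leqNgt => ni.
by rewrite bin_small.
Qed.

Lemma X1n_pchar u m : (('X + 1) ^+ (p ^ u * m) : {poly K}) = ('X^(p ^ u) + 1) ^+ m.
Proof.
have pP : p \in [pchar {poly K}].
  by rewrite inE (pcharf_prime pK) -polyC_natr (pcharf0 pK) polyC0 eqxx.
rewrite exprM exprDn_pchar ?expr1n // pnatX.
by rewrite (eq_pnat _ (pcharf_eq pP)) pnat_id ?orbT // (pcharf_prime pK).
Qed.

(** Compare coefficients in [(X + 1)^(p^a) = X^(p^a) + 1]. *)
Lemma bin_pchar_eq0 a k : (0 < k < p ^ a)%N -> ('C(p ^ a, k))%:R = 0 :> K.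
Proof.
move=> /andP[k0 ka]; rewrite -coef_X1n -[X in _ ^+ X]muln1 X1n_pchar expr1.
by rewrite coefD coefXn coef1 ltn_eqF // gtn_eqF // addr0.
Qed.

(** The coefficient of [X^(p^a)] in [(X^(p^a) + 1)^m] is [m]. *)
Lemma bin_pchar_neq0 a m : ~~ (p %| m)%N -> ('C(p ^ a * m, p ^ a))%:R != 0 :> K.
Proof.
move=> pm; rewrite -coef_X1n X1n_pchar addrC exprDn coef_sum.
have P0 : (0 < p ^ a)%N by rewrite expn_gt0 prime_gt0 ?(pcharf_prime pK).
case: m pm => [|m] pm; first by rewrite dvdn0 in pm.
rewrite (bigD1 (Ordinal (isT : (1 < m.+2)%N))) //= big1 => [|[i im] /= i1].
  by rewrite expr1n mul1r coefMn coefXn eqxx bin1 addr0 -(dvdn_pcharf pK).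
rewrite expr1n mul1r -exprM coefMn coefXn -{1}[(p ^ a)%N]muln1 eqn_pmul2l //.
by have /negPf := i1; rewrite -val_eqE /= eq_sym => ->; rewrite mul0rn.
Qed.

(** By Bezout some integer multiple of [f *+ n] is [f] again, and integer multiples never lower the
    value; the two values therefore bound each other. *)
Lemma pv_mulrn_pchar (V : ozmodType) (nu : valuation (ratfun K) V) (f : {poly K}) n :
  n%:R != 0 :> K -> pv nu (f *+ n) = pv nu f.
Proof.
rewrite -(dvdn_pcharf pK) => pn.
have n0 : (0 < n)%N by case: n pn => //; rewrite dvdn0.
have /(coprimeP _ n0)[[m l] /= ml] : coprime n p.
  by rewrite coprime_sym prime_coprime // (pcharf_prime pK).
have mn : f *+ n *+ m = f.
  rewrite -mulrnA mulnC (_ : (m * n)%N = (l * p).+1); last by lia.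
  by rewrite mulrS mulrnA -mulr_natr -polyC_natr (pcharf0 pK) mulr0 addr0.
case E : (pv nu (f *+ n)) => [v|]; last first.
  have := E; move/val_top/eqP; rewrite tofrac_eq0 => /eqP fn0.
  by rewrite -mn fn0 mul0rn pv0.
case E' : (pv nu f) => [w|]; last first.
  have := E'; move/val_top/eqP; rewrite tofrac_eq0 => /eqP f0.
  by rewrite f0 mul0rn pv0 in E.
congr Some; apply: le_anti.
have := vge_const m (vge_pv E); rewrite mn (vgeP _ E') => ->.
by have := vge_const n (vge_pv E'); rewrite (vgeP _ E) => ->.
Qed.

End BinomialChar.

(** * Sequences of key polynomials of constant degree *)

Section Tail.
Variables (K : fieldType) (V : ozmodType) (nu : valuation (ratfun K) V).
Local Notation pv := (pv nu).
Local Notation vge := (vge nu).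
Local Notation trunc_ge := (trunc_ge nu).
Variables (q : nat -> {poly K}) (N : nat) (b : nat -> V).
Hypotheses (N1 : (1 < N)%N) (qm : forall t, q t \is monic)
  (qN : forall t, size (q t) = N) (qb : forall t, pv (q t) = Fin (b t))
  (blt : forall s t, (s < t)%N -> b s < b t)
  (q_mul : forall t, trunc_mul nu (q t)).
Implicit Types (s t : nat) (h : {poly {poly K}}).

Let q1 t : (1 < size (q t))%N. Proof. by rewrite qN. Qed.

Let ble s t : (s <= t)%N -> b s <= b t.
Proof. by rewrite leq_eqVlt => /orP[/eqP->//|/blt/ltW]. Qed.

Lemma size_sub_tail s t : (size (q t - q s)%R < N)%N.
Proof. by rewrite -(qN t) size_sub_monic // !qN. Qed.

Lemma vge_sub_tail s t : (s <= t)%N -> vge (b s) (q t - q s).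
Proof. by move=> st; rewrite vgeB // (vgeP _ (qb _)) // ble. Qed.

Lemma pv_sub_tail s t : (s < t)%N -> pv (q t - q s) = Fin (b s).
Proof.
move=> st; rewrite addrC; have qs : pv (- q s) = Fin (b s) by rewrite pvN.
by rewrite pvD_lt // qs qb vinf_ltE blt.
Qed.

Section Carry.
Variables (h : {poly {poly K}}) (B : V) (s t : nat).
Hypotheses (st : (s <= t)%N) (hN : forall j, (size (h`_j)%R < N)%N)
  (hB : forall j, vge (B - b s *+ j) h`_j).

(** The Taylor coefficients of [h.[q s]] at [q t]. Their degrees may be too large for a
    [q t]-expansion, and reducing them produces the carries. *)
Let P i := (h^`N(i)).[- (q t - q s)].

Lemma taylor_tail m : (size h <= m)%N -> h.[q s] = \sum_(i < m) P i * q t ^+ i.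
Proof.
move=> hm; rewrite -(nderiv_taylor_wide _ hm); last exact: mulrC.
by rewrite opprB subrK.
Qed.

(** The coefficients of [h] and [q t - q s] have degree less than [q 0], where the truncation is
    [nu]; the bound follows by multiplicativity at [q 0]. The same argument at [q s] would leave no
    gain for the carries. *)
Lemma trunc_ge_taylor i : trunc_ge (q 0%N) (B - b s *+ i) (P i).
Proof.
rewrite /P horner_coef; apply: trunc_ge_sum => // -[j _] _ /=.
rewrite coef_nderivn mulrnAl; apply: trunc_geMn => //.
rewrite (_ : B - b s *+ i = (B - b s *+ (i + j)) + b s *+ j); last first.
  by rewrite mulrnDr opprD addrA subrK.
apply: (trunc_geM _ _ (qb 0)) => //.
  by apply/trunc_ge_small; rewrite ?qN.
apply: (trunc_geX _ _ (qb 0)) => //; apply/trunc_ge_small => //.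
  by rewrite size_polyN qN size_sub_tail.
by rewrite vgeN vge_sub_tail.
Qed.

(* Reducing the Taylor coefficients modulo [q t] creates carries, whose value is
   larger than the expected one by at least [b s - b 0], since the truncation at
   [q 0] controls the reduction. *)
Lemma taylor_carry e i : q_expansion (q t) h.[q s] e ->
  vge (B - b s *+ i + (b s - b 0%N)) (e`_i - P i).
Proof.
move=> He.
have /choice[E HE] k : exists E, q_expansion (q t) (P k) E.
  exact: q_expansion_exists.
have EB k j : vge (B - b s *+ k - b 0%N *+ j) (E k)`_j.
  apply: (trunc_ge_small_div (qm 0) (q1 0) (qb 0) (@q_mul 0) j (qm t) _ _
    (trunc_ge_taylor k)) => //.
    by rewrite !qN.
  by rewrite (vgeP _ (qb _)) ble.
pose m := maxn (size h) i.+1.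
have eE : e = \sum_(k <- iota 0 m) E k * 'X^k.
  apply: q_expansion_uniq He _ => //.
  rewrite (taylor_tail (leq_maxl _ _ : (_ <= m)%N)) -(big_mkord xpredT (fun k => P k * q t ^+ k)).
  rewrite /index_iota subn0; apply: q_expansion_sum => [|k _]; first by rewrite qN ltnW.
  by apply: q_expansionMXn => //; rewrite qN ltnW.
have im : (i < m)%N by rewrite leq_maxr.
(* Index [i] receives carries from the lower indices [k < i]; the higher coefficients of [E i] leave
   it and account for the rest of the difference with [P i]. *)
have -> : e`_i = (E i)`_0 + \sum_(k < m | (k < i)%N) (E k)`_(i - k).
  rewrite eE coef_sum -[in iota 0 m](subn0 m) -/(index_iota 0 m) big_mkord.
  rewrite (bigD1 (Ordinal im)) //= coefMXn ltnn subnn; congr (_ + _).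
  rewrite [RHS]big_mkcond [LHS]big_mkcond; apply: eq_bigr => -[k km] _ /=.
  by rewrite coefMXn -val_eqE /=; case: (ltngtP k i).
have [Pi _] := HE i; rewrite [P i]Pi.
rewrite (horner_coef_wide _ (leq_maxl (size (E i)) 1%N)).
case Em : (maxn _ _) (leq_maxr (size (E i)) 1%N) => [//|l] _.
rewrite big_ord_recl expr0 mulr1.
have cancel (x y z : {poly K}) : x + y - (x + z) = y - z.
  by rewrite opprD addrACA subrr add0r.
rewrite cancel.
have st0 : b 0%N <= b s by apply: ble.
apply: vgeB; apply: vge_sum => -[k km] /= H.
  apply: vge_le (EB k (i - k)%N); rewrite -(addrA B) -(addrA B) ozD2l.
  rewrite -{1}(subnKC (ltnW H)) mulrnDr opprD -addrA ozD2l addrC oz_leBlDr.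
  by rewrite [leRHS]addrC; apply: oz_subr_leMn; rewrite ?subn_gt0.
apply: vge_le (vgeM (EB i (bump 0 k)) (vgeX _ (vge_pv (qb t)))).
rewrite -!addrA !ozD2l addrC; apply: le_trans (_ : b s *+ k.+1 - b 0%N *+ k.+1 <= _).
  exact: oz_subr_leMn.
by rewrite ozD2r oz_leMn // ble.
Qed.
End Carry.

(** The term of index [j] in the [q t]-expansion has value at least [v + j (b t - b s)], since
    divisions cost only [b s]; for [j > 0] this exceeds [v]. *)
Lemma pv_const_coef f v s t e : (s < t)%N -> trunc_ge (q s) v f -> pv f = Fin v ->
  q_expansion (q t) f e -> pv e`_0 = Fin v.
Proof.
move=> st Hf fv He; apply: (pv_sub_lt (v := v + (b t - b s)) fv).
  by rewrite -{1}[v]addr0 oz_ltD2l oz_subr_gt0 blt.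
rewrite -vgeN opprB He.1 (horner_coef_wide _ (leq_maxl (size e) 1%N)).
case Em : (maxn _ _) (leq_maxr (size e) 1%N) => [//|l] _.
rewrite big_ord_recl expr0 mulr1 [_ + _ - _]addrC addKr; apply: vge_sum => -[k km] /= H.
have E1 : vge (v - b s *+ k.+1) e`_k.+1.
  apply: (trunc_ge_small_div (qm s) (q1 s) (qb s) (@q_mul s) k.+1 (qm t) _ _ Hf He).
    by rewrite !qN.
  by rewrite (vgeP _ (qb _)) ltW // blt.
apply: vge_le (vgeM E1 (vgeX _ (vge_pv (qb t)))).
rewrite -addrA ozD2l addrC; apply: le_trans (oz_subr_leMn (ble (ltnW st)) (ltn0Sn k)) _.
by rewrite addrC.
Qed.

End Tail.

(** * Ordered embeddings of a subgroup into the real numbers *)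

Section OrderedEmbedding.
Variables (V : ozmodType) (R : realType) (G : set V) (phi : V -> R).
Hypotheses (G0 : G 0) (GB : forall x y, G x -> G y -> G (x - y))
  (phi_emb : ordered_embedding G phi).
Implicit Types x y : V.

Lemma subgroupN x : G x -> G (- x).
Proof. by rewrite -sub0r; apply: GB. Qed.

Lemma subgroupD x y : G x -> G y -> G (x + y).
Proof. by move=> Gx /subgroupN Gy; rewrite -[y]opprK; apply: GB. Qed.

Lemma subgroupMn x n : G x -> G (x *+ n).
Proof. by move=> Gx; elim: n => // n IH; rewrite mulrS; apply: subgroupD. Qed.

Lemma phi0 : phi 0 = 0.
Proof.
have := phi_emb.1 _ _ G0 G0; rewrite addr0 => /eqP.
by rewrite -subr_eq subrr eq_sym => /eqP.
Qed.

Lemma phiD x y : G x -> G y -> phi (x + y) = phi x + phi y.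
Proof. exact: phi_emb.1. Qed.

Lemma phiB x y : G x -> G y -> phi (x - y) = phi x - phi y.
Proof.
by move=> Gx Gy; apply/eqP; rewrite eq_sym subr_eq -phiD ?subrK //; apply: GB.
Qed.

Lemma phiMn x n : G x -> phi (x *+ n) = n%:R * phi x.
Proof.
move=> Gx; elim: n => [|n IH]; first by rewrite mul0r phi0.
by rewrite mulrS phiD ?IH ?mulrS ?mulrDl ?mul1r //; apply: subgroupMn.
Qed.

Lemma phi_lt x y : G x -> G y -> (phi x < phi y) = (x < y).
Proof.
move=> Gx Gy; apply/idP/idP=> [|/(phi_emb.2 _ _ Gx Gy)//].
rewrite oz_ltNge ltNge; apply: contra; rewrite le_eqVlt => /orP[/eqP->//|].
by move/(phi_emb.2 _ _ Gy Gx)/ltW.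
Qed.

Lemma phi_le x y : G x -> G y -> (phi x <= phi y) = (x <= y).
Proof. by move=> Gx Gy; rewrite oz_leNgt leNgt phi_lt. Qed.

End OrderedEmbedding.

(** * Limit behaviour of the coefficients: exact and large indices *)

Section TailLimit.
Variables (K : fieldType) (V : ozmodType) (nu : valuation (ratfun K) V).
Local Notation pv := (pv nu).
Local Notation vge := (vge nu).
Local Notation trunc_ge := (trunc_ge nu).
Variables (q : nat -> {poly K}) (N : nat) (b : nat -> V).
Hypotheses (N1 : (1 < N)%N) (qm : forall t, q t \is monic)
  (qN : forall t, size (q t) = N) (qb : forall t, pv (q t) = Fin (b t))
  (blt : forall s t, (s < t)%N -> b s < b t)
  (q_mul : forall t, trunc_mul nu (q t)).
Variables (R : realType) (G : set V) (phi : V -> R).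
Hypotheses (G0 : G 0) (GB : forall x y, G x -> G y -> G (x - y))
  (phi_emb : ordered_embedding G phi) (Gb : forall t, G (b t))
  (Gsmall : forall (f : {poly K}) v, (size f < N)%N -> pv f = Fin v -> G v).
Variable bbar : R.
Hypotheses (bbar_gt : forall t, phi (b t) < bbar)
  (bbar_lim : forall eps, 0 < eps -> exists t, bbar - eps < phi (b t)).
Variables (F : {poly K}) (d : nat) (e : nat -> {poly {poly K}}).
Hypotheses (d0 : (0 < d)%N) (He : forall t, q_expansion (q t) F (e t))
  (ed : forall t, (e t)`_d = 1) (egt : forall t j, (d < j)%N -> (e t)`_j = 0)
  (eB : forall t j, vge (b t *+ d - b t *+ j) (e t)`_j)
  (stab : forall f : {poly K}, (size f < size F)%N ->
     exists t, forall v, vge v f -> trunc_ge (q t) v f).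
Implicit Types (s t k : nat).

Let ble s t : (s <= t)%N -> b s <= b t.
Proof. by rewrite leq_eqVlt => /orP[/eqP->//|/blt/ltW]. Qed.

Let phib s t : (s <= t)%N -> phi (b s) <= phi (b t).
Proof. by move=> st; rewrite (phi_le phi_emb) ?ble. Qed.

Lemma bbar_limM n (c : R) : 0 < c ->
  exists t0, forall t, (t0 <= t)%N -> n%:R * (bbar - phi (b t)) < c.
Proof.
move=> c0; have n0 : 0 < n.+1%:R :> R by rewrite ltr0Sn.
have [t0 Ht0] := bbar_lim (divr_gt0 c0 n0).
exists t0 => t /phib Ht; apply: le_lt_trans (_ : n.+1%:R * (bbar - phi (b t)) < _).
  by rewrite ler_wpM2r ?ler_nat // subr_ge0 ltW.
by rewrite mulrC -ltr_pdivlMr // ltrBlDr -ltrBlDl; apply: lt_le_trans Ht0 Ht.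
Qed.

Definition exact_coef k T : Prop := exists v, [/\ G v, phi v = (d - k)%:R * bbar
  & forall t, (T <= t)%N -> pv (e t)`_k = Fin v].

(* The extra term makes the corresponding monomial of value at least [d * bbar]. *)
Definition large_coef k T : Prop := exists w, [/\ G w,
  (d - k)%:R * bbar + d%:R * (bbar - phi (b T)) < phi w
  & forall t, (T <= t)%N -> vge w (e t)`_k].

Lemma size_F : size F = (d * N.-1).+1.
Proof.
have se : size (e 0%N) = d.+1.
  apply/eqP; rewrite eqn_leq; apply/andP; split.
    by apply/leq_sizeP => j /egt.
  rewrite ltnNge; apply/negP => /leq_sizeP/(_ d (leqnn _)).
  by rewrite ed => /eqP; rewrite oner_eq0.
rewrite (size_q_expansion (qm 0) (He 0)); last by rewrite -size_poly_gt0 se.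
by rewrite se qN lead_coefE se ed size_poly1 addn1.
Qed.

Lemma eN t j : (size ((e t)`_j)%R < N)%N.
Proof. by rewrite -(qN t); apply: (He t).2. Qed.

(** The coefficient of index [k] of [F] at [q t] and the constant coefficient of [g] at [q t] come
    from the same Taylor coefficient, each up to carries of value at least [E]. If [nu(g) >= E], the
    index is large. Otherwise the coefficient eventually has the value of [g], and letting [t] grow
    in [eB] shows that this value is at least [(d - k) bbar]: equality is the exact case, and a
    strict inequality leaves room for the margin once [T] is large. *)
Lemma exact_or_large_coef k : (0 < k < d)%N ->
  exists T0, forall T, (T0 <= T)%N -> exact_coef k T \/ large_coef k T.
Proof.
move=> /andP[k0 kd].
have b01 : 0 < phi (b 1) - phi (b 0).
  by rewrite subr_gt0 (phi_lt phi_emb) // blt.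
have [s0 Hs0] := bbar_limM (d - k) b01.
(* [s >= 1] keeps the gain [b s - b 0] at least [b 1 - b 0], the quantity against which [s0] was
   chosen; this gives [phi E > (d - k) bbar]. *)
pose s := maxn s0 1; have {Hs0} Hs := Hs0 s (leq_maxl _ _).
have s1 : phi (b 1) <= phi (b s) by rewrite phib // leq_maxr.
pose E := b s *+ (d - k) + (b s - b 0).
have GE : G E by apply: subgroupD => //; [apply: subgroupMn | apply: GB].
have phiE : (d - k)%:R * bbar < phi E.
  rewrite (phiD phi_emb) ?(phiMn _ _ phi_emb) ?(phiB _ phi_emb) //; last 2 first.
    exact: subgroupMn.
    exact: GB.
  move: Hs; rewrite mulrBr; lra.
pose h := (e s)^`N(k); pose g := h.[q s].
have hN j : (size (h`_j)%R < N)%N.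
  rewrite coef_nderivn -mulr_natl -polyC_natr mul_polyC.
  exact: leq_ltn_trans (size_scale_leq _ _) (eN s _).
have hB j : vge (b s *+ (d - k) - b s *+ j) h`_j.
  rewrite coef_nderivn; apply: vge_const; apply: vge_le (eB s (k + j)).
  by rewrite -{2}(subnKC (ltnW kd)) !mulrnDr opprD addrACA subrr add0r.
have sg : (size g < size F)%N.
  have qe : q_expansion (q s) g h by split=> // j; rewrite qN.
  rewrite size_F ltnS; apply: leq_trans (q_expansion_lt_size (m := (d - k).+1) (qm s) _ qe _) _.
  - by rewrite qN.
  - by move=> j dj; rewrite coef_nderivn egt ?mul0rn // -ltn_subLR // ltnW.
  - by rewrite qN leq_mul2r -subSn ?leq_subLR ?orbT //; lia.
have [t0 Ht0] := stab sg.
pose T0 := (maxn s t0).+1.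
have close t : (T0 <= t)%N -> exists g0, [/\ (forall v, vge v g -> vge v g0),
    (forall v, pv g = Fin v -> pv g0 = Fin v) & vge E ((e t)`_k - g0)].
  rewrite /T0 gtn_max => /andP[st t0t].
  have [eg Heg] : exists eg, q_expansion (q t) g eg.
    by apply: q_expansion_exists; rewrite qN.
  exists eg`_0; split=> [v /Ht0 gv|v gv|].
  - have := trunc_ge_small_div (qm t0) _ (qb t0) (@q_mul t0) 0 (qm t) _ _ gv Heg.
    by rewrite subr0; apply; rewrite ?qN // (vgeP _ (qb _)) ble // ltnW.
  - have gv' : trunc_ge (q t0) v g by apply: Ht0; rewrite (vgeP _ gv).
    exact: (pv_const_coef N1 qm qN qb blt q_mul t0t gv' gv Heg).
  have HeF : q_expansion (q t) (e s).[q s] (e t) by rewrite -(He s).1.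
  have H1 := taylor_carry N1 qm qN qb blt q_mul (ltnW st) (eN s) (eB s) k HeF.
  have := taylor_carry N1 qm qN qb blt q_mul (ltnW st) hN hB 0 Heg.
  rewrite subr0 nderivn0 -/E => H2; have := vgeB H1.
  rewrite -mulrnBr ?(ltnW kd) // -/E => /(_ _ H2).
  by rewrite -/h; set P := h.[_]; rewrite opprB subrKA.
have [gE|gE] := boolP (vge E g).
  have c0 : 0 < phi E - (d - k)%:R * bbar by rewrite subr_gt0.
  have [T1 HT1] := bbar_limM d c0; exists (maxn T0 T1) => T; rewrite geq_max.
  case/andP=> HT0 {}/HT1 HT; right; exists E; split=> // [|t Tt].
    by rewrite -ltrBrDl.
  have [g0 [/(_ _ gE) H1 _ H2]] := close t (leq_trans HT0 Tt).
  by rewrite -[_`_k](subrK g0); apply: vgeD.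
have [v gv vE] : exists2 v, pv g = Fin v & v < E.
  move: gE; rewrite vgeE -ltNge.
  case: (pv g) => [v|] //; by rewrite vinf_ltE => vE; exists v.
have ev t : (T0 <= t)%N -> pv (e t)`_k = Fin v.
  move=> /close[g0 [_ /(_ _ gv) g0v H]]; exact: pv_sub_lt g0v vE H.
have Gv : G v by apply: Gsmall (ev T0 (leqnn _)); apply: eN.
have vb : (d - k)%:R * bbar <= phi v.
  rewrite leNgt; apply/negP => vb.
  have c0 : 0 < (d - k)%:R * bbar - phi v by rewrite subr_gt0.
  have [T1 HT1] := bbar_limM (d - k) c0; have {HT1} HT := HT1 _ (leq_maxr T0 T1).
  have := eB (maxn T0 T1) k; rewrite (vgeP _ (ev _ (leq_maxl _ _))) -mulrnBr ?(ltnW kd) //.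
  rewrite -(phi_le phi_emb) ?(phiMn _ _ phi_emb) //; last exact: subgroupMn.
  by move: HT; rewrite mulrBr; lra.
move: vb; rewrite le_eqVlt => /orP[/eqP vb|vb].
  by exists T0 => T HT; left; exists v; split=> // t /(leq_trans HT)/ev.
have c0 : 0 < phi v - (d - k)%:R * bbar by rewrite subr_gt0.
have [T1 HT1] := bbar_limM d c0; exists (maxn T0 T1) => T; rewrite geq_max.
case/andP=> HT0 {}/HT1 HT; right; exists v; split=> // [|t Tt].
  by rewrite -ltrBrDl.
by rewrite (vgeP _ (ev _ (leq_trans HT0 Tt))).
Qed.

(** The first inequality says that the gain on carries from [q T] exceeds [d] times the gap
    [bbar - b T], and so also what is lost when [b T] stands for [bbar] in a threshold
    [(d - k) bbar]. *)
Lemma exact_or_large_uniform : exists T0, forall T, (T0 <= T)%N ->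
  d%:R * (bbar - phi (b T)) < phi (b T) - phi (b 0) /\
  forall k, (0 < k < d)%N -> exact_coef k T \/ large_coef k T.
Proof.
have [T0 HT0] : exists T0, forall T, (T0 <= T)%N -> forall k, (k < d)%N -> (0 < k)%N ->
    exact_coef k T \/ large_coef k T.
  have: (d <= d)%N by []; elim: {-2}d => [|m IH] md; first by exists 0%N.
  have [T1 HT1] := IH (ltnW md).
  case: (posnP m) => [m0|m0].
    by exists 0%N => T _ k; rewrite m0 ltnS leqn0 => /eqP->.
  have [|T2 HT2] := @exact_or_large_coef m; first by rewrite m0.
  exists (maxn T1 T2) => T; rewrite geq_max => /andP[H1 H2] k.
  by rewrite ltnS leq_eqVlt => /orP[/eqP-> _|]; [apply: HT2 | apply: HT1].
have b01 : 0 < phi (b 1) - phi (b 0).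
  by rewrite subr_gt0 (phi_lt phi_emb) // blt.
have [T1 HT1] := bbar_limM d b01.
exists (maxn 1 (maxn T0 T1)) => T; rewrite !geq_max => /and3P[H1 H2 H3]; split.
  by have := HT1 T H3; have := phib H1; lra.
by move=> k /andP[k0 kd]; apply: HT0.
Qed.

Variables (p e0 : nat).
Hypotheses (pK : p \in [pchar K]) (dE : d = (p ^ e0)%N).

Lemma exact_coef_pow T k :
  d%:R * (bbar - phi (b T)) < phi (b T) - phi (b 0) ->
  (forall k, (0 < k < d)%N -> exact_coef k T \/ large_coef k T) ->
  (0 < k < d)%N -> exact_coef k T -> exists a, k = (p ^ a)%N.
Proof.
move=> HT HA; have [n] := ubnP (d - k); elim: n k => // n IH j0 jn /andP[j00 j0d].
case=> v0 [Gv0 phiv0 ev0].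
have p1 : (1 < p)%N by apply: prime_gt1; apply: pcharf_prime pK.
pose u := logn p j0; pose k := (p ^ u)%N.
have kj : (k %| j0)%N by apply: pfactor_dvdnn.
have [->|kj0] := eqVneq j0 k; first by exists u.
have k0 : (0 < k)%N by rewrite expn_gt0 ltnW.
have {kj0}kj0 : (k < j0)%N by rewrite ltn_neqAle eq_sym kj0 dvdn_leq.
have Cj0 : ('C(j0, k))%:R != 0 :> K.
  rewrite -(divnK kj) mulnC; apply: (bin_pchar_neq0 pK); apply/negP => pj.
  have : (p ^ u.+1 %| j0)%N.
    by rewrite expnS -[X in (_ %| X)%N](divnK kj) dvdn_mul.
  by rewrite pfactor_dvdn ?(pcharf_prime pK) // ltnn.
clearbody k; have phiT := bbar_gt T.
(* [x] is the value of the term of index [j0] in the Taylor formula for the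
   coefficient of index [k]. *)
pose x := v0 + b T *+ (j0 - k).
have Gx : G x by apply: subgroupD => //; apply: subgroupMn.
have phix : phi x = (d - j0)%:R * bbar + (j0 - k)%:R * phi (b T).
  by rewrite (phiD phi_emb) ?(phiMn _ _ phi_emb) ?phiv0 //; apply: subgroupMn.
have kd : (k < d)%N by apply: ltn_trans j0d.
have xk : phi x < (d - k)%:R * bbar.
  have : 0 < (j0 - k)%:R * (bbar - phi (b T)).
    by rewrite mulr_gt0 ?subr_gt0 // ltr0n subn_gt0.
  rewrite phix !natrB ?(ltnW kd) ?(ltnW kj0) ?(ltnW j0d) //; lra.
pose z := - (q T.+1 - q T).
have pvz i : pv (z ^+ i) = Fin (b T *+ i).
  by apply: pvX; rewrite pvN (pv_sub_tail qb blt) //.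
pose h := e T; pose P := (h^`N(k)).[z].
(* The term of index [j0] is the only one of least value, so that it determines the value of [P]. *)
have other i : (i <= d - k)%N -> i != (j0 - k)%N -> Fin x < pv ((h^`N(k))`_i * z ^+ i).
  move=> ik ij; rewrite coef_nderivn.
  have [C0 | Cn0] := eqVneq (('C(k + i, k))%:R : K) 0.
    by rewrite -mulr_natr -polyC_natr C0 mulr0 mul0r pv0.
  set j := (k + i)%N in Cn0 *.
  have ki : (j - k)%N = i by rewrite /j addKn.
  have jd : (j < d)%N.
    have : (j <= d)%N by rewrite /j -leq_subRL // ltnW.
    rewrite leq_eqVlt => /orP[/eqP jd|//].
    by move: Cn0; rewrite jd dE bin_pchar_eq0 ?eqxx // k0 -dE.
  have j_gt0 : (0 < j)%N by rewrite (leq_trans k0) // leq_addr.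
  suff [w [Gw wx wj]] : exists w, [/\ G w, phi x < phi (w + b T *+ i) & vge w (e T)`_j].
    have := vgeM (vge_const 'C(j, k) wj) (vge_pv (pvz i)); apply: vge_gt.
    by rewrite -(phi_lt phi_emb) //; apply: subgroupD => //; apply: subgroupMn.
  have bT0 : 0 < bbar - phi (b T) by rewrite subr_gt0.
  have phiw w : G w -> phi (w + b T *+ i) = phi w + i%:R * phi (b T).
    by move=> Gw; rewrite (phiD phi_emb) ?(phiMn _ _ phi_emb) //; apply: subgroupMn.
  have [jj0|jj0|jj0] := ltngtP j j0; last by rewrite -jj0 ki eqxx in ij.
  (* Compared with the term of index [j0], the bound has [bbar] in place of [b T] in [j0 - j]
     places, hence is strictly larger. *)
  - have [w [Gw ww wj]] : exists w, [/\ G w, (d - j)%:R * bbar <= phi w & vge w (e T)`_j].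
      have /HA[[w [Gw pw ew]]|[w [Gw pw ew]]] : (0 < j < d)%N by rewrite j_gt0.
        by exists w; rewrite pw (vgeP _ (ew T (leqnn _))).
      exists w; split=> //; last exact: ew.
      by apply: le_trans (ltW pw); rewrite lerDl mulr_ge0 // ltW.
    exists w; split=> //; rewrite phiw // phix.
    have : 0 < (j0 - j)%:R * (bbar - phi (b T)) by rewrite mulr_gt0 // ltr0n subn_gt0.
    move: ww; rewrite !natrB ?(ltnW j0d) ?(ltnW jd) ?(ltnW kj0) ?(ltnW jj0) // /j natrD; lra.
  (* An exact [j > j0] is a power of [p] by induction, against the nonvanishing of the binomial
     coefficient. For a large one, the margin [d (bbar - b T)] covers the loss
     [(j - j0) (bbar - b T)]. *)
  have /HA[ex|[w [Gw pw ew]]] : (0 < j < d)%N by rewrite j_gt0.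
    have [||a ja] := IH j _ _ ex; last 2 first.
    - by rewrite j_gt0.
    - by move: Cn0; rewrite ja bin_pchar_eq0 ?eqxx // k0 -ja (ltn_trans kj0).
    by rewrite -ltnS (leq_trans _ jn) // ltnS ltn_sub2l // ltnS.
  exists w; split=> //; last exact: ew.
  rewrite phiw // phix.
  have : 0 <= (d - (j - j0))%:R * (bbar - phi (b T)) by rewrite mulr_ge0 // ltW.
  have jj0d : (j - j0 <= d)%N by apply: leq_trans (leq_subr _ _) (ltnW jd).
  move: pw; rewrite !natrB ?(ltnW j0d) ?(ltnW jd) ?(ltnW kj0) ?(ltnW jj0) // /j natrD; lra.
have pvP : pv P = Fin x.
  have sz : (size (h^`N(k))%R <= (d - k).+1)%N.
    apply/leq_sizeP => j dj; rewrite coef_nderivn egt ?mul0rn // -ltn_subLR // ltnW //.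
  have j0k : (j0 - k < (d - k).+1)%N by rewrite ltnS leq_sub2r // ltnW.
  rewrite /P (horner_coef_wide _ sz) (bigD1 (Ordinal j0k)) //=.
  have pvj : pv ((h^`N(k))`_(j0 - k) * z ^+ (j0 - k)) = Fin x.
    rewrite coef_nderivn subnKC ?(ltnW kj0) // pvM pvz.
    by rewrite (pv_mulrn_pchar pK) ?ev0.
  rewrite pvD_lt pvj //; apply: (big_ind (fun f => Fin x < pv f)).
  - by rewrite pv0.
  - by move=> f1 f2 H1 H2; rewrite /Defs.pv rmorphD val_ltD.
  move=> [i ik]; rewrite -val_eqE /= => ij; apply: other => //; by rewrite -ltnS.
have HeF : q_expansion (q T.+1) (e T).[q T] (e T.+1) by rewrite -(He T).1.
have := taylor_carry N1 qm qN qb blt q_mul (leqnSn T) (eN T) (eB T) k HeF.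
rewrite -/z -/P -mulrnBr ?(ltnW kd) // => HE.
(* [E] bounds the carries from [q T] to [q T.+1]. As [x < E], the new coefficient of index [k] has
   the value [x] of [P], too small for both alternatives. *)
pose E := b T *+ (d - k) + (b T - b 0).
have GE : G E by apply: subgroupD => //; [apply: subgroupMn | apply: GB].
have xE : x < E.
  rewrite -(phi_lt phi_emb) //; apply: lt_trans xk _.
  rewrite (phiD phi_emb) ?(phiMn _ _ phi_emb) ?(phiB _ phi_emb) //; last 2 first.
  - exact: subgroupMn.
  - exact: GB.
  have : 0 <= k%:R * (bbar - phi (b T)) by rewrite mulr_ge0 // subr_ge0 ltW.
  move: HT; rewrite natrB ?(ltnW kd) //; lra.
have ek := pv_sub_lt pvP xE HE.
have /HA[[w [Gw pw ew]]|[w [Gw pw ew]]] : (0 < k < d)%N by rewrite k0.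
  by have := ew _ (leqnSn T); rewrite ek => -[xw]; move: xk; rewrite xw pw ltxx.
have := ew _ (leqnSn T); rewrite (vgeP _ ek) -(phi_le phi_emb) // leNgt.
rewrite (lt_trans xk) //; apply: le_lt_trans pw.
by rewrite lerDl mulr_ge0 // subr_ge0 ltW.
Qed.

End TailLimit.

(** * Key polynomials *)

Section Extensionality.
Variables (K : fieldType) (V : ozmodType) (nu : valuation (ratfun K) V).
Variables (disp : Order.disp_t) (L : bOrderType disp) (alpha : L -> nat).
Local Notation exps := {fsfun L -> nat with 0%N}.
Variables (Q1 Q2 : L -> {poly K}) (l : L).
Hypothesis Q12 : forall i, (i <= l)%O -> Q1 i = Q2 i.
Implicit Types (g : exps) (s : seq (K * exps)) (f : {poly K}) (e : nat -> seq (K * exps)).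

Lemma mon_ext g : std_exps alpha l g -> mon Q1 g = mon Q2 g.
Proof.
move=> [gl _ _]; rewrite /mon big_seq [RHS]big_seq; apply: eq_bigr => i.
by rewrite mem_finsupp => /gl il; rewrite Q12.
Qed.

Lemma term_eval_ext (t : K * exps) : std_exps alpha l t.2 -> term_eval Q1 t = term_eval Q2 t.
Proof. by move=> H; rewrite /term_eval mon_ext. Qed.

Lemma expn_eval_ext s : free_std_expansion nu alpha Q1 l s -> expn_eval Q1 s = expn_eval Q2 s.
Proof.
move=> [_ H _]; rewrite /expn_eval big_seq [RHS]big_seq; apply: eq_bigr => -[c g] /H[_ gl _].
exact: term_eval_ext.
Qed.

Lemma free_std_expansion_ext s :
  free_std_expansion nu alpha Q1 l s -> free_std_expansion nu alpha Q2 l s.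
Proof.
move=> Hs; have [H1 H2 H3] := Hs; split=> //; rewrite -(expn_eval_ext Hs) H3.
rewrite big_seq [RHS]big_seq; apply: eq_bigr => -[c g] /H2[_ gl _].
by rewrite term_eval_ext.
Qed.

Lemma std_expansion_ext f N e :
  std_expansion nu alpha Q1 l f N e -> std_expansion nu alpha Q2 l f N e.
Proof.
move=> [fE H]; split=> [|j /H/free_std_expansion_ext//].
rewrite fE; apply: eq_bigr => -[j jN] _ /=.
by rewrite (expn_eval_ext (H j _)) ?Q12.
Qed.

Lemma min_value_ext f N e : std_expansion nu alpha Q1 l f N e ->
  min_value nu Q1 l N e = min_value nu Q2 l N e.
Proof.
move=> [_ H]; apply: eq_bigr => -[j jN] _ /=.
by rewrite (expn_eval_ext (H j _)) ?Q12.
Qed.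

Lemma initial_algebra_ext : initial_algebra (nu := nu) Q1 l = initial_algebra Q2 l.
Proof.
rewrite /initial_algebra; congr (subring_generated (_ `|` _)).
by apply: eq_imagel => q /= ql; rewrite Q12 // ltW.
Qed.

Lemma initial_relation_ext a e :
  (forall j, (j < a)%N -> free_std_expansion nu alpha Q1 l (e j)) ->
  initial_relation nu Q1 l a e = initial_relation nu Q2 l a e.
Proof.
move=> H; rewrite /initial_relation; congr (_ + _); apply: eq_bigr => -[j ja] _ /=.
congr (_ *: _); rewrite big_seq [RHS]big_seq; apply: eq_bigr => -[c g] cg.
by have [_ /(_ _ _ cg)[_ gl _] _] := H j ja; rewrite (mon_ext gl).
Qed.

End Extensionality.

(** * Monomials in the key polynomials and their degrees *)

Section Monomials.
Variables (K : fieldType) (V : ozmodType) (nu : valuation (ratfun K) V).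
Variables (disp : Order.disp_t) (L : bOrderType disp) (Q : L -> {poly K}).
Local Notation exps := {fsfun L -> nat with 0%N}.
Implicit Types (g : exps) (f h : {poly K}) (i j l : L).

Lemma expn_eval_nil : expn_eval Q [::] = 0.
Proof. by rewrite /expn_eval big_nil. Qed.

Lemma mon0 : mon Q [fsfun] = 1.
Proof. by rewrite /mon finsupp0 big_seq_fset0. Qed.

Lemma mon_with g j n : g j = 0%N -> mon Q [fsfun g with j |-> n] = mon Q g * Q j ^+ n.
Proof.
move=> gj; have [->|n0] := eqVneq n 0%N.
  rewrite expr0 mulr1; congr (mon Q _); apply/fsfunP => i.
  by rewrite fsfun_withE; case: eqP => // ->.
have jg : j \notin finsupp g by rewrite mem_finsupp gj.
rewrite /mon finsupp_with (negPf n0) big_fsetU1 //= fsfun_with mulrC; congr (_ * _).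
rewrite big_seq_cond [RHS]big_seq_cond; apply: eq_bigr => i /andP[ig _].
by rewrite fsfun_withE; case: eqP => // ij; rewrite -ij ig in jg.
Qed.

Lemma fsfun_without_with g j n : [fsfun [fsfun g with j |-> n] with j |-> g j] = g.
Proof. by apply/fsfunP => i; rewrite !fsfun_withE; case: eqP => // ->. Qed.

Lemma degM f h : f \is monic -> h \is monic -> deg (f * h) = (deg f + deg h)%N.
Proof.
move=> fm hm; rewrite /deg size_Mmonic ?monic_neq0 //.
have := monic_neq0 fm; have := monic_neq0 hm; rewrite -!size_poly_gt0; lia.
Qed.

Lemma degX f n : f \is monic -> deg (f ^+ n) = (n * deg f)%N.
Proof. by move=> fm; rewrite /deg size_exp mulnC. Qed.

Lemma deg_lt f h : h \is monic -> f \is monic -> (deg f < deg h)%N = (size f < size h)%N.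
Proof.
move=> hm fm; rewrite /deg.
have := monic_neq0 fm; have := monic_neq0 hm; rewrite -!size_poly_gt0; lia.
Qed.

Hypothesis Qm : forall i, Q i \is monic.

Lemma mon_monic g : mon Q g \is monic.
Proof. by apply: monic_prod => i _; apply: monic_exp. Qed.

End Monomials.

Section Keys.
Variables (K : fieldType) (V : ozmodType) (nu : valuation (ratfun K) V).
Variables (disp : Order.disp_t) (L : bOrderType disp).
Hypothesis L_wo : well_ordered L.
Variables (alpha : L -> nat) (Q : L -> {poly K}).
Hypothesis Q_key : key_polynomials nu alpha Q [set: L].
Hypothesis x_pos : Fin 0 < pv nu 'X.
Local Notation pv := (pv nu).
Local Notation vge := (vge nu).
Local Notation trunc_ge := (trunc_ge nu).
Local Notation exps := {fsfun L -> nat with 0%N}.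
Implicit Types (g : exps) (f h : {poly K}) (i j k l : L).

Lemma key_monic i : Q i \is monic.
Proof. by case: Q_key => -[/(_ i I)[]]. Qed.

Lemma key_alpha_gt0 i : (0 < alpha i)%N.
Proof. by case: Q_key => -[/(_ i I)[]]. Qed.

Lemma key_bot : Q \bot%O = 'X.
Proof. by case: Q_key => -[]. Qed.

Definition nonmax i := ~ is_max [set: L] i.

Lemma nonmax_lt i j : (i < j)%O -> nonmax i.
Proof. by move=> ij [_ /(_ j I)]; rewrite leNgt ij. Qed.

Lemma key_deg i j : nonmax j -> nxt alpha setT i j -> deg (Q j) = (alpha j * deg (Q i))%N.
Proof.
move=> nj ij; case: Q_key => -[_ _ _ H] *; apply: H => //.
by apply: contraTneq (nxt_lt ij) => ->; rewrite ltx0.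
Qed.

Lemma key_size i : size (Q i) = (deg (Q i)).+1.
Proof. by rewrite /deg prednK // size_poly_gt0 monic_neq0 // key_monic. Qed.

(** Cutting the index set at [j] can change [i+] for some [i < j]. In that case [i] and [j] have the
    same next index below [l], and since [Q_j] occurs in the monomial, [Q_i] does not. *)
Lemma std_exps_without l j g : (j < l)%O -> std_exps alpha l g -> g j != 0%N ->
  (forall i, (j < i)%O -> g i = 0%N) -> std_exps alpha j [fsfun g with j |-> 0%N].
Proof.
move=> jl [gl ga g1] gj0 gmax; split=> [i|i k ij ik|i k Hi ik j1 j2 j1k j2k].
- rewrite fsfun_withE; have [//|_ gi] := eqVneq i j; rewrite leNgt; apply/negP => /gmax gi0.
  by rewrite gi0 in gi.
- rewrite fsfun_withE (lt_eqF ij).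
  have [H|[k' [Hi ik' jk']]] := nxt_upto_up L_wo ij (ltW jl) ik.
    exact: ga (lt_trans ij jl) H.
  have [->|gi] := eqVneq (g i) 0%N; first exact: key_alpha_gt0.
  by move: ij; rewrite (g1 _ _ Hi ik' i j ik' jk' gi gj0) ltxx.
have ul := sub_upto (ltW jl).
have [_ _ [[_ iok]|[/(_ Hi)//]]] := ik.
have up m : nxt alpha (upto j) m k -> nxt alpha (upto l) m k.
  by move=> mk; have [Hm _] := nxt_inessential mk iok; apply: nxt_inessential_sub Hm.
rewrite !fsfun_withE; have [//|_ g1'] := eqVneq j1 j; have [//|_ g2'] := eqVneq j2 j.
by apply: (g1 _ _ (inessential_sub ul Hi) (up _ ik)) => //; apply: up.
Qed.

Lemma fsfun_max g : (exists i, g i != 0%N) ->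
  exists j, g j != 0%N /\ forall i, (j < i)%O -> g i = 0%N.
Proof.
case=> i0 gi0; have i0g : i0 \in finsupp g by rewrite mem_finsupp.
have [j jg Hj] : exists2 j, j \in finsupp g & forall i, i \in finsupp g -> (i <= j)%O.
  have : enum_fset (finsupp g) != [::].
    by apply/eqP => E; have : i0 \in enum_fset (finsupp g) by []; rewrite E.
  have -> : mem (finsupp g) = mem (enum_fset (finsupp g)) by [].
  elim: (enum_fset (finsupp g)) => // a r IH _.
  have [->|/IH[j jr Hj]] := eqVneq r [::].
    by exists a; rewrite ?inE // => i; rewrite inE => /eqP->.
  have [aj|ja] := leP a j.
    by exists j; rewrite ?inE ?jr ?orbT // => i; rewrite inE => /orP[/eqP->//|/Hj].
  exists a; rewrite ?inE ?eqxx // => i; rewrite inE => /orP[/eqP->//|/Hj ij].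
  exact: le_trans ij (ltW ja).
exists j; split=> [|i ji]; first by rewrite -mem_finsupp.
apply/eqP; rewrite -[_ == _]negbK -mem_finsupp; apply/negP => /Hj.
by rewrite leNgt ji.
Qed.

(** * Degrees of standard monomials *)

Definition deg_spec l := [/\ (0 < deg (Q l))%N,
  forall i, (i < l)%O -> (deg (Q i) <= deg (Q l))%N &
  forall g, std_exps alpha l g -> g l = 0%N -> (deg (mon Q g) < deg (Q l))%N].

Lemma size_expn_eval l (s : seq (K * exps)) : deg_spec l ->
  (forall c g, (c, g) \in s -> std_exps alpha l g /\ g l = 0%N) ->
  (size (expn_eval Q s) < size (Q l))%N.
Proof.
move=> [Ql0 _ H] Hs; rewrite /expn_eval big_seq.
apply: (big_ind (fun f : {poly K} => (size f < size (Q l))%N)).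
- by rewrite size_poly0 key_size.
- by move=> f1 f2 H1 H2; rewrite (leq_ltn_trans (size_polyD _ _)) // gtn_max H1.
move=> [c g] /Hs[gl gl0]; apply: leq_ltn_trans (size_scale_leq _ _) _.
by rewrite -deg_lt ?key_monic ?mon_monic ?H //; exact: key_monic.
Qed.

Lemma size_free l s : deg_spec l -> free_std_expansion nu alpha Q l s ->
  (size (expn_eval Q s) < size (Q l))%N.
Proof.
move=> Hl [_ Hs _]; apply: size_expn_eval => // c g /Hs[_ gl gl0]; by split.
Qed.

(** When [i] is inessential, [j] is not [i+] and the degree formula of pre-key polynomials does not
    apply; but then [alpha j = 1], and condition (b) shows that [Q j - Q i] has degree less than
    [Q i]. *)
Lemma deg_succ i j : nonmax j -> succ i j -> deg_spec i ->
  deg (Q j) = (alpha j * deg (Q i))%N.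
Proof.
move=> nj ij Hi.
have [Hin|Hin] := pselect (inessential alpha setT i); last first.
  by apply: key_deg => //; split=> //; right.
have a1 := inessential_succ_alpha1 Hin ij.
case: Q_key => _ _ /(_ j i I ij)[e [-> + _ _]] _ _; rewrite a1 => /(_ 0%N isT) He.
rewrite big_ord1 expr0 mulr1 expr1 mul1n /deg size_polyDl //.
exact: size_free He.
Qed.

Lemma index_cases j : j = \bot%O \/ (exists i, succ i j) \/
  (j <> \bot%O /\ forall i, ~ succ i j).
Proof.
have [->|/eqP jn] := eqVneq j \bot%O; first by left.
by right; have [H|/forallNP H] := pselect (exists i, succ i j); [left | right].
Qed.

Lemma limit_nxt j : j <> \bot%O -> (forall i, ~ succ i j) ->
  (exists i, nxt alpha setT i j) /\
  forall i, nxt alpha setT i j -> inessential alpha setT i /\ plus_omega i j.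
Proof.
move=> /eqP jn js; case: Q_key => _ _ _ /(_ j I jn js)[H _ _ _ _] _; split=> // i.
by move=> [_ _ [//|[_ /js]]].
Qed.

Lemma limit_between i j k : (forall i, ~ succ i j) -> nxt alpha setT i j ->
  (k < j)%O -> exists2 m, (k < m)%O & nxt alpha setT m j.
Proof.
move=> js [_ _ [[Hi ij]|[_ /js//]]] kj.
have [ki|ik] := leP k i.
  have [m im imj] := ij.1 1%N; have im' := plus_nat_le im.
  exists m; last first.
    split=> //; left; split; first exact: inessential_shift Hi im.
    exact: plus_omega_shift ij im.
  by case: im => n -> [im _]; apply: le_lt_trans ki im.
have [t it] := plus_omega_between ij (ltW ik) kj.
have [m im mj] := ij.1 t.+1; exists m.
  by case: (im) => n /(plus_nat_uniq it) <- [].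
split=> //; left; split; first exact: inessential_shift Hi im.
exact: plus_omega_shift ij im.
Qed.

(** Split off the largest index [j] of the monomial. The rest has degree less than [deg Q_j] by
    induction, and the exponent of [Q_j] is less than [alpha_(j+)]; the total is below
    [alpha_(j+) deg Q_j = deg Q_(j+)], which is at most [deg Q_l]. *)
Lemma deg_specP l : nonmax l -> deg_spec l.
Proof.
elim/(well_founded_ind L_wo): l => l IH nl.
have IH' i : (i < l)%O -> deg_spec i by move=> il; apply: IH il (nonmax_lt il).
have [Ql0 Ql] : (0 < deg (Q l))%N /\ forall i, (i < l)%O -> (deg (Q i) <= deg (Q l))%N.
  have [->|[[k kl]|[ln ls]]] := index_cases l.
  - by split=> [|i]; rewrite ?ltx0 // key_bot /deg size_polyX.
  - have Hk := IH' _ (succ_lt kl); have dl := deg_succ nl kl Hk; case: Hk => Qk0 Qk _.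
    rewrite dl muln_gt0 key_alpha_gt0 Qk0; split=> // i.
    move=> /(lt_succ_le kl); rewrite le_eqVlt => /orP[/eqP ->|/Qk H].
      by rewrite leq_pmull // key_alpha_gt0.
    by apply: leq_trans H _; rewrite leq_pmull // key_alpha_gt0.
  have [[k kl] _] := limit_nxt ln ls.
  split=> [|i il].
    by rewrite (key_deg nl kl) muln_gt0 key_alpha_gt0; case: (IH' _ (nxt_lt kl)).
  have [m im ml] := limit_between ls kl il; have [_ /(_ i im) H _] := IH' _ (nxt_lt ml).
  by rewrite (key_deg nl ml) (leq_trans H) // leq_pmull // key_alpha_gt0.
split=> // g gl gl0.
have [E|/existsNP[i /eqP gi]] := pselect (forall i, g i = 0%N).
  have -> : g = [fsfun] by apply/fsfunP => i; rewrite E fsfun0E.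
  by rewrite mon0 /deg size_poly1.
have [j [gj0 gj]] := fsfun_max (ex_intro _ i gi).
have jl : (j < l)%O.
  case: (gl) => /(_ j gj0) + _ _; rewrite le_eqVlt => /orP[/eqP jl|//].
  by rewrite jl gl0 in gj0.
have [k jk] := nxt_exists L_wo alpha jl.
have gjk : (g j < alpha k)%N by case: (gl) => _ /(_ _ _ jl jk).
(* If [j+] is not the same below [l] and in [L], then [alpha k = 1], which forces the exponent of
   [Q_j] to be 0. *)
have kT : nxt alpha setT j k.
  have [//|ak] := nxt_upto_setT jk.
  by move: gjk gj0; rewrite ak ltnS leqn0 => /eqP ->.
have [_ kl _] := jk.
have dk : deg (Q k) = (alpha k * deg (Q j))%N.
  by apply: key_deg kT; move: kl => /=; rewrite /upto /= le_eqVlt => /orP[/eqP->//|/nonmax_lt].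
have dkl : (deg (Q k) <= deg (Q l))%N.
  by move: kl; rewrite /upto /= le_eqVlt => /orP[/eqP->//|/Ql].
apply: leq_trans dkl; rewrite dk -[g](fsfun_without_with g j 0) mon_with ?fsfun_with //.
rewrite degM ?degX ?monic_exp ?mon_monic ?key_monic //; last exact: key_monic.
have [_ _ /(_ _ (std_exps_without jl gl gj0 gj))] := IH' _ jl.
rewrite fsfun_with => /(_ erefl) H.
have : ((g j).+1 * deg (Q j) <= alpha k * deg (Q j))%N by rewrite leq_mul2r gjk orbT.
by apply: leq_trans; rewrite mulSn ltn_add2r.
Qed.

(* [b_i]; the default value is never used, see [pvQ]. *)
Definition bv i : V := odflt 0 (pv (Q i)).

Lemma pvQ i : pv (Q i) = Fin (bv i).
Proof. by have [b E] := pv_fin nu (monic_neq0 (key_monic i)); rewrite /bv E. Qed.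

Lemma std_q_expansion l f N e : deg_spec l -> std_expansion nu alpha Q l f N e ->
  q_expansion (Q l) f (\poly_(j < N.+1) expn_eval Q (e j)).
Proof.
move=> Hl [-> H]; split=> [|j]; first by rewrite horner_poly.
rewrite coef_poly; case: ifP => [jN|_]; last by rewrite size_poly0 key_size.

exact: size_free (H j _).
Qed.

(** * Initial forms and the growth of the values *)

Lemma pinM f h : pin nu (f * h) = pin nu f * pin nu h.
Proof. by rewrite /pin rmorphM in_formM. Qed.

Lemma pinX f n : pin nu (f ^+ n) = pin nu f ^+ n.
Proof. by rewrite /pin rmorphXn in_formX. Qed.

Lemma pin_term (t : K * exps) :
  gr_embed (in_form (nuK nu) t.1) * pin nu (mon Q t.2) = pin nu (term_eval Q t).
Proof. by rewrite gr_embed_in_form -in_formM /term_eval -mul_polyC /pin rmorphM. Qed.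

Lemma gr_class_pin v f : pv f = Fin v -> pin nu f = gr_class nu v (tofrac f).
Proof. exact: in_formE. Qed.

Lemma gr_class_psum v I (r : seq I) (P : pred I) (F : I -> {poly K}) :
  (forall a, P a -> vge v (F a)) ->
  \sum_(a <- r | P a) gr_class nu v (tofrac (F a)) =
  gr_class nu v (tofrac (\sum_(a <- r | P a) F a)).
Proof. by move=> H; rewrite rmorph_sum gr_class_sum. Qed.

Lemma horner_initial_relation l a (e : nat -> seq (K * exps)) :
  (initial_relation nu Q l a e).[pin nu (Q l)] =
  pin nu (Q l ^+ a) + \sum_(j < a) \sum_(t <- e j) pin nu (term_eval Q t * Q l ^+ j).
Proof.
rewrite /initial_relation hornerD hornerXn horner_sum pinX; congr (_ + _).
apply: eq_bigr => j _; rewrite hornerZ hornerXn mulr_suml; apply: eq_bigr => t _.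
by rewrite pin_term pinM pinX.
Qed.

Lemma size_initial_relation l a (e : nat -> seq (K * exps)) :
  size (initial_relation nu Q l a e) = a.+1.
Proof.
rewrite /initial_relation size_polyDl ?size_polyXn // ltnS.
rewrite -(poly_def a (fun j : nat => \sum_(t <- e j) _)); exact: size_poly.
Qed.

Lemma succ_key l i : succ l i -> exists e : nat -> seq (K * exps),
  [/\ Q i = Q l ^+ alpha i + \sum_(j < alpha i) expn_eval Q (e j) * Q l ^+ j,
      forall j : nat, (j < alpha i)%N -> free_std_expansion nu alpha Q l (e j),
      forall j : nat, (j < alpha i)%N -> vge (bv l *+ alpha i) (expn_eval Q (e j) * Q l ^+ j)
    & minimal_relation (graded_fractions (initial_algebra (nu := nu) Q l)) (pin nu (Q l))
        (initial_relation nu Q l (alpha i) e)].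
Proof.
move=> li; case: Q_key => _ _ /(_ i l I li)[e [H1 H2 H3 H4]] _ _.
exists e; split=> // j ja; rewrite /expn_eval mulr_suml big_seq.
by apply: vge_sum => t te; rewrite /vge H3 // (pvX _ (pvQ l)).
Qed.

(** All monomials in the expansion of [Q i] have value [bv l *+ alpha i], and by condition (b) their
    initial forms add up to 0: the class of [Q i] in this degree vanishes. *)
Lemma succ_value l i : succ l i -> bv l *+ alpha i < bv i.
Proof.
move=> li; case: Q_key => _ _ /(_ i l I li)[e [HQ H2 H3 [_ _ + _]]] _ _.
set v := bv l *+ alpha i.
have H4 (j : nat) t : (j < alpha i)%N -> t \in e j -> pv (term_eval Q t * Q l ^+ j) = Fin v.
  by move=> ja te; rewrite H3 // (pvX _ (pvQ l)).
rewrite horner_initial_relation (gr_class_pin (pvX _ (pvQ l))) -/v.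
have -> : \sum_(j < alpha i) \sum_(t <- e j) pin nu (term_eval Q t * Q l ^+ j) =
    gr_class nu v (tofrac (\sum_(j < alpha i) expn_eval Q (e j) * Q l ^+ j)).
  rewrite -gr_class_psum => [|[j ja] _].
    apply: eq_bigr => -[j ja] _ /=.
    rewrite /expn_eval mulr_suml big_seq [in RHS]big_seq -gr_class_psum => [|t te].
      by apply: eq_bigr => t te; rewrite (gr_class_pin (H4 _ _ ja te)).
    exact: vge_pv (H4 _ _ ja te).
  rewrite /expn_eval mulr_suml big_seq; apply: vge_sum => t te.
  exact: vge_pv (H4 _ _ ja te).
have v1 : vge v (Q l ^+ alpha i) by rewrite (vgeP _ (pvX _ (pvQ l))).
have v2 : vge v (\sum_(j < alpha i) expn_eval Q (e j) * Q l ^+ j).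
  apply: vge_sum => -[j ja] _; rewrite /expn_eval mulr_suml big_seq.
  by apply: vge_sum => t te; apply: vge_pv (H4 _ _ ja te).
rewrite -gr_classD // -rmorphD -HQ => /gr_class_eq0.
rewrite -/(pv (Q i)) pvQ vinf_ltE; apply.
by have := vgeD v1 v2; rewrite -HQ vgeE pvQ.
Qed.

(** The hypothesis under which (c) provides monic expansions. The index [l + omega] may be the
    maximum of [L], and only boundedness is then available. *)
Definition bounded_or_nonmax i := bounded_below_index nu Q i \/ nonmax i.

Lemma limit_key i i0 : i <> \bot%O -> (forall k, ~ succ k i) -> bounded_or_nonmax i ->
  nxt alpha setT i0 i -> exists e : nat -> seq (K * exps),
  [/\ std_expansion nu alpha Q i0 (Q i) (alpha i) e, expn_eval Q (e (alpha i)) = 1,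
      forall j : nat, (j <= alpha i)%N -> vge (bv i0 *+ alpha i) (expn_eval Q (e j) * Q i0 ^+ j),
      pv (expn_eval Q (e 0%N)) = Fin (bv i0 *+ alpha i) & bv i0 *+ alpha i < bv i].
Proof.
move=> /eqP ib is_ Hb i0i; case: Q_key => _ _ _ /(_ i I ib is_)[_ H1 H2 _ H3] _.
have [e He] := H1 _ i0i; have [E1 E2 E3] := H3 Hb _ _ i0i He.
have E2' : min_value nu Q i0 (alpha i) e = Fin (bv i0 *+ alpha i).
  by rewrite E2 (pvX _ (pvQ i0)).
exists e; split=> //.
- move=> j ja; rewrite -ltnS in ja.
  have /le_bigmin_ordP := lexx (min_value nu Q i0 (alpha i) e).
  by rewrite {1}E2' => /(_ (Ordinal ja)).
- by rewrite -E3.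
by have [_ /(_ _ _ He)] := H2 _ i0i; rewrite E2' pvQ vinf_ltE.
Qed.

(** The degree formula of pre-key polynomials leaves out a maximal index; here the degree is read
    off the monic expansion instead. *)
Lemma limit_deg i i0 : i <> \bot%O -> (forall k, ~ succ k i) -> bounded_or_nonmax i ->
  nxt alpha setT i0 i -> deg (Q i) = (alpha i * deg (Q i0))%N.
Proof.
move=> ib is_ Hb i0i; have [e [He e1 _ _ _]] := limit_key ib is_ Hb i0i.
have Hi0 := deg_specP (nonmax_lt (nxt_lt i0i)).
have Hq := std_q_expansion Hi0 He; set p := \poly_(j < _) _ in Hq.
have pa : p`_(alpha i) = 1 by rewrite coef_poly ltnSn e1.
have sp : size p = (alpha i).+1.
  apply/eqP; rewrite eqn_leq size_poly /= ltnNge; apply/negP => /leq_sizeP/(_ _ (leqnn _)).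
  by rewrite pa => /eqP; rewrite oner_eq0.
have := size_q_expansion (key_monic i0) Hq; rewrite -size_poly_gt0 sp => /(_ isT).
by rewrite lead_coefE sp pa size_poly1 /deg => ->; rewrite addn1.
Qed.

(** Positivity is part of the induction, because [b <= b *+ alpha] depends on the sign of [b]. *)
Lemma value_spec i : bounded_or_nonmax i -> 0 < bv i /\ forall k, (k < i)%O -> bv k < bv i.
Proof.
elim/(well_founded_ind L_wo): i => i IH Hi.
have IH' k : (k < i)%O -> 0 < bv k /\ forall m, (m < k)%O -> bv m < bv k.
  by move=> ki; apply: IH ki (or_intror (nonmax_lt ki)).
have [ib|[[k ki]|[ib is_]]] := index_cases i.
- by rewrite ib; split=> [|k]; [move: x_pos; rewrite -key_bot pvQ vinf_ltE | rewrite ltx0].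
- have [k0 Hk] := IH' _ (succ_lt ki).
  have kiv : bv k < bv i.
    by apply: le_lt_trans (succ_value ki); apply: oz_mulrn_ge (ltW k0) (key_alpha_gt0 i).
  split=> [|m /(lt_succ_le ki)]; first exact: lt_trans kiv.
  by rewrite le_eqVlt => /orP[/eqP->//|/Hk/lt_trans]; apply.
have [[k ki] _] := limit_nxt ib is_.
have lim m : nxt alpha setT m i -> bv m < bv i.
  move=> mi; have [m0 _] := IH' _ (nxt_lt mi).
  have [e [_ _ _ _]] := limit_key ib is_ Hi mi; apply: le_lt_trans.
  exact: oz_mulrn_ge (ltW m0) (key_alpha_gt0 i).
split=> [|m mi]; first by apply: lt_trans (lim _ ki); case: (IH' _ (nxt_lt ki)).
have [n mn ni] := limit_between is_ ki mi.
by apply: lt_trans (lim _ ni); have [_ /(_ _ mn)] := IH' _ (nxt_lt ni).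
Qed.

Definition free_spec l := forall f, (size f < size (Q l))%N ->
  exists s, free_std_expansion nu alpha Q l s /\ f = expn_eval Q s.

(** The value of the sum is the least value of its monomials, so that its initial form is the sum of
    the initial forms of those attaining it; each is a product of generators. *)
Lemma initial_algebra_free l s :
  (forall c g, (c, g) \in s -> std_exps alpha l g /\ g l = 0%N) ->
  pv (expn_eval Q s) = \big[Num.min / \top%O]_(t <- s) pv (term_eval Q t) ->
  initial_algebra (nu := nu) Q l (pin nu (expn_eval Q s)).
Proof.
move=> Hs Hmin B HB B1 BB BM.
have B0 : B 0 by rewrite -(subrr 1); apply: BB.
have BD x y : B x -> B y -> B (x + y).
  by move=> Bx By; rewrite -[y]opprK -[- y]sub0r; apply: (BB) => //; apply: BB.
case E : (pv (expn_eval Q s)) => [v|]; last first.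
  have -> : expn_eval Q s = 0.
    by move/val_top/eqP: E; rewrite tofrac_eq0 => /eqP.
  by rewrite /pin rmorph0 in_form0.
have Ht : forall t, t \in s -> vge v (term_eval Q t).
  by apply/le_bigmin_seq; rewrite -Hmin E.
rewrite (gr_class_pin E) /expn_eval big_seq -gr_class_psum //.
apply: (big_ind B) => // -[c g] ts; have Hv := Ht _ ts.
have [tv|tv] := eqVneq (pv (term_eval Q (c, g))) (Fin v); last first.
  suff -> : gr_class nu v (tofrac (term_eval Q (c, g))) = 0 by [].
  by apply/gr_class_eq0 => //; rewrite lt_neqAle eq_sym tv.
rewrite -(gr_class_pin tv) -pin_term; apply: (BM).
  by apply: (HB); left; exists (in_form (nuK nu) c).
have [[gl _ _] gl0] := Hs _ _ ts.
rewrite /mon /pin rmorph_prod.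
have: {subset (enum_fset (finsupp g)) <= finsupp g} by [].
elim: (enum_fset (finsupp g)) => [|q r' IH] Hr.
  by rewrite big_nil in_form1.
rewrite big_cons in_formM; apply: (BM); last first.
  by apply: IH => // i ir; apply: Hr; rewrite inE ir orbT.
have qg : g q != 0%N by rewrite -mem_finsupp; apply: Hr; rewrite inE eqxx.
rewrite rmorphXn in_formX.
have : B (in_form nu (tofrac (Q q))).
  apply: (HB); right; exists q => //=; rewrite lt_neqAle gl // andbT.
  by apply: contraNneq qg => ->; rewrite gl0.
by move=> Bq; elim: (g q) => [|n IHn]; rewrite ?expr0 // exprS; apply: (BM).
Qed.

Lemma graded_fractions_sub (A : set (gr nu)) : A 1 -> A `<=` graded_fractions A.
Proof.
move=> A1 a Aa; exists a, 1; split=> //; last by rewrite mulr1.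
  by rewrite -(in_form1 nu); apply: in_form_homogeneous.
by rewrite -(in_form1 nu); apply: in_form_neq0 (Defs.val1 nu).
Qed.

(** If some term has value below [v], the terms of least value [w] cancel in degree [w]. The initial
    forms of their coefficients lie in the initial algebra by [free_spec] and make up a nonzero [p]
    of degree less than [alpha i] that vanishes at the initial form of [Q l]. *)
Lemma trunc_exact_succ l i : nonmax i -> succ l i -> free_spec l ->
  forall f, (size f < size (Q i))%N -> forall v, vge v f -> trunc_ge (Q l) v f.
Proof.
move=> ni li Hl f fi v fv.
have nl := nonmax_lt (succ_lt li); have Dl := deg_specP nl.
have sl : (1 < size (Q l))%N by rewrite key_size ltnS; case: Dl.
have [e He] := q_expansion_exists f sl; exists e => //.
have e0 (j : nat) : (alpha i <= j)%N -> e`_j = 0.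
  apply: q_expansion_coef0 (key_monic l) He _.
  by move: fi; rewrite key_size ltnS (deg_succ ni li Dl).
have [e' [_ _ _ [_ _ _ minP]]] := succ_key li.
have Hlt (j : nat) : (alpha i <= j)%N -> vge v (e`_j * Q l ^+ j).
  by move=> /e0 ->; rewrite mul0r vge0.
apply: contrapT => /existsNP[j0 Hj0].
pose F (j : 'I_(alpha i)) := pv (e`_j * Q l ^+ j).
have [w Ew wv] : exists2 w, \big[Num.min / \top%O]_j F j = Fin w & w < v.
  have [aj0|j0a] := leqP (alpha i) j0; first by case: Hj0; apply: Hlt.
  have : ~~ (Fin v <= \big[Num.min / \top%O]_j F j).
    by apply/negP => /le_bigmin_ordP/(_ (Ordinal j0a)).
  rewrite -ltNge; case: (\big[_/_]_j F j) => [w|] //.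
  by rewrite vinf_ltE; exists w.
have wF (j : 'I_(alpha i)) : vge w (e`_j * Q l ^+ j).
  by move: j; apply/(le_bigmin_ordP F); rewrite Ew.
have [j1 Fj1] := bigmin_attained Ew.
pose p := \poly_(j < alpha i) (if pv (e`_j * Q l ^+ j) == Fin w then pin nu e`_j else 0).
have AQ (j : nat) : initial_algebra (nu := nu) Q l (pin nu e`_j).
  have [s [[_ H1 H2] ->]] := Hl _ (He.2 j).
  by apply: initial_algebra_free => // c g /H1[_ gl gl0]; split.
have A1 : initial_algebra (nu := nu) Q l 1 by move=> B.
have A0 : initial_algebra (nu := nu) Q l 0.
  by move=> B _ B1 BB _; rewrite -(subrr 1); apply: BB.
have pB (j : nat) : graded_fractions (initial_algebra (nu := nu) Q l) p`_j.
  apply: graded_fractions_sub => //; rewrite coef_poly.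
  by case: ifP => _ //; case: ifP => _.
have p0 : p != 0.
  apply/eqP => /(congr1 (fun p : {poly _} => p`_j1)).
  rewrite coef_poly ltn_ord coef0 -/(F j1) Fj1 eqxx => H.
  have : e`_j1 != 0.
    by apply/eqP => E; move: Fj1; rewrite /F E mul0r pv0.
  move=> /(pv_fin nu)[u Eu]; exact: in_form_neq0 Eu H.
have proot : p.[pin nu (Q l)] = 0.
  rewrite horner_poly.
  have -> : \sum_(j < alpha i) (if pv (e`_j * Q l ^+ j) == Fin w then pin nu e`_j else 0) *
      pin nu (Q l) ^+ j = \sum_(j < alpha i) gr_class nu w (tofrac (e`_j * Q l ^+ j)).
    apply: eq_bigr => j _; rewrite -pinX; case: eqP => [E|/eqP E].
      by rewrite -pinM (gr_class_pin E).
    rewrite mul0r; apply/esym; apply/gr_class_eq0; first exact: wF.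
    by rewrite lt_neqAle eq_sym E; apply: wF.
  rewrite gr_class_psum //.
  have -> : \sum_(j < alpha i) e`_j * Q l ^+ j = f.
    rewrite [RHS]He.1 (horner_coef_wide _ (_ : size e <= alpha i)%N) //.
    by apply/leq_sizeP.
  apply/gr_class_eq0; first exact: vge_le (ltW wv) fv.
  by apply: lt_le_trans fv; rewrite vinf_ltE.
have := minP _ p0 pB proot; rewrite size_initial_relation leqNgt ltnS => /negP; apply.
exact: size_poly.
Qed.

(** Otherwise [f] would have the limit property in a degree less than that of [Q i]. The standard
    expansions required by this property come from [free_spec] below [i]. *)
Lemma trunc_exact_limit i : i <> \bot%O -> (forall k, ~ succ k i) ->
  (forall k, (k < i)%O -> free_spec k) -> forall f, (size f < size (Q i))%N ->
  exists i0, nxt alpha setT i0 i /\ forall v, vge v f -> trunc_ge (Q i0) v f.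
Proof.
move=> ib is_ IH f fi; apply: contrapT => /forallNP H.
case: Q_key => _ _ _ /(_ i I (introN eqP ib) is_)[[i0 i0i] _ _ Hmin _] _.
have f0 : f != 0.
  apply/eqP => E; apply: (H i0); split=> // v _; rewrite E; apply: trunc_ge0.
  - exact: key_monic.
  - by rewrite key_size ltnS; case: (deg_specP (nonmax_lt (nxt_lt i0i))).
suff /Hmin : limit_property nu alpha Q setT i f.
  rewrite leqNgt; move: fi; rewrite key_size /deg -size_poly_gt0 in f0 *; move: f0; lia.
move=> k ki; have kl := nxt_lt ki; have Dk := deg_specP (nonmax_lt kl).
have sk : (1 < size (Q k))%N by rewrite key_size ltnS; case: Dk.
split.
  have [e He] := q_expansion_exists f sk.
  have /choice[s Hs] (j : nat) :
      exists s, free_std_expansion nu alpha Q k s /\ e`_j = expn_eval Q s.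
    by apply: IH => //; apply: He.2.
  exists (size e), s; split=> [|j _]; last by case: (Hs j).
  rewrite {1}He.1 (horner_coef_wide _ (leqnSn _)); apply: eq_bigr => j _.
  by rewrite (Hs j).2.
move=> N e He; rewrite ltNge; apply/negP => /le_bigmin_ordP fe.
apply: (H k); split=> // v fv; exists (\poly_(j < N.+1) expn_eval Q (e j)).
  exact: std_q_expansion.
move=> j; rewrite coef_poly; case: ifP => jN; last by rewrite mul0r vge0.
exact: le_trans fv (fe (Ordinal jN)).
Qed.

(* If [j+] computed below [l] is beyond [i], then [j] is inessential below [l] but not
   below [i], where [j+ = j + 1] and [alpha (j + 1) = 1]. *)
Lemma std_exps_beyond_nxt l i j k g : (i < l)%O -> (j < i)%O -> std_exps alpha i g ->
  nxt alpha (upto l) j k -> (i < k)%O -> g j = 0%N.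
Proof.
move=> il ji [_ ga _] jk ik.
have [[_ ik' _]|[_ Hj jok ink]] := nxt_upto_down ji (ltW il) jk.
  by move: ik'; rewrite /upto /= leNgt ik.
have [m jm] := nxt_exists L_wo alpha ji.
have := ga _ _ ji jm; suff -> : alpha m = 1%N by rewrite ltnS leqn0 => /eqP.
have [_ mi [[_ jom]|[_ sjm]]] := jm.
  by move: mi; rewrite (plus_omega_uniq jom jok) /upto /= leNgt ik.
exact: inessential_succ_alpha1 Hj sjm.
Qed.

(** Between [i] and [l] the next index changes only for those [j] whose [j+] moves beyond [i]; these
    do not occur in [g], so that no new constraint is violated. *)
Lemma std_exps_with l i g n : nxt alpha (upto l) i l -> std_exps alpha i g ->
  g i = 0%N -> (n < alpha l)%N -> std_exps alpha l [fsfun g with i |-> n].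
Proof.
move=> il gi gi0 nl; have ltil := nxt_lt il; have [gs ga g1] := gi.
split=> [j|j k jl jk|j k Hj jk j1 j2 j1k j2k].
- rewrite fsfun_withE; have [-> _|ji] := eqVneq j i; first exact: ltW.
  by move=> /gs ji'; apply: le_trans ji' (ltW ltil).
- rewrite fsfun_withE; have [ji|ji] := eqVneq j i.
    by move: jk; rewrite ji => /(nxt_uniq il) <-.
  have [->|gj] := eqVneq (g j) 0%N; first exact: key_alpha_gt0.
  have {}ji : (j < i)%O by rewrite lt_neqAle ji gs.
  have [jk'|[ik _ _ _]] := nxt_upto_down ji (ltW ltil) jk; first exact: ga jk'.
  by rewrite (std_exps_beyond_nxt ltil ji gi jk ik) in gj.
have [_ _ [[_ jok]|[/(_ Hj)//]]] := jk.
have down m : m != i -> g m != 0%N -> nxt alpha (upto l) m k ->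
    nxt alpha (upto i) m k /\ (m < i)%O.
  move=> mi gm mk; have {}mi : (m < i)%O by rewrite lt_neqAle mi gs.
  have [//|[ik _ _ _]] := nxt_upto_down mi (ltW ltil) mk.
  by rewrite (std_exps_beyond_nxt ltil mi gi mk ik) in gm.
have notl m : m != i -> g m != 0%N -> nxt alpha (upto l) m k -> nxt alpha (upto l) i k -> False.
  move=> mi gm mk /(nxt_uniq il) kl; have [[_ + _] _] := down m mi gm mk.
  by rewrite /upto /= -kl leNgt ltil.
rewrite !fsfun_withE; have [E1|j1i] := eqVneq j1 i; have [E2|j2i] := eqVneq j2 i.
- by rewrite E1 E2.
- by move=> _ g2; case: (notl j2) => //; rewrite -E1.
- by move=> g1' _; case: (notl j1) => //; rewrite -E2.
move=> g1' g2; have [h1 _] := down _ j1i g1' j1k; have [h2 _] := down _ j2i g2 j2k.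
have [H1 _] := nxt_inessential h1 jok.
exact: (g1 _ _ H1 h1 j1 j2 h1 h2 g1' g2).
Qed.

(** Free expansions of the coefficients of the [Q i]-expansion are multiplied by the powers of
    [Q i]. The minimum of the values of the resulting monomials is [nu(f)] because the truncation at
    [Q i] is exact on [f]. *)
Lemma free_spec_step l i : nxt alpha (upto l) i l ->
  deg (Q l) = (alpha l * deg (Q i))%N -> deg_spec i -> free_spec i ->
  forall f, (size f < size (Q l))%N -> (forall v, vge v f -> trunc_ge (Q i) v f) ->
  exists s, free_std_expansion nu alpha Q l s /\ f = expn_eval Q s.
Proof.
move=> il dl Di Hi f fl ftr.
have [->|f0] := eqVneq f 0.
  exists [::]; rewrite /expn_eval big_nil; split=> //.
  by split=> //; rewrite /expn_eval !big_nil pv0.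
have [v fv] := pv_fin nu f0.
have [e He ev] := ftr v (vge_pv fv).
have e0 (j : nat) : (alpha l <= j)%N -> e`_j = 0.
  apply: q_expansion_coef0 (key_monic i) He _.
  by move: fl; rewrite key_size ltnS dl.
(* The bound [g i < m] keeps the exponents distinct when the monomials with factor [Q i ^+ m] are
   appended. *)
have build (m : nat) : (m <= alpha l)%N -> exists s : seq (K * exps),
  [/\ uniq [seq t.2 | t <- s],
      forall c g, (c, g) \in s -> [/\ c != 0, std_exps alpha l g, g l = 0%N & (g i < m)%N],
      forall t, t \in s -> vge v (term_eval Q t)
    & expn_eval Q s = \sum_(j < m) e`_j * Q i ^+ j].
  elim: m => [|m IH] ml.
    by exists [::]; split=> //; rewrite /expn_eval big_nil big_ord0.
  have [s [s1 s2 s3 s4]] := IH (ltnW ml).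
  have [r [[r1 r2 r3] er]] := Hi _ (He.2 m).
  pose up (t : K * exps) : K * exps := (t.1, [fsfun t.2 with i |-> m]).
  have upE (t : K * exps) : t \in r -> term_eval Q (up t) = term_eval Q t * Q i ^+ m.
    case: t => c g /r2[_ _ gi0]; rewrite /term_eval /up /= mon_with //.
    by rewrite scalerAl.
  exists (s ++ map up r); split.
  - rewrite map_cat cat_uniq s1 /= -map_comp; apply/andP; split.
      apply/hasPn => _ /mapP[[c g] gr ->] /=; apply/negP => /mapP[[c' g'] gs' /= Eg].
      by have [_ _ _] := s2 _ _ gs'; rewrite -Eg fsfun_with ltnn.
    have -> : map (snd \o up) r = map (fun g : exps => [fsfun g with i |-> m]) (map snd r).
      by rewrite -map_comp.
    rewrite map_inj_in_uniq // => _ _ /mapP[[c1 g1] g1r ->] /mapP[[c2 g2] g2r ->] /= E.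
    have [_ _ z1] := r2 _ _ g1r; have [_ _ z2] := r2 _ _ g2r.
    have := fsfun_without_with g1 i m; have := fsfun_without_with g2 i m.
    by rewrite E z1 z2 => -> ->.
  - move=> c g; rewrite mem_cat => /orP[/s2[? ? ? H]|/mapP[[c' g'] /r2[c0 gst gi0] [-> ->]]].
      by split=> //; apply: ltnW.
    split=> //; first exact: std_exps_with.
      rewrite fsfun_withE gt_eqF ?(nxt_lt il) //.
      apply/eqP; apply: contraT => /(let: And3 H _ _ := gst in H l).
      by rewrite leNgt (nxt_lt il).
    by rewrite fsfun_with.
  - move=> t; rewrite mem_cat => /orP[/s3//|/mapP[t' t'r ->]]; rewrite (upE _ t'r).
    have H : pv (expn_eval Q r) <= pv (term_eval Q t').
      by rewrite r3; move: t' t'r {upE}; apply/le_bigmin_seq.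
    rewrite (vgeMr _ _ (pvX _ (pvQ i))); apply: le_trans H.
    by have := ev m; rewrite (vgeMr _ _ (pvX _ (pvQ i))) er.
  rewrite /expn_eval big_cat /= big_map big_ord_recr /= -s4 er; congr (_ + _).
  rewrite /expn_eval mulr_suml big_seq [RHS]big_seq; apply: eq_bigr => t; exact: upE.
have [s [s1 s2 s3 s4]] := build _ (leqnn _).
have fs : f = expn_eval Q s.
  rewrite s4 [LHS]He.1 (horner_coef_wide _ (_ : size e <= alpha l)%N) //.
  by apply/leq_sizeP.
exists s; split=> //; split=> // [c g /s2[]//|].
apply: le_anti; apply/andP; split.
  by apply/le_bigmin_seq => t /s3; rewrite -fs fv.
have -> : expn_eval Q s = \sum_(t <- s | t \in s) term_eval Q t by rewrite -big_seq.
by apply: pv_sum_ge => t ts; move: t ts; apply/le_bigmin_seq.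
Qed.

Lemma size_key_gt1 i : nonmax i -> (1 < size (Q i))%N.
Proof. by move=> /deg_specP[H _ _]; rewrite key_size. Qed.

Lemma nxt_upto_succ i l : succ i l -> nxt alpha (upto l) i l.
Proof.
move=> il; split; rewrite /upto /= ?lexx // ?(ltW (succ_lt il)) //.
right; split=> // -[[j ij jl] _]; have [m [k -> ikm] mj] := ij.1 1%N.
move: mj; rewrite (succ_uniq ikm il).
by rewrite ltNge jl.
Qed.

Lemma nxt_upto_limit i l : (forall k, ~ succ k l) -> nxt alpha setT i l ->
  nxt alpha (upto l) i l.
Proof.
move=> ls [_ _ [[Hi il]|[_ /ls//]]]; split; rewrite /upto /= ?lexx //.
  exact: ltW (plus_omega_lt il).
by left; split=> //; case: Hi => _ H; split=> //; exists l; rewrite /upto /=.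
Qed.

Lemma free_specP l : nonmax l -> free_spec l.
Proof.
elim/(well_founded_ind L_wo): l => l IH nl.
have IH' i : (i < l)%O -> free_spec i by move=> il; apply: IH il (nonmax_lt il).
have [lb|[[i il]|[lb ls]]] := index_cases l => f fl.
- have fc : (size f <= 1)%N by move: fl; rewrite lb key_bot size_polyX ltnS.
  have [->|f0] := eqVneq f 0.
    exists [::]; rewrite /expn_eval big_nil; split=> //.
    by split=> //; rewrite /expn_eval !big_nil pv0.
  exists [:: (f`_0, [fsfun])].
  have fE : expn_eval Q [:: (f`_0, [fsfun])] = f.
    by rewrite /expn_eval big_seq1 /term_eval /= mon0 alg_polyC -size1_polyC.
  split=> //; split=> // [c g|].
    rewrite inE => /eqP[-> ->]; split; rewrite ?fsfun0E //.
      by apply: contra_neq f0 => f00; rewrite (size1_polyC fc) f00.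
    by split=> [i|i k|i k _ _ j1 j2 _ _]; rewrite fsfun0E // => _ _; apply: key_alpha_gt0.
  rewrite big_cons big_nil fE (min_idPl (lex1 _)).
  by move: fE; rewrite /expn_eval big_seq1 => ->.
- have nl' := nonmax_lt (succ_lt il); have Di := deg_specP nl'.
  apply: (free_spec_step (nxt_upto_succ il)) => //; first exact: deg_succ.
    exact: IH' (succ_lt il).
  exact: (trunc_exact_succ nl il (IH' _ (succ_lt il)) fl).
have [i [il Hi]] := trunc_exact_limit lb ls IH' fl.
have il' := nxt_upto_limit ls il.
apply: (free_spec_step il') => //; first exact: key_deg.
  exact: deg_specP (nonmax_lt (nxt_lt il)).
exact: IH' (nxt_lt il).
Qed.

(** * Multiplicativity of the truncations *)

Lemma trunc_ge_succ_key i l : succ i l -> nonmax l -> trunc_mul nu (Q i) ->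
  trunc_ge (Q i) (bv i *+ alpha l) (Q l).
Proof.
move=> il nl Hm; have ni := nonmax_lt (succ_lt il).
have qm := key_monic i; have q1 := size_key_gt1 ni.
have [e [-> efree ev _]] := succ_key il; apply: trunc_geD.
  by apply: (trunc_geX qm q1 (pvQ i) Hm); apply: trunc_ge_q (pvQ i).
apply: trunc_ge_sum => // -[j jl] _ /=.
rewrite -[bv i *+ alpha l](subrK (bv i *+ j)); apply: (trunc_geMqX q1 (pvQ i)).
apply/trunc_ge_small => //; first exact: size_free (deg_specP ni) (efree _ jl).
by have := ev _ jl; rewrite (vgeMr _ _ (pvX _ (pvQ i))).
Qed.

Lemma trunc_ge_limit_key i l : l <> \bot%O -> (forall k, ~ succ k l) -> bounded_or_nonmax l ->
  nxt alpha setT i l -> trunc_ge (Q i) (bv i *+ alpha l) (Q l).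
Proof.
move=> lb ls Hl il; have [e [He _ ev _ _]] := limit_key lb ls Hl il.
exists (\poly_(j < (alpha l).+1) expn_eval Q (e j)).
  exact: std_q_expansion (deg_specP (nonmax_lt (nxt_lt il))) He.
by move=> j; rewrite coef_poly; case: ifP => [/ev//|_]; rewrite mul0r vge0.
Qed.

(** Key polynomials with the same limit [l] all have degree [deg (Q l) / alpha l], so that
    truncations can be compared along them. *)
Lemma nxt_limit_mono l i j v f : l <> \bot%O -> (forall k, ~ succ k l) ->
  bounded_or_nonmax l -> nxt alpha setT i l -> nxt alpha setT j l -> (i <= j)%O ->
  trunc_mul nu (Q j) -> trunc_ge (Q i) v f -> trunc_ge (Q j) v f.
Proof.
move=> lb ls Hl il jl ij Hj; have nj := nonmax_lt (nxt_lt jl).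
have sij : size (Q i) = size (Q j).
  rewrite !key_size; congr _.+1; apply/eqP; rewrite -(eqn_pmul2l (key_alpha_gt0 l)).
  by rewrite -!limit_deg.
apply: (trunc_ge_mono (key_monic i) (key_monic j) _ sij (pvQ i) (pvQ j)) => //.
  exact: size_key_gt1.
move: ij; rewrite le_eqVlt => /orP[/eqP->//|ij].
by have [_ /(_ _ ij)/ltW] := value_spec (or_intror nj).
Qed.

(** At a limit, the two factors may become exact at different indices; by monotonicity the later one
    serves for both. *)
Lemma trunc_mulP l : nonmax l -> trunc_mul nu (Q l).
Proof.
elim/(well_founded_ind L_wo): l => l IH nl.
have IH' i : (i < l)%O -> trunc_mul nu (Q i) by move=> il; apply: IH il (nonmax_lt il).
have al := key_alpha_gt0 l; have lm := key_monic l.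
have [lb|[[i il]|[lb ls]]] := index_cases l => f g u v fl gl fu gv.
- have c (h : {poly K}) : (size h < size (Q l))%N -> (size h <= 1)%N.
    by rewrite lb key_bot size_polyX ltnS.
  apply/trunc_ge_small => //; last exact: vgeM.
  rewrite lb key_bot size_polyX ltnS (leq_trans (size_polyMleq _ _)) //.
  have := c _ fl; have := c _ gl; lia.
- have il' := succ_lt il; have ni := nonmax_lt il'.
  have tr := trunc_exact_succ nl il (free_specP ni).
  have bl : bv i *+ alpha l <= bv l by apply: ltW; apply: succ_value.
  apply: (trunc_mul_step (key_monic i) (size_key_gt1 ni) (pvQ i) (IH' _ il')
    lm al (pvQ l) bl) => //.
  - exact: deg_succ (deg_specP ni).
  - exact: trunc_ge_succ_key (IH' _ il').
  - exact: tr.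
  - exact: tr.
have Hl : bounded_or_nonmax l by right.
have fr k : (k < l)%O -> free_spec k by move=> kl; apply: free_specP (nonmax_lt kl).
have [i [il trf]] := trunc_exact_limit lb ls fr fl.
have [j [jl trg]] := trunc_exact_limit lb ls fr gl.
have [m [ml tf tg]] : exists m, [/\ nxt alpha setT m l, trunc_ge (Q m) u f & trunc_ge (Q m) v g].
  have [ij|ji] := leP i j.
    exists j; split=> //; last exact: trg.
    exact: (nxt_limit_mono lb ls Hl il jl ij (IH' _ (nxt_lt jl)) (trf _ fu)).
  exists i; split=> //; first exact: trf.
  exact: (nxt_limit_mono lb ls Hl jl il (ltW ji) (IH' _ (nxt_lt il)) (trg _ gv)).
have nm := nonmax_lt (nxt_lt ml).
have [e [_ _ _ _ /ltW bl]] := limit_key lb ls Hl ml.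
apply: (trunc_mul_step (key_monic m) (size_key_gt1 nm) (pvQ m) (IH' _ (nxt_lt ml))
  lm al (pvQ l) bl) => //.
- exact: key_deg.
- exact: trunc_ge_limit_key.
Qed.

Lemma value_group_const c v : c != 0 -> pv c%:P = Fin v -> tGamma0 nu v.
Proof. by move=> _ cv; exists 1%N => //; exists c. Qed.

Lemma tGamma00 : tGamma0 nu 0.
Proof. exact: (value_group_const (oner_neq0 K) (pv1 nu)). Qed.

Lemma value_groupMn (y : K) v n : nuK nu y = Fin v -> nuK nu (y ^+ n) = Fin (v *+ n).
Proof.
move=> yv; elim: n => [|n IH]; first exact: Defs.val1.
by rewrite exprS Defs.valM yv IH mulrS.
Qed.

Lemma tGamma0B x y : tGamma0 nu x -> tGamma0 nu y -> tGamma0 nu (x - y).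
Proof.
move=> [n n0 [a av]] [m m0 [b bv']]; exists (n * m)%N; first by rewrite muln_gt0 n0.
exists (a ^+ m / b ^+ n); rewrite mulrnBl mulrnA [in y *+ _]mulnC [y *+ _]mulrnA.
have bn : b ^+ n != 0.
  apply/eqP => E; have := value_groupMn n bv'; rewrite E Defs.val0 //.
have := Defs.valM (nuK nu) (a ^+ m / b ^+ n) (b ^+ n).
rewrite divfK // (value_groupMn _ av) (value_groupMn _ bv').
case: (nuK nu _) => [w|] //= [->]; by rewrite addrK.
Qed.

Lemma tGamma0_bv i : nonmax i -> tGamma0 nu (bv i).
Proof.
move=> ni; case: Q_key => _ /(_ i I ni)[b Hb Gb] _ _ _.
by have := pvQ i; rewrite Hb => -[<-].
Qed.

(** The value of a free standard expansion is that of one of its monomials, a sum of elements of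
    [tGamma0]. It allows the values of coefficients to be compared through [phi]. *)
Lemma tGamma0_poly l f v : nonmax l -> (size f < size (Q l))%N -> pv f = Fin v -> tGamma0 nu v.
Proof.
move=> nl fl fv; have [s [[_ H1 H2] fE]] := free_specP nl fl.
have G0 := tGamma00; have GB := tGamma0B; have GDx := subgroupD G0 GB.
move: fv; rewrite fE H2 => /bigmin_attained_seq[[c g] ts].
have [c0 [gs _ _] gl0] := H1 _ _ ts.
pose P h := forall w, pv h = Fin w -> tGamma0 nu w.
have PM h1 h2 : P h1 -> P h2 -> P (h1 * h2).
  move=> P1 P2 w; rewrite pvM; case E1 : (pv h1) => [w1|] //; case E2 : (pv h2) => [w2|] //= [<-].
  by apply: GDx; [apply: P1 | apply: P2].
suff : P (term_eval Q (c, g)) by apply.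
rewrite /term_eval -mul_polyC; apply: (PM) => [w|]; first exact: value_group_const.
have P1 : P 1 by move=> w; rewrite pv1 => -[<-].
rewrite /mon big_seq; apply: (big_ind P P1 PM) => i ig.
have gi : g i != 0%N by rewrite -mem_finsupp.
have il : nonmax i.
  by move: (gs _ gi); rewrite le_eqVlt => /orP[/eqP->//|/nonmax_lt].
elim: (g i) => [|n IH]; rewrite ?expr0 // exprS; apply: PM => // w.
by rewrite pvQ => -[<-]; apply: tGamma0_bv.
Qed.

(** * The block below l + omega *)

Section Block.
Variables (R : realType) (phi : V -> R).
Hypothesis phi_emb : ordered_embedding (tGamma0 nu) phi.
Variables l lw : L.
Hypotheses (lw_def : plus_omega l lw)
  (alpha1 : forall t i, (0 < t)%N -> plus_nat l t i -> alpha i = 1%N)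
  (bounded : exists2 b, tGamma0 nu b &
     forall t i, (0 < t)%N -> plus_nat l t i -> pv (Q i) <= Fin b).

Let ls k : ~ succ k lw. Proof. exact: plus_omega_not_succ lw_def. Qed.

Let lb : lw <> \bot%O.
Proof. by move=> E; have := plus_omega_lt lw_def; rewrite E ltx0. Qed.

(** [t = 0] is left out: [alpha l] may differ from 1, and [l] is then not inessential. *)
Lemma block_nxt t i : (0 < t)%N -> plus_nat l t i -> nxt alpha setT i lw.
Proof.
move=> t0 li; have il := plus_omega_shift lw_def li.
split=> //; left; split=> //; split=> [|s k ik]; first by exists lw.
by apply: alpha1 (plus_nat_cat li ik); rewrite addn_gt0 t0.
Qed.

Lemma block_bound k : (k < lw)%O -> exists t i, [/\ (0 < t)%N, plus_nat l t i & (k <= i)%O].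
Proof.
move=> klw; have [kl|lk] := leP k l.
  have [i li _] := lw_def.1 1%N; exists 1%N, i; split=> //.
  by case: (li) => m -> [/ltW lm _]; apply: le_trans kl lm.
have [[|t] lt] := plus_omega_between lw_def (ltW lk) klw; last by exists t.+1, k.
by move: lk; rewrite (lt : k = l) ltxx.
Qed.

Lemma bounded_lw : bounded_or_nonmax lw.
Proof.
left; have [b Gb Hb] := bounded; exists b => // k /block_bound[t [i [t0 li ki]]].
apply: le_trans (Hb _ _ t0 li); move: ki; rewrite le_eqVlt => /orP[/eqP->//|ki].
have ni := nonmax_lt (nxt_lt (block_nxt t0 li)).
by have [_ /(_ _ ki)/ltW] := value_spec (or_intror ni); rewrite !pvQ.
Qed.

Lemma size_block i j : nxt alpha setT i lw -> nxt alpha setT j lw -> size (Q i) = size (Q j).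
Proof.
move=> il jl; rewrite !key_size; congr _.+1; apply/eqP.
rewrite -(eqn_pmul2l (key_alpha_gt0 lw)) -!limit_deg //; exact: bounded_lw.
Qed.

Lemma deg_lt_lw i j : nxt alpha setT i lw -> (j < lw)%O -> (deg (Q j) <= deg (Q i))%N.
Proof.
move=> il jl; have [m jm ml] := limit_between ls il jl.
have [_ /(_ _ jm) H _] := deg_specP (nonmax_lt (nxt_lt ml)).
by apply: leq_trans H _; have := size_block ml il; rewrite !key_size => -[->].
Qed.

Section Sequence.
Variable idx : nat -> L.
Hypothesis idxP : forall t, plus_nat l t.+1 (idx t).

Lemma idx_nxt t : nxt alpha setT (idx t) lw.
Proof. exact: block_nxt (idxP t). Qed.

Lemma idx_nonmax t : nonmax (idx t).
Proof. exact: nonmax_lt (nxt_lt (idx_nxt t)). Qed.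

Arguments idx_nonmax : clear implicits.

Lemma plus_natE t i : (0 < t)%N -> plus_nat l t i -> i = idx t.-1.
Proof. by move=> t0 lt; apply: plus_nat_uniq (idxP _); rewrite prednK. Qed.

Lemma idx_lt s t : (s < t)%N -> (idx s < idx t)%O.
Proof.
move=> st; have := idxP t; rewrite -(subnKC (leqW st)) subSS => /plus_nat_split[j].
move=> /(plus_nat_uniq (idxP s)) <-; case: (t - s)%N (subn_gt0 s t) => [|m]; first by rewrite st.
by move=> _ [k /plus_nat_le ik [kj _]]; apply: le_lt_trans kj.
Qed.

Lemma idx_cofinal k : (k < lw)%O -> exists t, (k <= idx t)%O.
Proof. by move=> /block_bound[t [i [t0 /(plus_natE t0) -> ki]]]; exists t.-1. Qed.

Lemma bv_idx_lt s t : (s < t)%N -> bv (idx s) < bv (idx t).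
Proof. by move=> /idx_lt st; have [_ /(_ _ st)] := value_spec (or_intror (idx_nonmax t)). Qed.

Variable bbar : R.
Hypothesis bbar_def : bbar = sup [set phi v | v in [set v | exists t i,
  [/\ (0 < t)%N, plus_nat l t i & pv (Q i) = Fin v]]].

Let Gb t : tGamma0 nu (bv (idx t)).
Proof. exact: tGamma0_bv (idx_nonmax t). Qed.

Let bset : set R := [set phi (bv (idx t)) | t in setT].

Let bbarE : bbar = sup bset.
Proof.
rewrite bbar_def; congr sup; apply/seteqP; split=> x /=.
  move=> [v [t [i [t0 /(plus_natE t0) -> ]]]]; rewrite pvQ => -[<-] <-.
  by exists t.-1.
move=> [t _ <-]; exists (bv (idx t)) => //; exists t.+1, (idx t); split=> //.
exact: pvQ.
Qed.

Let bset_sup : has_sup bset.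
Proof.
split; first by exists (phi (bv (idx 0))), 0%N.
have [b Gb' Hb] := bounded; exists (phi b) => _ [t _ <-].
rewrite (phi_le phi_emb) //.
by have := Hb _ _ (ltn0Sn t) (idxP t); rewrite pvQ.
Qed.

(** The supremum is not attained because the values increase strictly. *)
Lemma bbar_gt t : phi (bv (idx t)) < bbar.
Proof.
apply: lt_le_trans (_ : phi (bv (idx t.+1)) <= _).
  by rewrite (phi_lt phi_emb) // bv_idx_lt.
by rewrite bbarE; apply: sup_upper_bound bset_sup _ _; exists t.+1.
Qed.

Lemma bbar_lim eps : 0 < eps -> exists t, bbar - eps < phi (bv (idx t)).
Proof.
by move=> e0; have [_ [t _ <-] H] := sup_adherent e0 bset_sup; exists t; rewrite bbarE.
Qed.

Lemma phi_block_lt k : (k < lw)%O -> phi (bv k) < bbar.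
Proof.
move=> klw; have [t kt] := idx_cofinal klw; apply: le_lt_trans (bbar_gt t).
rewrite (phi_le phi_emb) //; last exact: tGamma0_bv (nonmax_lt klw).
move: kt; rewrite le_eqVlt => /orP[/eqP->//|kt].
by have [_ /(_ _ kt)/ltW] := value_spec (or_intror (idx_nonmax t)).
Qed.

Let d := alpha lw.
Variable E : nat -> nat -> seq (K * exps).
Hypothesis EP : forall t,
  [/\ std_expansion nu alpha Q (idx t) (Q lw) d (E t), expn_eval Q (E t d) = 1,
      forall j : nat, (j <= d)%N -> vge (bv (idx t) *+ d) (expn_eval Q (E t j) * Q (idx t) ^+ j),
      pv (expn_eval Q (E t 0%N)) = Fin (bv (idx t) *+ d) & bv (idx t) *+ d < bv lw].

Definition coefs t : {poly {poly K}} := \poly_(j < d.+1) expn_eval Q (E t j).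

Lemma coefsE t (j : nat) : (j <= d)%N -> (coefs t)`_j = expn_eval Q (E t j).
Proof. by move=> jd; rewrite coef_poly ltnS jd. Qed.

Lemma coefs_expansion t : q_expansion (Q (idx t)) (Q lw) (coefs t).
Proof. by have [H _ _ _ _] := EP t; apply: std_q_expansion (deg_specP (idx_nonmax t)) H. Qed.

Lemma vge_coefs t (j : nat) : vge (bv (idx t) *+ d - bv (idx t) *+ j) (coefs t)`_j.
Proof.
have [jd|dj] := leqP j d; last by rewrite coef_poly ltnS leqNgt dj vge0.
rewrite coefsE //; have [_ _ /(_ j jd) H _ _] := EP t.
by move: H; rewrite (vgeMr _ _ (pvX _ (pvQ _))).
Qed.

(** The index at which the truncation is exact on [f] is overtaken by some [idx t], and truncations
    increase on the way. *)
Lemma block_stab f : (size f < size (Q lw))%N ->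
  exists t, forall v, vge v f -> trunc_ge (Q (idx t)) v f.
Proof.
have fr k : (k < lw)%O -> free_spec k by move=> /nonmax_lt; apply: free_specP.
move=> /(trunc_exact_limit lb ls fr)[i [il H]].
have [t it] := idx_cofinal (nxt_lt il); exists t => v /H.
exact: (nxt_limit_mono lb ls bounded_lw il (idx_nxt t) it (trunc_mulP (idx_nonmax t))).
Qed.

Local Notation exact_coef := (exact_coef nu (tGamma0 nu) phi bbar d coefs).
Local Notation large_coef :=
  (large_coef nu (fun t => bv (idx t)) (tGamma0 nu) phi bbar d coefs).

Lemma idx_size t : size (Q (idx t)) = size (Q (idx 0)).
Proof. by apply: size_block; apply: idx_nxt. Qed.

Lemma exists_good_index (p e0 : nat) : p \in [pchar K] -> d = (p ^ e0)%N ->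
  exists T, forall k : nat, (0 < k < d)%N ->
    (exact_coef k T /\ exists a, k = (p ^ a)%N) \/ large_coef k T.
Proof.
move=> pK dE.
have N1 : (1 < size (Q (idx 0)))%N by apply: size_key_gt1; apply: idx_nonmax.
have qm t : Q (idx t) \is monic by apply: key_monic.
have qb t : pv (Q (idx t)) = Fin (bv (idx t)) by apply: pvQ.
have qmul t : trunc_mul nu (Q (idx t)) by apply: trunc_mulP (idx_nonmax t).
have Gs (f : {poly K}) v : (size f < size (Q (idx 0)))%N -> pv f = Fin v -> tGamma0 nu v.
  exact: tGamma0_poly (idx_nonmax 0).
have cd t : (coefs t)`_d = 1 by rewrite coefsE //; case: (EP t).
have cgt t (j : nat) : (d < j)%N -> (coefs t)`_j = 0.
  by move=> dj; rewrite coef_poly ltnS leqNgt dj.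
have d0 : (0 < d)%N by apply: key_alpha_gt0.
have [T HT] := exact_or_large_uniform N1 qm idx_size qb bv_idx_lt qmul tGamma00 tGamma0B
  phi_emb Gb Gs bbar_gt bbar_lim d0 coefs_expansion cd cgt vge_coefs block_stab.
have [HT1 HT2] := HT T (leqnn _); exists T => k kd.
have [Hk|Hk] := HT2 k kd; last by right.
left; split=> //.
exact: (exact_coef_pow N1 qm idx_size qb bv_idx_lt qmul tGamma00 tGamma0B
  phi_emb Gb bbar_gt coefs_expansion cgt vge_coefs pK dE HT1 HT2 kd Hk).
Qed.

(** * Removal of the monomials with large coefficients *)

Section Replacement.
Variables (p T : nat).
Hypothesis good : forall k : nat, (0 < k < d)%N ->
  (exact_coef k T /\ exists a, k = (p ^ a)%N) \/ large_coef k T.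

Let Gbv k : (k < lw)%O -> tGamma0 nu (bv k).
Proof. by move=> /nonmax_lt; apply: tGamma0_bv. Qed.

(** The indices 0 and [d] are always kept, as condition (c) prescribes the value of the constant
    coefficient and the leading coefficient. *)
Definition dropped (j : nat) : bool := (0 < j < d)%N && `[< large_coef j T >].

Definition new_coefs (j : nat) : seq (K * exps) := if dropped j then [::] else E T j.

Definition limit_key_poly : {poly K} :=
  \sum_(j < d.+1) expn_eval Q (new_coefs j) * Q (idx T) ^+ j.

Let D : {poly K} := \sum_(j < d.+1 | dropped j) expn_eval Q (E T j) * Q (idx T) ^+ j.

Lemma limit_key_polyE : limit_key_poly = Q lw - D.
Proof.
have [[-> _] _ _ _ _] := EP T; apply/eqP; rewrite eq_sym subr_eq; apply/eqP.
rewrite /limit_key_poly /D [X in _ + X]big_mkcond -big_split; apply: eq_bigr => -[j jd] _ /=.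
rewrite /new_coefs; case: ifP => _; last by rewrite addr0.
by rewrite expn_eval_nil mul0r add0r.
Qed.

(** Condition (c) requires this at every [k] with [k+ = lw], before and after [idx T]. For [k] after
    [idx T], only the smaller value [b_(idx T)] is available for each factor [Q (idx T)], and the
    margin in [large_coef] makes up for it. *)
Lemma dropped_large k : nxt alpha setT k lw ->
  exists u, bv k *+ d < u /\ trunc_ge (Q k) u D.
Proof.
move=> kl; have klw := nxt_lt kl; have nk := nonmax_lt klw.
have qm := key_monic k; have q1 := size_key_gt1 nk.
pose P f := exists u, bv k *+ d < u /\ trunc_ge (Q k) u f.
apply: (big_ind P).
(* The empty sum satisfies any bound; [d] times a later value in the block is one above
   [bv k *+ d]. *)
- have [t kt] := idx_cofinal klw; exists (bv (idx t.+1) *+ d); split; last exact: trunc_ge0.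
  apply: oz_ltMn (key_alpha_gt0 lw).
  have [_ H] := value_spec (or_intror (idx_nonmax t.+1)); apply: H.
  exact: le_lt_trans kt (idx_lt (ltnSn t)).
- move=> f g [u [ku fu]] [v [kv gv]]; have [uv|vu] := leP (Fin u) (Fin v).
    by exists u; split=> //; apply: trunc_geD => //; apply: trunc_ge_le gv.
  exists v; split=> //; apply: trunc_geD => //; apply: trunc_ge_le fu.
  exact: (ltW vu : (Fin v <= Fin u)).
move=> [j jd1] /= /andP[/andP[j0 jd] /asboolP[w [Gw phiw wj]]].
have {wj}wj := wj T (leqnn T); rewrite coefsE ?(ltnW jd) // in wj.
have kb : phi (bv k) < bbar by apply: phi_block_lt.
have Tb := bbar_gt T.
have Gk := Gbv klw.
(* [c] is the smaller of the values of [Q k] and [Q (idx T)]. *)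
have [c [Gc kc Qc]] : exists c, [/\ tGamma0 nu c,
    d%:R * phi (bv k) < phi w + j%:R * phi c & trunc_ge (Q k) c (Q (idx T))].
  have dj0 : 0 <= d%:R * (bbar - phi (bv (idx T))) by rewrite mulr_ge0 // subr_ge0 ltW.
  have [kT|Tk] := leP k (idx T).
    exists (bv k); split=> //; last first.
      have bkT : bv k <= bv (idx T).
        move: kT; rewrite le_eqVlt => /orP[/eqP->//|kT].
        by have [_ /(_ _ kT)/ltW] := value_spec (or_intror (idx_nonmax T)).
      have sk := size_block (idx_nxt T) kl.
      rewrite -[Q (idx T)](subrK (Q k)); apply: trunc_geD; last exact: trunc_ge_q (pvQ k).
      apply/trunc_ge_small => //; first by rewrite -sk size_sub_monic // key_monic.
      by rewrite vgeB // (vgeP _ (pvQ _)).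
    have : 0 <= (d - j)%:R * (bbar - phi (bv k)) by rewrite mulr_ge0 // subr_ge0 ltW.
    move: phiw dj0; rewrite natrB ?(ltnW jd) //; lra.
  exists (bv (idx T)); split=> //; last first.
    have := nxt_limit_mono lb ls bounded_lw (idx_nxt T) kl (ltW Tk) (trunc_mulP nk).
    apply; exact: (trunc_ge_q (key_monic _) (size_key_gt1 (idx_nonmax T)) (pvQ _)).
  have : 0 < d%:R * (bbar - phi (bv k)).
    by rewrite mulr_gt0 ?subr_gt0 // ltr0n; apply: key_alpha_gt0.
  have : 0 <= (d - j)%:R * (bbar - phi (bv (idx T))) by rewrite mulr_ge0 // subr_ge0 ltW.
  move: phiw; rewrite natrB ?(ltnW jd) //; lra.
have G0 := tGamma00; have GB := tGamma0B.
exists (w + c *+ j); split.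
  have Gcj : tGamma0 nu (c *+ j) by apply: subgroupMn.
  rewrite -(phi_lt phi_emb) ?(phiD phi_emb) ?(phiMn G0 GB phi_emb) //; first exact: subgroupMn.
  exact: subgroupD.
apply: (trunc_geM qm q1 (pvQ k) (trunc_mulP nk)).
  apply/trunc_ge_small => //; rewrite (size_block kl (idx_nxt T)).
  have [[_ H] _ _ _ _] := EP T; apply: size_free (deg_specP (idx_nonmax T)) (H j _).
  by rewrite ltnW.
exact: (trunc_geX qm q1 (pvQ k) (trunc_mulP nk)).
Qed.

Lemma size_lw k : nxt alpha setT k lw -> size (Q lw) = (d * (size (Q k)).-1).+1.
Proof. by move=> kl; rewrite key_size (limit_deg lb ls bounded_lw kl). Qed.

Lemma size_D : (size D < size (Q lw))%N.
Proof.
have q1 := size_key_gt1 (idx_nonmax T).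
rewrite (size_lw (idx_nxt T)) ltnS.
pose e : {poly {poly K}} := \poly_(j < d.+1) (if dropped j then expn_eval Q (E T j) else 0).
apply: (q_expansion_lt_size (e := e) (key_monic _) q1); last first.
  move=> j dj; rewrite coef_poly /dropped; case: ifP => // _.
  by rewrite [(j < d)%N]ltnNge dj andbF.
split=> [|j].
  rewrite horner_poly /D big_mkcond; apply: eq_bigr => j _.
  by case: ifP => _ //; rewrite mul0r.
rewrite coef_poly; case: ifP => [|_]; last by rewrite size_poly0 ltnW.
rewrite ltnS => jd; case: ifP => _; last by rewrite size_poly0 ltnW.
by have [[_ H] _ _ _ _] := EP T; apply: size_free (deg_specP (idx_nonmax T)) (H j _).
Qed.

Lemma limit_key_poly_size : size limit_key_poly = size (Q lw).
Proof. by rewrite limit_key_polyE size_polyDl // size_polyN size_D. Qed.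

Lemma limit_key_poly_monic : limit_key_poly \is monic.
Proof.
by rewrite monicE limit_key_polyE lead_coefDl ?size_polyN ?size_D // -monicE key_monic.
Qed.

Lemma limit_key_poly_value k : nxt alpha setT k lw -> Fin (bv k *+ d) < pv limit_key_poly.
Proof.
move=> kl; have [u [ku /trunc_ge_vge Du]] := dropped_large kl.
have [e [_ _ _ _ kv]] := limit_key lb ls bounded_lw kl.
rewrite limit_key_polyE; apply: lt_le_trans (pvD_min _ _ _).
by rewrite lt_min pvQ vinf_ltE kv pvN; apply: vge_gt ku Du.
Qed.

(** Subtracting [D] leaves the leading coefficient unchanged, for reasons of degree, and also the
    value of the constant coefficient, since the truncation of [D] is above [bv k *+ d]. *)
Lemma limit_key_poly_expansion k : nxt alpha setT k lw -> exists e : {poly {poly K}},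
  [/\ q_expansion (Q k) limit_key_poly e, e`_d = 1, forall j : nat, (d < j)%N -> e`_j = 0,
      forall j : nat, vge (bv k *+ d) (e`_j * Q k ^+ j) & pv e`_0 = Fin (bv k *+ d)].
Proof.
move=> kl; have nk := nonmax_lt (nxt_lt kl); have qm := key_monic k.
have [u [ku [eD HD eDu]]] := dropped_large kl.
have [e [He e1 ev ev0 kv]] := limit_key lb ls bounded_lw kl.
have Hq := std_q_expansion (deg_specP nk) He; set eF := \poly_(j < _) _ in Hq.
have eD0 (j : nat) : (d <= j)%N -> eD`_j = 0.
  apply: q_expansion_coef0 qm HD _; rewrite -ltnS -size_lw //; exact: size_D.
exists (eF - eD); split.
- by rewrite limit_key_polyE; apply: q_expansionD Hq (q_expansionN HD).
- by rewrite coefB eD0 // subr0 coef_poly ltnSn.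
- by move=> j dj; rewrite coefB eD0 ?(ltnW dj) // coef_poly ltnS leqNgt dj subr0.
- move=> j; rewrite coefB mulrBl; apply: vgeB; last exact: vge_le (ltW ku) (eDu j).
  rewrite coef_poly ltnS; case: ifP => [jd|_]; first exact: ev.
  by rewrite mul0r vge0.
rewrite coefB coef_poly /= -ev0; apply: pvD_lt; rewrite ev0 pvN.
by have := eDu 0%N; rewrite expr0 mulr1; apply: vge_gt.
Qed.

Lemma limit_key_poly_std k : nxt alpha setT k lw ->
  exists e, std_expansion nu alpha Q k limit_key_poly d e.
Proof.
move=> kl; have [e [He _ egt _ _]] := limit_key_poly_expansion kl.
have nk := nonmax_lt (nxt_lt kl).
have /choice[s Hs] (j : nat) : exists s, free_std_expansion nu alpha Q k s /\ e`_j = expn_eval Q s.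
  by apply: free_specP => //; apply: He.2.
exists s; split=> [|j _]; last by case: (Hs j).
rewrite {1}He.1 (horner_coef_wide _ (_ : size e <= d.+1)%N); last by apply/leq_sizeP.
by apply: eq_bigr => j _; rewrite (Hs j).2.
Qed.

(** Condition (c) speaks of all standard expansions; their coefficients are those of the unique
    [Q k]-expansion. *)
Lemma limit_key_poly_std_spec k N e : nxt alpha setT k lw ->
  std_expansion nu alpha Q k limit_key_poly N e ->
  [/\ expn_eval Q (e d) = 1 \/ (N < d)%N, min_value nu Q k N e = Fin (bv k *+ d)
    & pv (expn_eval Q (e 0%N)) = Fin (bv k *+ d)].
Proof.
move=> kl He; have nk := nonmax_lt (nxt_lt kl).
have [e' [He' e1 egt ev ev0]] := limit_key_poly_expansion kl.
have Hq := std_q_expansion (deg_specP nk) He.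
have ee (j : nat) : (j <= N)%N -> expn_eval Q (e j) = e'`_j.
  by move=> jN; rewrite (q_expansion_uniq (key_monic k) He' Hq) coef_poly ltnS jN.
have dN : (d <= N)%N.
  rewrite leqNgt; apply/negP => Nd; have := e1.
  rewrite (q_expansion_uniq (key_monic k) He' Hq) coef_poly ltnS leqNgt Nd => /esym/eqP.
  by rewrite oner_eq0.
split; [by left; rewrite ee | | by rewrite ee].
rewrite /min_value; apply: le_anti; apply/andP; split.
  have /le_bigmin_ordP H := lexx (min_value nu Q k N e).
  have dN1 : (d < N.+1)%N by rewrite ltnS.
  by apply: le_trans (H (Ordinal dN1)) _; rewrite /= ee // e1 mul1r (pvX _ (pvQ k)).
by apply/le_bigmin_ordP => -[j jN] /=; rewrite (ee j jN); apply: ev.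
Qed.

Lemma new_coefs_free (j : nat) : (j <= d)%N -> free_std_expansion nu alpha Q (idx T) (new_coefs j).
Proof.
move=> jd; rewrite /new_coefs; case: ifP => _.
  by split=> //; rewrite big_nil expn_eval_nil pv0.
by have [[_ H] _ _ _ _] := EP T; apply: H.
Qed.

Lemma new_coefs_d : expn_eval Q (new_coefs d) = 1.
Proof. by rewrite /new_coefs /dropped ltnn andbF; case: (EP T). Qed.

Lemma new_coefs_kept (j : nat) : (0 < j < d)%N -> expn_eval Q (new_coefs j) <> 0 ->
  (exists a, j = (p ^ a)%N) /\ exists v, [/\ pv (expn_eval Q (new_coefs j)) = Fin v,
    tGamma0 nu v & phi v = (d - j)%:R * bbar].
Proof.
move=> jd; rewrite /new_coefs /dropped jd /=; case: asboolP => [_|nl _].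
  by rewrite expn_eval_nil.
have [[[v [Gv phiv ev]] ja]|//] := good jd; split=> //; exists v; split=> //.
by rewrite -coefsE ?ev //; case/andP: jd => _ /ltnW.
Qed.

Lemma limit_key_poly_trivial : d = 1%N -> limit_key_poly = Q lw.
Proof.
move=> d1; rewrite limit_key_polyE /D big_pred0 ?subr0 // => j.
apply/negP => /andP[/andP[j0 jd] _]; have : (1 < d)%N by apply: leq_ltn_trans jd.
by rewrite d1.
Qed.

End Replacement.
End Sequence.
End Block.

(** * Replacing the limit key polynomial *)

Section Transfer.
Variables (l lw : L) (Qw : {poly K}).
Hypotheses (lw_def : plus_omega l lw) (Qw_monic : Qw \is monic)
  (Qw_size : size Qw = size (Q lw))
  (Qw_std : forall k, nxt alpha setT k lw ->
     exists e, std_expansion nu alpha Q k Qw (alpha lw) e)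
  (Qw_value : forall k, nxt alpha setT k lw -> Fin (bv k *+ alpha lw) < pv Qw)
  (Qw_spec : forall k N e, nxt alpha setT k lw -> std_expansion nu alpha Q k Qw N e ->
     [/\ expn_eval Q (e (alpha lw)) = 1 \/ (N < alpha lw)%N,
         min_value nu Q k N e = Fin (bv k *+ alpha lw)
       & pv (expn_eval Q (e 0%N)) = Fin (bv k *+ alpha lw)]).
Local Notation Q' := (replace Q lw Qw).
Local Notation D := (upto lw).

Let ls k : ~ succ k lw. Proof. exact: plus_omega_not_succ lw_def. Qed.

Let lb : lw <> \bot%O.
Proof. by move=> E; have := plus_omega_lt lw_def; rewrite E ltx0. Qed.

Lemma replaceE i : (i < lw)%O -> Q' i = Q i.
Proof. by move=> il; rewrite /replace lt_eqF. Qed.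

Lemma replace_lw : Q' lw = Qw. Proof. by rewrite /replace eqxx. Qed.

Let Q'Q k i : (k < lw)%O -> (i <= k)%O -> Q' i = Q i.
Proof. by move=> kl ik; rewrite replaceE // (le_lt_trans ik). Qed.

Let QQ' k i : (k < lw)%O -> (i <= k)%O -> Q i = Q' i.
Proof. by move=> kl ik; rewrite (Q'Q kl). Qed.

(** As [lw] is a limit, [i + omega] does not exceed it when [i < lw]; being inessential thus means
    the same in both index sets. *)
Lemma nxt_upto_lw i j : (i < lw)%O -> nxt alpha D i j <-> nxt alpha setT i j.
Proof.
move=> il; split; first exact: nxt_upto_setT_lim lw_def il.
exact: nxt_setT_upto lw_def il.
Qed.

Lemma upto_nonmax i : D i -> ~ is_max D i -> (i < lw)%O.
Proof.
move=> il nm; rewrite lt_neqAle il andbT; apply/eqP => E; apply: nm.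
by rewrite E; split=> [|j //]; rewrite /upto /=.
Qed.

Lemma nxt_upto_le i j : nxt alpha D i j -> (i < lw)%O.
Proof. by move=> H; have [_ jl _] := H; apply: lt_le_trans (nxt_lt H) jl. Qed.

Lemma replace_pre_key : pre_key alpha Q' D.
Proof.
have [[_ a0 Q0 _] _ _ _ _] := Q_key; split=> //.
- move=> i il; split; last exact: key_alpha_gt0.
  by rewrite /replace; case: eqP => // _; apply: key_monic.
- by rewrite replaceE // lt_neqAle le0x andbT eq_sym; apply/eqP.
move=> i i0 il nm _ Hn; have ilw := upto_nonmax il nm.
have i0lw : (i0 < lw)%O by apply: lt_trans ilw; exact: nxt_lt Hn.
rewrite !replaceE //; apply: key_deg (nonmax_lt ilw) _.
by apply/nxt_upto_lw.
Qed.

Lemma replace_key_a : key_a nu Q' D.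
Proof.
move=> i il nm; have ilw := upto_nonmax il nm; rewrite replaceE //.
by have [_ Ha _ _ _] := Q_key; apply: Ha (nonmax_lt ilw).
Qed.

Lemma replace_key_b : key_b nu alpha Q' D.
Proof.
move=> i i' il i'i; have ilw : (i < lw)%O.
  rewrite lt_neqAle il andbT; apply/eqP => E; apply: (@ls i'); by rewrite -E.
have i'lw := lt_trans (succ_lt i'i) ilw.
have Q12 := fun j => @QQ' i' j i'lw.
have [_ _ /(_ i i' I i'i)[e [H1 H2 H3 H4]] _ _] := Q_key.
exists e; split.
- rewrite !replaceE // {1}H1; congr (_ + _); apply: eq_bigr => -[j ja] _ /=.
  by rewrite (expn_eval_ext Q12 (H2 j ja)).
- by move=> j ja; apply: free_std_expansion_ext Q12 _ (H2 j ja).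
- move=> j [c g] ja te; have [_ /(_ _ _ te)[_ gl _] _] := H2 j ja.
  by rewrite replaceE // -(term_eval_ext Q12 (t := (c, g)) gl) // H3.
rewrite -(initial_algebra_ext nu Q12) -(initial_relation_ext Q12 H2) replaceE //.
Qed.

(** The property involves only key polynomials below [lw], so that the minimality of the degree
    carries over to a replacement of the same degree. *)
Lemma limit_property_replace i f : (i <= lw)%O ->
  limit_property nu alpha Q' D i f <-> limit_property nu alpha Q setT i f.
Proof.
move=> ilw; split=> H k ki.
  have klw : (k < lw)%O by apply: lt_le_trans ilw; exact: nxt_lt ki.
  have [[N [e He]] Hm] := H k (proj2 (nxt_upto_lw _ klw) ki).
  split; first by exists N, e; exact: (std_expansion_ext (fun j => @Q'Q k j klw) He).
  move=> N' e' He'; have He'' := std_expansion_ext (fun j => @QQ' k j klw) He'.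
  by rewrite (min_value_ext (fun j => @QQ' k j klw) He'); apply: Hm.
have klw : (k < lw)%O := nxt_upto_le ki.
have [[N [e He]] Hm] := H k (proj1 (nxt_upto_lw _ klw) ki).
split; first by exists N, e; exact: (std_expansion_ext (fun j => @QQ' k j klw) He).
move=> N' e' He'; have He'' := std_expansion_ext (fun j => @Q'Q k j klw) He'.
by rewrite (min_value_ext (fun j => @Q'Q k j klw) He'); apply: Hm.
Qed.

Lemma replace_key_c : key_c nu alpha Q' D.
Proof.
move=> i il ib is_; have [_ _ _ /(_ i I ib is_)[H1 H2 H3 H4 H5] _] := Q_key.
have up k : nxt alpha setT k i -> nxt alpha D k i.
  move=> ki; apply/nxt_upto_lw => //; exact: lt_le_trans (nxt_lt ki) il.
have down k : nxt alpha D k i -> (k < lw)%O /\ nxt alpha setT k i.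
  by move=> ki; have klw := nxt_upto_le ki; split=> //; apply/nxt_upto_lw.
have [k0 k0i] := H1.
have stdQ k : nxt alpha D k i -> exists e, std_expansion nu alpha Q k (Q' i) (alpha i) e.
  move=> /down[klw ki]; have [ilw|] := boolP (i < lw)%O; first by rewrite replaceE //; apply: H2.
  move=> ilw; have ii : i = lw by apply: le_anti; rewrite il leNgt ilw.
  by rewrite ii replace_lw; apply: Qw_std; rewrite -ii.
split.
- by exists k0; apply: up.
- move=> k ki; have [e He] := stdQ k ki; have [klw _] := down _ ki.
  by exists e; exact: (std_expansion_ext (fun j => @QQ' k j klw) He).
- apply/limit_property_replace => //; have [ilw|ilw] := boolP (i < lw)%O; first by rewrite replaceE.
  have ii : i = lw by apply: le_anti; rewrite il leNgt ilw.
  rewrite ii replace_lw => k klw; split; first by have [e He] := Qw_std klw; exists (alpha lw), e.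
  by move=> N e He; have [_ -> _] := Qw_spec klw He; apply: Qw_value.
- move=> f /limit_property_replace => /(_ il) /H4.
  have [ilw|ilw] := boolP (i < lw)%O; first by rewrite replaceE.
  have ii : i = lw by apply: le_anti; rewrite il leNgt ilw.
  by rewrite ii replace_lw /deg Qw_size.
move=> _ k e /down[klw ki] He.
have Heq := std_expansion_ext (fun j => @Q'Q k j klw) He.
have free (j : nat) : (j <= alpha i)%N -> expn_eval Q' (e j) = expn_eval Q (e j).
  by case: He => _ He /He; apply: expn_eval_ext => m; apply: Q'Q.
rewrite !free // (min_value_ext (fun j => @Q'Q k j klw) He) (replaceE klw).
have [ilw|ilw] := boolP (i < lw)%O.
  by rewrite replaceE // in Heq; apply: H5 => //; right; apply: nonmax_lt ilw.
have ii : i = lw by apply: le_anti; rewrite il leNgt ilw.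
rewrite ii replace_lw in Heq ki *; have [E1 E2 E3] := Qw_spec ki Heq.
by rewrite E2 E3 (pvX _ (pvQ k)); case: E1; rewrite ?ltnn.
Qed.

(* In the second case only [lw] has the degree of [Q lw], so that the condition is
   void in this degree. *)
Lemma replace_key_d : Qw = Q lw \/ (forall j, (j < lw)%O -> (deg (Q j) < deg (Q lw))%N) ->
  key_d nu Q D -> key_d nu Q' D.
Proof.
move=> [-> |Hd] Hkd.
  have -> : replace Q lw (Q lw) = Q by apply/funext => i; rewrite /replace; case: eqP => // ->.
  by [].
have degE i : deg (Q' i) = deg (Q i).
  by rewrite /replace; case: eqP => // ->; rewrite /deg Qw_size.
move=> n; have -> : [set i | D i /\ deg (Q' i) = n] = [set i | D i /\ deg (Q i) = n].
  by apply/seteqP; split=> i /=; rewrite degE.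
move=> Hinf f fm fn; have [i [Di di fi]] := Hkd n Hinf f fm fn.
have [ilw|ilw] := boolP (i < lw)%O; first by exists i; rewrite replaceE.
have ii : i = lw by apply: le_anti; rewrite Di leNgt ilw.
case: Hinf; apply: (@sub_finite_set _ _ [set lw]); last exact: finite_set1.
move=> j [jl dj] /=; apply/eqP; apply: contraT => jlw.
have := Hd j; rewrite lt_neqAle jlw jl => /(_ isT).
by rewrite dj -di ii ltnn.
Qed.

End Transfer.

End Keys.

Theorem proposition9p2
    (K : fieldType) (V : ozmodType) (nu : valuation (ratfun K) V)
    (tensorV : is_tensor_rat (value_group nu))
    (rank1 : rank_one (value_group (nuK nu)))
    (x_pos : Fin 0 < pv nu 'X)
    (R : realType) (phi : V -> R)
    (phi_emb : ordered_embedding (tGamma0 nu) phi)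
    (d : Order.disp_t) (L : bOrderType d)
    (L_wo : well_ordered L) (L_count : countable [set: L])
    (alpha : L -> nat) (Q : L -> {poly K})
    (Q_key : key_polynomials nu alpha Q [set: L])
    (p : nat) (pchar_residue : p \in [pchar residue_field nu])
    (pchar_K : p \in [pchar K])
    (l lw : L) (lw_def : plus_omega l lw)
    (alpha1 : forall t i, (0 < t)%N -> plus_nat l t i -> alpha i = 1%N)
    (bounded : exists2 b, tGamma0 nu b &
       forall t i, (0 < t)%N -> plus_nat l t i -> pv nu (Q i) <= Fin b)
    (bbar : R)
    (bbar_def : bbar = sup [set phi v | v in
       [set v | exists t i,
          [/\ (0 < t)%N, plus_nat l t i & pv nu (Q i) = Fin v]]])
    (delta e0 : nat)
    (delta_stable : exists t0, forall t i, (t0 <= t)%N -> plus_nat l t i ->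
       is_delta nu (Q i) (Q lw) delta)
    (delta_def : delta = (p ^ e0)%N) :
  exists Qw : {poly K},
  let Q' := replace Q lw Qw in
  let D := upto lw in
  [/\ Qw \is monic,
      [/\ pre_key alpha Q' D, key_a nu Q' D, key_b nu alpha Q' D,
          key_c nu alpha Q' D & key_d nu Q D -> key_d nu Q' D]
    & exists t i e,
      [/\ plus_nat l t i,
          std_expansion nu alpha Q' i Qw delta e /\
            expn_eval Q' (e delta) = 1,
          weakly_affine Q' p delta e,
          forall s k, (0 < s)%N -> plus_nat l s k ->
            pv nu (Q k ^+ (p ^ e0)) <= pv nu Qw
        & forall j, (0 < j <= delta)%N -> expn_eval Q' (e j) <> 0 ->
            exists v, [/\ pv nu (expn_eval Q' (e j)) = Fin v, tGamma0 nu v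
              & phi v = (p ^ e0 - j)%N%:R * bbar]]].
Proof.
have /choice[idx idxP] t : exists i, plus_nat l t.+1 i.
  by have [i li _] := lw_def.1 t.+1; exists i.
have ls k : ~ succ k lw by apply: plus_omega_not_succ lw_def.
have lb : lw <> \bot%O by move=> E; have := plus_omega_lt lw_def; rewrite E ltx0.
have blw := bounded_lw L_wo Q_key x_pos lw_def alpha1 bounded.
have inxt t : nxt alpha setT (idx t) lw by exact: (block_nxt lw_def alpha1 (ltn0Sn t) (idxP t)).
have /choice[E EP] t := limit_key Q_key lb ls blw (inxt t).
have cE := coefs_expansion L_wo Q_key lw_def alpha1 idxP EP.
(* The leading term [Q_i^(alpha lw)] attains the least value [alpha lw * b_i] of the terms of the
   expansion, so that the largest such index is the degree of the expansion in [Q_i]. *)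
have deltaE : delta = alpha lw.
  have [t0 Ht0] := delta_stable; have [e He [[ed _] emax]] := Ht0 _ _ (leqnSn t0) (idxP t0).
  rewrite (q_expansion_uniq (key_monic Q_key _) He (cE t0)) in ed emax.
  apply/eqP; rewrite eqn_leq; apply/andP; split.
    by move: ed; rewrite coef_poly ltnS; case: leqP; rewrite ?eqxx.
  have c1 : (coefs alpha Q lw E t0)`_(alpha lw) = 1.
    by rewrite coefsE //; have [_ -> _ _ _] := EP t0.
  apply: emax => /=; rewrite c1 oner_eq0; split=> //; rewrite mul1r.
  apply: le_anti; apply/andP; split.
    apply/le_bigmin_ordP => -[j js] /=; rewrite (pvX _ (pvQ Q_key _)).
    have := vge_coefs Q_key EP t0 j; rewrite -(vgeMr _ _ (pvX _ (pvQ Q_key _))).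
    by [].
  have ds : (alpha lw < size (coefs alpha Q lw E t0))%N.
    by rewrite ltnNge; apply/negP => /leq_sizeP/(_ _ (leqnn _))/eqP; rewrite c1 oner_eq0.
  have /le_bigmin_ordP H := lexx (trunc_value nu (Q (idx t0)) (coefs alpha Q lw E t0)).
  by apply: le_trans (H (Ordinal ds)) _; rewrite /= c1 mul1r.
have dE : alpha lw = (p ^ e0)%N by rewrite -deltaE.
have [T good] := exists_good_index L_wo Q_key x_pos phi_emb lw_def alpha1 bounded idxP
  bbar_def EP pchar_K dE.
pose Qw := limit_key_poly nu alpha Q phi lw idx bbar E T.
have Wsize : size Qw = size (Q lw).
  exact: (limit_key_poly_size L_wo Q_key x_pos phi lw_def alpha1 bounded idxP bbar EP).
have Wmonic : Qw \is monic.
  exact: (limit_key_poly_monic L_wo Q_key x_pos phi lw_def alpha1 bounded idxP bbar EP).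
have Wval := limit_key_poly_value L_wo Q_key x_pos phi_emb lw_def alpha1 bounded idxP
  bbar_def EP T.
have Wstd := limit_key_poly_std L_wo Q_key x_pos phi_emb lw_def alpha1 bounded idxP
  bbar_def EP T.
have Wspec := limit_key_poly_std_spec L_wo Q_key x_pos phi_emb lw_def alpha1 bounded idxP
  bbar_def EP (T := T).
have a0 := key_alpha_gt0 Q_key lw.
have Tlw : (idx T < lw)%O := nxt_lt (inxt T).
exists Qw => Q' D; split=> //.
  split.
  - exact: (replace_pre_key Q_key lw_def Wmonic).
  - exact: (replace_key_a Q_key).
  - exact: (replace_key_b Q_key Qw lw_def).
  - exact: (replace_key_c Q_key lw_def Wsize Wstd Wval Wspec).
  apply: (replace_key_d Wsize).
  (* If [alpha lw = 1], no index lies strictly between 0 and [alpha lw] and nothing is dropped;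
     otherwise [deg (Q lw)] exceeds all earlier degrees. *)
  have [a1|a1] := eqVneq (alpha lw) 1%N.
    by left; apply: limit_key_poly_trivial EP _ a1.
  right=> j jlw; rewrite (limit_deg L_wo Q_key lb ls blw (inxt 0)).
  have H := deg_lt_lw L_wo Q_key x_pos lw_def alpha1 bounded (inxt 0) jlw.
  apply: leq_ltn_trans H _; rewrite -[ltnLHS]mul1n ltn_pmul2r.
    by rewrite ltn_neqAle eq_sym a1.
  by have [] := deg_specP L_wo Q_key (nonmax_lt (nxt_lt (inxt 0))).
pose e := new_coefs nu alpha Q phi lw idx bbar E T.
have eQ j : (j <= alpha lw)%N -> free_std_expansion nu alpha Q (idx T) (e j).
  exact: new_coefs_free.
have QQ' i : (i <= idx T)%O -> Q i = Q' i.
  by move=> iT; rewrite /Q' replaceE // (le_lt_trans iT).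
have eE j : (j <= alpha lw)%N -> expn_eval Q' (e j) = expn_eval Q (e j).
  by move=> jd; rewrite (expn_eval_ext QQ' (eQ j jd)).
have e1 : expn_eval Q (e (alpha lw)) = 1 by apply: new_coefs_d.
(* [idx T] is [l + (T + 1)]. *)
exists T.+1, (idx T), e; rewrite deltaE; split=> //.
- split; last by rewrite eE.
  by apply: (std_expansion_ext QQ'); split.
- move=> j /andP[j0 jd] npow; rewrite eE //; apply: contrapT => ej.
  move: jd; rewrite leq_eqVlt => /orP[/eqP jE|jd]; first by apply: (npow e0); rewrite jE dE.
  have jd' : (0 < j < alpha lw)%N by rewrite j0.
  by have [[a /npow]] := new_coefs_kept good jd' ej.
- move=> s k s0 lk; rewrite (plus_natE idxP s0 lk) -dE (pvX _ (pvQ Q_key _)).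
  exact: ltW (Wval _ (inxt _)).
move=> j /andP[j0 jd]; rewrite eE // => ej.
move: jd; rewrite leq_eqVlt => /orP[/eqP jE|jd].
  (* The leading coefficient 1 has value 0, in accordance with [(p^e0 - p^e0) bbar = 0]. *)
  exists 0; rewrite jE e1 pv1 dE subnn mul0r; split=> //; first exact: tGamma00.
  by apply: (phi0 _ phi_emb); apply: tGamma00.
have jd' : (0 < j < alpha lw)%N by rewrite j0.
by have [_] := new_coefs_kept good jd' ej; rewrite dE.
Qed.
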